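(* Let $2\le k<l$ be integers and let $\mathfrak g^{I}_{k,l}$ be the Lie algebra of symmetries of first kind of the system $y^{(k)}(x)=0$, $z^{(l)}(x)=0$. Then $\mathfrak g^{I}_{k,l}$ is spanned over $\mathbb R$ by (the prolongations to $\mathcal E$ of) the following vector fields on $J^{0}(\mathbb R,\mathbb R^2)=\mathbb R^3$ with coordinates $(x,y,z)$. (1) If $k=2$, $l>2$: (i) $\frac{\partial}{\partial x},\ \frac{\partial}{\partial y}$; (ii) $x\frac{\partial}{\partial x},\ x\frac{\partial}{\partial y},\ y\frac{\partial}{\partial x},\ y\frac{\partial}{\partial y},\ z\frac{\partial}{\partial z}$; (iii) $x^2\frac{\partial}{\partial x}+xy\frac{\partial}{\partial y}+(l-1)xz\frac{\partial}{\partial z}$ and $xy\frac{\partial}{\partial x}+y^2\frac{\partial}{\partial y}+(l-1)yz\frac{\partial}{\partial z}$; (iv) $x^iy^j\frac{\partial}{\partial z}$ with $i,j\ge 0$, $0\le i+j\le l-1$. Algebraically, $\mathfrak g^{I}_{2,l}$ is isomorphic to the semidirect product $\mathfrak{gl}(3,\mathbb R)\ltimes S^{l-1}(\mathbb R^3)$, where the subalgebra $\mathfrak{gl}(3,\mathbb R)$ is spanned by (i)--(iii) and the commutative ideal $S^{l-1}(\mathbb R^3)$ is spanned by (iv). (2) If $2<k<l$: (i) $\frac{\partial}{\partial x},\ x\frac{\partial}{\partial x},\ x^2\frac{\partial}{\partial x}+(k-1)xy\frac{\partial}{\partial y}+(l-1)xz\frac{\partial}{\partial z},\ y\frac{\partial}{\partial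 y},\ z\frac{\partial}{\partial z}$; (ii) $\frac{\partial}{\partial y},\ x\frac{\partial}{\partial y},\dots,x^{k-1}\frac{\partial}{\partial y}$; (iii) $x^iy^j\frac{\partial}{\partial z}$ with $i,j\ge 0$, $0\le i+(k-1)j\le l-1$. Algebraically, $\mathfrak g^{I}_{k,l}$ is isomorphic to $\bigl((\mathbb R\times\mathfrak{gl}(2,\mathbb R))\ltimes V_k\bigr)\ltimes\Bigl(\sum_{i=0}^{[l/k]}V_{l-ki}\Bigr)$, where $V_r$ is an $r$-dimensional irreducible representation of $\mathfrak{gl}(2,\mathbb R)$ and $[\,\cdot\,]$ is the integer part; the subalgebra $\mathbb R\times\mathfrak{gl}(2,\mathbb R)$ is spanned by (i), the subalgebra $V_k$ is spanned by (ii), and the commutative ideal $\sum_{i=0}^{[l/k]}V_{l-ki}$ is spanned by (iii).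
   Context: Equation manifold. $\mathcal E$ is the manifold $\mathbb R^{k+l+1}$ with coordinates $(x,y_0,\dots,y_{k-1},z_0,\dots,z_{l-1})$, where $y_0=y$, $z_0=z$ (it is the submanifold of the jet space cut out by the system $y^{(k)}=0$, $z^{(l)}=0$). Put $$X=\frac{\partial}{\partial x}+\sum_{i=0}^{k-2}y_{i+1}\frac{\partial}{\partial y_i}+\sum_{j=0}^{l-2}z_{j+1}\frac{\partial}{\partial z_j},\qquad E=\langle X\rangle,$$ $$F_1=\Bigl\langle \frac{\partial}{\partial y_i}\ (1\le i\le k-1),\ \frac{\partial}{\partial z_j}\ (1\le j\le l-1)\Bigr\rangle .$$ Symmetries of first kind are the (smooth) vector fields $S$ on $\mathcal E$ with $[S,E]\subset E$ and $[S,F_1]\subset F_1$. Prolongation. The prolongation to $\mathcal E$ of a vector field $A\frac{\partial}{\partial x}+B\frac{\partial}{\partial y}+C\frac{\partial}{\partial z}$ on $\mathbb R^3$ is the vector field $A\frac{\partial}{\partial x}+\sum_{i=0}^{k-1}B_i\frac{\partial}{\partial y_i}+\sum_{j=0}^{l-1}C_j\frac{\partial}{\partial z_j}$ with $B_0=B$, $C_0=C$, $B_{i+1}=X(B_i)-y_{i+1}X(A)$, $C_{j+1}=X(C_j)-z_{j+1}X(A)$. In semidirect products $\mathfrak h\ltimes\mathfrak i$ the ideal is $\mathfrak i$.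
   Formalization: In part (2) the ideal is taken as the sum of V_{l-(k-1)i} for 0≤i≤[l/(k-1)] (V_0=0) instead of V_{l-ki} for 0≤i≤[l/k]: the printed sum has the wrong dimension for the span of (iii), e.g. 5 instead of 6 for k=3, l=4. *)

(* Defs.v *)
From HB Require Import structures.
From mathcomp Require Import all_boot all_order all_algebra.
From mathcomp Require Import ring.

Set Implicit Arguments.
Unset Strict Implicit.
Unset Printing Implicit Defensive.

Import GRing.Theory.
Local Open Scope ring_scope.

Record lieAlgebra (R : fieldType) := LieAlgebra {
  lie_space :> lmodType R;
  lie_bracket : lie_space -> lie_space -> lie_space;
  lie_linearl : forall y, linear (lie_bracket^~ y);
  lie_linearr : forall x, linear (lie_bracket x);
  lie_alternating : forall x, lie_bracket x x = 0;
  lie_jacobi : forall x y z,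
    lie_bracket x (lie_bracket y z) + lie_bracket y (lie_bracket z x)
      + lie_bracket z (lie_bracket x y) = 0 }.

Record lieRep (R : fieldType) (L : lieAlgebra R) (V : lmodType R) := LieRep {
  lie_act :> L -> V -> V;
  lie_act_linearl : forall v, linear (lie_act^~ v);
  lie_act_linearr : forall x, linear (lie_act x);
  lie_act_bracket : forall x y v,
    lie_act (lie_bracket x y) v
      = lie_act x (lie_act y v) - lie_act y (lie_act x v) }.

Definition irreducible_rep (R : fieldType) (L : lieAlgebra R) (V : vectType R)
    (rho : lieRep L V) : Prop :=
  (fullv : {vspace V}) <> 0%VS /\
  forall U : {vspace V},
    (forall x v, v \in U -> rho x v \in U) -> U = 0%VS \/ U = fullv.

Section LinearAux.
Variables (R : pzRingType) (U V : lmodType R) (f : U -> V) (hf : linear f).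

Lemma linear_fD x y : f (x + y) = f x + f y.
Proof. by rewrite -[x]scale1r hf !scale1r. Qed.

Lemma linear_f0 : f 0 = 0.
Proof. by apply: (@addrI _ (f 0)); rewrite -linear_fD !addr0. Qed.

Lemma linear_fN x : f (- x) = - f x.
Proof. by apply/eqP; rewrite -subr_eq0 opprK -linear_fD addNr linear_f0. Qed.

Lemma linear_fZ a x : f (a *: x) = a *: f x.
Proof. by rewrite -[a *: x]addr0 hf linear_f0 addr0. Qed.

Lemma linear_fB x y : f (x - y) = f x - f y.
Proof. by rewrite linear_fD linear_fN. Qed.

End LinearAux.

Lemma lie_anti (R : fieldType) (L : lieAlgebra R) (x y : L) :
  lie_bracket x y = - lie_bracket y x.
Proof.
apply/eqP; rewrite -subr_eq0 opprK; apply/eqP.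
have := lie_alternating (x + y).
rewrite (linear_fD (lie_linearr _)) !(linear_fD (lie_linearl _)).
by rewrite !lie_alternating add0r addr0 addrC.
Qed.

Section Abelian.
Variables (R : fieldType) (V : lmodType R).
Let br (_ _ : V) : V := 0.
Fact abelian_linear : linear (fun _ : V => 0 : V).
Proof. by move=> a x y; rewrite scaler0 addr0. Qed.
Fact abelian_jacobi x y z : br x (br y z) + br y (br z x) + br z (br x y) = 0.
Proof. by rewrite /br !addr0. Qed.
Definition lie_abelian : lieAlgebra R :=
  @LieAlgebra R V br (fun _ => abelian_linear) (fun _ => abelian_linear)
    (fun _ => erefl) abelian_jacobi.
End Abelian.

Section Gl.
Variables (R : fieldType) (n : nat).

Let br (A B : 'M[R]_n) := A *m B - B *m A.

Fact gl_linearl B : linear (br^~ B).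
Proof.
by move=> a A A'; rewrite /br mulmxDl mulmxDr -scalemxAl -scalemxAr scalerBr
  opprD addrACA.
Qed.

Fact gl_linearr A : linear (br A).
Proof.
by move=> a B B'; rewrite /br mulmxDl mulmxDr -scalemxAl -scalemxAr scalerBr
  opprD addrACA.
Qed.

Fact gl_alternating A : br A A = 0.
Proof. exact: subrr. Qed.

Fact gl_jacobi A B C : br A (br B C) + br B (br C A) + br C (br A B) = 0.
Proof.
rewrite /br !mulmxBl !mulmxBr !mulmxA !opprB.
by apply/matrixP=> i j; rewrite !mxE; ring.
Qed.

Definition gl : lieAlgebra R :=
  LieAlgebra gl_linearl gl_linearr gl_alternating gl_jacobi.

End Gl.

Section DirectProduct.
Variables (R : fieldType) (L1 L2 : lieAlgebra R).
Let br (x y : L1 * L2) : L1 * L2 :=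
  (lie_bracket x.1 y.1, lie_bracket x.2 y.2).

Fact lie_prod_linearl y : linear (br^~ y).
Proof. by move=> a x x'; congr (_, _); apply: lie_linearl. Qed.

Fact lie_prod_linearr x : linear (br x).
Proof. by move=> a y y'; congr (_, _); apply: lie_linearr. Qed.

Fact lie_prod_alternating x : br x x = 0.
Proof. by congr (_, _); apply: lie_alternating. Qed.

Fact lie_prod_jacobi x y z : br x (br y z) + br y (br z x) + br z (br x y) = 0.
Proof. by congr (_, _); apply: lie_jacobi. Qed.

Definition lie_prod : lieAlgebra R :=
  LieAlgebra lie_prod_linearl lie_prod_linearr
    lie_prod_alternating lie_prod_jacobi.

End DirectProduct.

(* The semidirect product of L with the commutative ideal V. *)
Section Semidirect.
Variables (R : fieldType) (L : lieAlgebra R) (V : lmodType R).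
Variable rho : lieRep L V.
Let br (x y : L * V) : L * V :=
  (lie_bracket x.1 y.1, rho x.1 y.2 - rho y.1 x.2).

Fact semidirect_linearl y : linear (br^~ y).
Proof.
move=> a x x'; congr (_, _); first exact: lie_linearl.
by rewrite /= lie_act_linearl lie_act_linearr scalerBr opprD addrACA.
Qed.

Fact semidirect_linearr x : linear (br x).
Proof.
move=> a y y'; congr (_, _); first exact: lie_linearr.
by rewrite /= lie_act_linearl lie_act_linearr scalerBr opprD addrACA.
Qed.

Fact semidirect_alternating x : br x x = 0.
Proof. by congr (_, _); [apply: lie_alternating | apply: subrr]. Qed.

Let zmod_jacobi (a b c d e f : V) :
  (a - b - (c - d)) + (c - e - (f - b)) + (f - d - (a - e)) = 0.
Proof.
rewrite !opprB [c - e + _]addrC [a - b + _ + _]addrACA !subrKA addrACA subrKA.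
by rewrite [d - e + _]subrKA subrKA subrr.
Qed.

Fact semidirect_jacobi x y z :
  br x (br y z) + br y (br z x) + br z (br x y) = 0.
Proof.
congr (_, _); first exact: lie_jacobi.
rewrite /= !(linear_fB (lie_act_linearr rho _)) !lie_act_bracket.
exact: zmod_jacobi.
Qed.

Definition semidirect : lieAlgebra R :=
  LieAlgebra semidirect_linearl semidirect_linearr
    semidirect_alternating semidirect_jacobi.

End Semidirect.

Section DirectSum.
Variables (R : fieldType) (L : lieAlgebra R) (N : nat) (p : 'I_N -> nat).
Variable V : forall i, lieRep L 'cV[R]_(p i).
Let act (x : L) (w : 'cV[R]_(\sum_i p i)) : 'cV[R]_(\sum_i p i) :=
  \mxcol_i V i x (submxcol w i).

Let submxcol_linear i : linear (fun w : 'cV[R]_(\sum_i p i) => submxcol w i).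
Proof. by move=> a u v; apply/matrixP=> s t; rewrite !mxE. Qed.

Fact rep_sum_linearl w : linear (act^~ w).
Proof.
move=> a x y; apply/mxcolP => i.
by rewrite submxcol_linear !mxcolK lie_act_linearl.
Qed.

Fact rep_sum_linearr x : linear (act x).
Proof.
move=> a u v; apply/mxcolP => i.
by rewrite [RHS]submxcol_linear !mxcolK submxcol_linear lie_act_linearr.
Qed.

Fact rep_sum_bracket x y w :
  act (lie_bracket x y) w = act x (act y w) - act y (act x w).
Proof.
apply/mxcolP => i.
by rewrite (linear_fB (@submxcol_linear i)) !mxcolK lie_act_bracket.
Qed.

Definition rep_sum : lieRep L 'cV[R]_(\sum_i p i) :=
  LieRep rep_sum_linearl rep_sum_linearr rep_sum_bracket.

End DirectSum.

Module SymmetricPower.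
From mathcomp Require Import mpoly.
Section SymmetricPower.
Variables (R : fieldType) (n d : nat).
Implicit Types (A B : 'M[R]_n) (p : {mpoly R[n]}).

(* The derivation of the polynomial ring that sends 'X_j to the image
   \sum_i A i j *: 'X_i of the j-th basis vector under A. *)
Definition gl_der A p : {mpoly R[n]} :=
  \sum_i \sum_j A i j *: ('X_i * mderiv j p).

Fact gl_der_homog A p : p \is d.-homog -> gl_der A p \is d.-homog.
Proof.
move=> hp; apply: rpred_sum => i _; apply: rpred_sum => j _; apply: rpredZ.
rewrite [p]mpolyE raddf_sum mulr_sumr big_seq; apply: rpred_sum => m hm.
rewrite /= mderivZ mderivX -!scalerAr; apply: rpredZ.
have [->|mj] := eqVneq (m j) 0%N; first by rewrite scale0r rpred0.
apply: rpredZ; rewrite -mpolyXD dhomogX /= mdegD mdeg1.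
have /dhomogP/(_ _ hm) <- := hp.
have mU : (U_(j) <= m)%MM by rewrite lep1mP.
by rewrite -[X in _ == mdeg X](submK mU) mdegD mdeg1 addnC.
Qed.

Fact gl_der_linearl p : linear (gl_der^~ p).
Proof.
move=> a A B; rewrite /gl_der scaler_sumr -big_split /=; apply: eq_bigr => i _.
rewrite scaler_sumr -big_split /=; apply: eq_bigr => j _.
by rewrite !mxE scalerDl scalerA.
Qed.

Fact gl_der_linearr A : linear (gl_der A).
Proof.
move=> a p q; rewrite /gl_der scaler_sumr -big_split /=.
apply: eq_bigr => i _; rewrite scaler_sumr -big_split /=.
apply: eq_bigr => j _.
by rewrite linearP mulrDr -scalerAr scalerDr !scalerA mulrC.
Qed.

Fact gl_derM A p q : gl_der A (p * q) = gl_der A p * q + p * gl_der A q.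
Proof.
rewrite /gl_der mulr_suml mulr_sumr -big_split /=; apply: eq_bigr => i _.
rewrite mulr_suml mulr_sumr -big_split /=; apply: eq_bigr => j _.
by rewrite mderivM mulrDr scalerDr -scalerAl -scalerAr -mulrA [p * ('X_i * _)]mulrCA.
Qed.

Fact gl_derX A k : gl_der A 'X_k = \sum_i A i k *: 'X_i.
Proof.
apply: eq_bigr => i _; rewrite (bigD1 k) //= big1 => [|j jk].
  by rewrite addr0 mderivX mnm1E eqxx scale1r -{1}[U_(k)%MM]add0m addmK mpolyX0 mulr1.
by rewrite mderivX mnm1E eq_sym (negPf jk) scale0r mulr0 scaler0.
Qed.

Fact gl_der_bracket A B p :
  gl_der (lie_bracket (A : gl R n) B) p
    = gl_der A (gl_der B p) - gl_der B (gl_der A p).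
Proof.
have derB C D : gl_der C (gl_der D p) = gl_der (C *m D) p
    + \sum_i \sum_j \sum_k \sum_l (C k l * D i j)
        *: ('X_k * 'X_i * (mderiv l (mderiv j p))).
  have lC := gl_der_linearr C.
  rewrite {2}/gl_der (big_morph _ (linear_fD lC) (linear_f0 lC)).
  under eq_bigr => i _.
    rewrite (big_morph _ (linear_fD lC) (linear_f0 lC)).
    under eq_bigr => j _.
      rewrite (linear_fZ lC) gl_derM gl_derX scalerDr; over.
    rewrite big_split; over.
  rewrite big_split /=; congr (_ + _).
    rewrite exchange_big /= [RHS]exchange_big /=; apply: eq_bigr => j _.
    under eq_bigr => i _ do rewrite mulr_suml scaler_sumr.
    rewrite exchange_big; apply: eq_bigr => k _; rewrite !mxE scaler_suml.
    by apply: eq_bigr => i _; rewrite -scalerAl scalerA mulrC.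
  apply: eq_bigr => i _; apply: eq_bigr => j _.
  rewrite mulr_sumr scaler_sumr; apply: eq_bigr => k _.
  rewrite mulr_sumr scaler_sumr; apply: eq_bigr => l _.
  by rewrite -scalerAr scalerA mulrC mulrCA mulrA.
rewrite !derB opprD addrACA [X in _ + X](_ : _ = 0) ?addr0.
  by rewrite (linear_fB (gl_der_linearl p)).
apply/eqP; rewrite subr_eq0; apply/eqP.
have pairE (F : 'I_n -> 'I_n -> 'I_n -> 'I_n -> {mpoly R[n]}) :
    \sum_i \sum_j \sum_k \sum_l F i j k l =
    \sum_(u : 'I_n * 'I_n) \sum_(v : 'I_n * 'I_n) F u.1 u.2 v.1 v.2.
  rewrite pair_bigA; apply: eq_bigr => u _; exact: pair_bigA.
rewrite !pairE exchange_big; apply: eq_bigr => u _; apply: eq_bigr => v _ /=.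
by rewrite mderiv_comm mulrC ['X_(v.1) * _]mulrC.
Qed.

(* Sym^d of the standard representation, as the homogeneous polynomials of
   degree d in the basis vectors 'X_0, ..., 'X_(n-1) of R^n. *)
Definition sym_space : lmodType R := dhomog n R d.

Definition sym_act (A : gl R n) (p : sym_space) : sym_space :=
  DHomog (gl_der_homog A (dhomog_is_dhomog p)).

Fact sym_act_linearl (p : sym_space) : linear (sym_act^~ p).
Proof. by move=> a A B; apply: val_inj; rewrite /= gl_der_linearl. Qed.

Fact sym_act_linearr A : linear (sym_act A).
Proof. by move=> a p q; apply: val_inj; rewrite /= gl_der_linearr. Qed.

Fact sym_act_bracket (A B : gl R n) (p : sym_space) :
  sym_act (lie_bracket A B) p = sym_act A (sym_act B p) - sym_act B (sym_act A p).
Proof. by apply: val_inj; rewrite /= gl_der_bracket. Qed.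

Definition sym_pow : lieRep (gl R n) sym_space :=
  LieRep sym_act_linearl sym_act_linearr sym_act_bracket.

End SymmetricPower.
End SymmetricPower.

From mathcomp Require Import all_classical all_reals all_analysis.
Import numFieldNormedType.Exports.
Local Open Scope classical_set_scope.
Local Open Scope ring_scope.

Fixpoint Ck (R : realType) (V W : normedModType R) (n : nat) (f : V -> W)
    : Prop :=
  if n is n'.+1 then
    (forall p, differentiable f p) /\ (forall v, Ck n' ('D_v f))
  else continuous f.

Definition smooth (R : realType) (V W : normedModType R) (f : V -> W) : Prop :=
  forall n, Ck n f.

Definition lin_span (R : pzRingType) (M : lmodType R) (s : seq M) : set M :=
  [set v | exists c : nat -> R, v = \sum_(i < size s) c i *: s`_i].

Section EquationManifold.
Variables (R : realType) (k l : nat).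

(* R^(k+l+1), with coordinates numbered x, y_0, ..., y_(k-1),
   z_0, ..., z_(l-1). *)
Definition eqn_mfd := 'rV[R]_(k + l).+1.

Definition x_idx : 'I_(k + l).+1 := ord0.
(* [y_idx i] is only meaningful for i < k, and [z_idx j] for j < l. *)
Definition y_idx (i : nat) : 'I_(k + l).+1 := inord i.+1.
Definition z_idx (j : nat) : 'I_(k + l).+1 := inord (k + j).+1.

Definition x_ (p : eqn_mfd) : R := p ord0 x_idx.
Definition y_ (i : nat) (p : eqn_mfd) : R := p ord0 (y_idx i).
Definition z_ (j : nat) (p : eqn_mfd) : R := p ord0 (z_idx j).

Definition vfield := eqn_mfd -> eqn_mfd.

Definition d_dx : vfield := fun=> delta_mx ord0 x_idx.
Definition d_dy (i : nat) : vfield := fun=> delta_mx ord0 (y_idx i).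
Definition d_dz (j : nat) : vfield := fun=> delta_mx ord0 (z_idx j).

Definition vf_bracket (S T : vfield) : vfield :=
  fun p => 'D_(S p) T p - 'D_(T p) S p.

(* The sections of the distribution spanned by the vector fields in s. *)
Definition distribution (s : seq vfield) : set vfield :=
  [set V | exists c : nat -> eqn_mfd -> R,
     (forall i, smooth (c i)) /\
     V = fun p => \sum_(i < size s) c i p *: s`_i p].

Definition X_field : vfield := fun p =>
  d_dx p + \sum_(0 <= i < k.-1) y_ i.+1 p *: d_dy i p
         + \sum_(0 <= j < l.-1) z_ j.+1 p *: d_dz j p.

Definition E_dist : set vfield := distribution [:: X_field].

Definition F1_dist : set vfield :=
  distribution ([seq d_dy i | i <- iota 1 k.-1] ++
                [seq d_dz j | j <- iota 1 l.-1]).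

Definition sym_first_kind : set vfield :=
  [set S : vfield | [/\ smooth S,
     (forall V, E_dist V -> E_dist (vf_bracket S V)) &
     (forall V, F1_dist V -> F1_dist (vf_bracket S V))]].

Definition X_der (f : eqn_mfd -> R) : eqn_mfd -> R := fun p => 'D_(X_field p) f p.

(* With u = y_ (resp. z_), the coefficients B_i (resp. C_j) of the
   prolongation of A d/dx + B d/dy + C d/dz. *)
Fixpoint prol_coef (u : nat -> eqn_mfd -> R) (A B : eqn_mfd -> R) (i : nat)
    : eqn_mfd -> R :=
  if i is i'.+1 then
    fun p => X_der (prol_coef u A B i') p - u i'.+1 p * X_der A p
  else B.

End EquationManifold.

Arguments sym_first_kind R k l : clear implicits.

(* A vector field A d/dx + B d/dy + C d/dz on R^3, given by the map
   (x, y, z) |-> (A, B, C). *)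
Definition vfield3 (R : realType) := R -> R -> R -> R * R * R.

Definition prolong (R : realType) (k l : nat) (V : vfield3 R) : vfield R k l :=
  let V' (p : eqn_mfd R k l) := V (x_ p) (y_ 0 p) (z_ 0 p) in
  let A p := (V' p).1.1 in
  let B p := (V' p).1.2 in
  let C p := (V' p).2 in
  fun p => A p *: d_dx p
    + \sum_(0 <= i < k) prol_coef (@y_ R k l) A B i p *: d_dy i p
    + \sum_(0 <= j < l) prol_coef (@z_ R k l) A C j p *: d_dz j p.

Arguments prolong {R} k l V.

Section Generators.
Variables (R : realType).

Definition prol_span (k l : nat) (s : seq (vfield3 R)) : set (vfield R k l) :=
  lin_span [seq prolong k l V | V <- s].

Definition gens1_i : seq (vfield3 R) :=
  [:: fun x y z => (1, 0, 0); fun x y z => (0, 1, 0)].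

Definition gens1_ii : seq (vfield3 R) :=
  [:: fun x y z => (x, 0, 0); fun x y z => (0, x, 0); fun x y z => (y, 0, 0);
      fun x y z => (0, y, 0); fun x y z => (0, 0, z)].

Definition gens1_iii (l : nat) : seq (vfield3 R) :=
  [:: fun x y z => (x ^+ 2, x * y, l.-1%:R * x * z);
      fun x y z => (x * y, y ^+ 2, l.-1%:R * y * z)].

Definition gens1_iv (l : nat) : seq (vfield3 R) :=
  [seq (fun x y z => (0, 0, x ^+ ij.1 * y ^+ ij.2))
     | ij <- [seq (i, j) | i <- iota 0 l, j <- iota 0 l]
     & (ij.1 + ij.2 <= l.-1)%N].

Definition gens2_i (k l : nat) : seq (vfield3 R) :=
  [:: fun x y z => (1, 0, 0); fun x y z => (x, 0, 0);
      fun x y z => (x ^+ 2, k.-1%:R * x * y, l.-1%:R * x * z);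
      fun x y z => (0, y, 0); fun x y z => (0, 0, z)].

Definition gens2_ii (k : nat) : seq (vfield3 R) :=
  [seq (fun x y z => (0, x ^+ i, 0)) | i <- iota 0 k].

(* For k > 1, the constraint i + (k-1) j <= l - 1 forces i, j < l; for a fixed
   j it leaves l - (k-1) j values of i. *)
Definition gens2_iii (k l : nat) : seq (vfield3 R) :=
  [seq (fun x y z => (0, 0, x ^+ ij.1 * y ^+ ij.2))
     | ij <- [seq (i, j) | i <- iota 0 l, j <- iota 0 l]
     & (ij.1 + k.-1 * ij.2 <= l.-1)%N].

End Generators.

Arguments prol_span {R} k l s.
Arguments gens1_i {R}.
Arguments gens1_ii {R}.
Arguments gens1_iii {R} l.
Arguments gens1_iv {R} l.
Arguments gens2_i {R} k l.
Arguments gens2_ii {R} k.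
Arguments gens2_iii {R} k l.


(* phi is an isomorphism from L onto the Lie algebra (g, br); the bracket br
   needs to be a Lie bracket only on the subspace g. *)
Definition is_lie_iso (R : fieldType) (M : lmodType R) (br : M -> M -> M)
    (L : lieAlgebra R) (g : set M) (phi : L -> M) : Prop :=
  [/\ linear phi, injective phi,
      (forall a b, phi (lie_bracket a b) = br (phi a) (phi b)) &
      range phi = g].

(* Main.v *)
(* In characteristic form Q = (B - y_1 A, C - z_1 A), a field with components
   (A, B, C) is a symmetry iff X^k (B - y_1 A) = 0 and X^l (C - z_1 A) = 0, that
   is, iff along every solution curve (t, y(t), z(t)), with y and z polynomials
   of degrees < k and < l, the functions B - y' A and C - z' A are polynomials
   of degrees < k and < l.  Interpolation turns this into algebra.  As k < l, z
   can be changed at one of k + 1 points without changing B - y' A at the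
   others, so A and B do not depend on z; the same device makes C affine in z.
   Then z |-> c z - z' a, where a and c are A and the z-coefficient of C along
   the curve, preserves the polynomials of degree < l, which forces deg a <= 2.
   A function that is polynomial of bounded degree on all lines y = c_0 + c_1 x
   is a polynomial, and the curves y = s x^(k-1) bound its weighted degree and
   relate the top coefficients of A, B and C.
   For k = 2 the solutions form the projective action of gl(3), extended by the
   forms of degree l - 1 in (x, y, 1); for k > 2 they are built from the action
   of gl(2) on binary forms in the chart (x, 1). *)

Require Import Defs.
From HB Require Import structures.
From mathcomp Require Import all_boot all_order all_algebra.
From mathcomp Require Import ring zify.
Set Implicit Arguments.
Unset Strict Implicit.
Unset Printing Implicit Defensive.
Import Order.TTheory GRing.Theory Num.Theory.
Local Open Scope ring_scope.

(** * Functions polynomial along solution curves *)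

(** One analytic obstacle shapes the classification: vanishing second differences in z do not by
    themselves make a function affine, since additive functions can be wild. This implication is
    isolated as the hypothesis [hC], discharged later by differentiability; everything else about A,
    B, C is algebra over a [numFieldType]. On the manifold, a field S with [S, X] proportional to X,
    whose components along x, y_0, z_0 depend on x, y_0, z_0 alone, is the prolongation of these
    components. By Jacobi's identity brackets of such fields are proportional in the same way, so
    brackets need to be compared on R^3 only. A field a d/dx + b d/dy + c z d/dz acts on a vertical
    field Q d/dz by sending Q to a Q_x + b Q_y - c Q; the signs in the embeddings of the matrices
    make this the natural action on forms. For k > 2 the coefficient of y^j in Q has degree at most
    l - 1 - (k-1) j in x, so the summands of the ideal are V_(l - (k-1) j) with j up to the integer
    part of l / (k-1): the step is k - 1, the maximal degree of a solution y, and not k. *)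

Section PolyFun.
Variable F : numFieldType.
Implicit Types (p q : {poly F}) (f g : F -> F).

Lemma horner_eq p q : (forall t, p.[t] = q.[t]) -> p = q.
Proof.
move=> h; apply/eqP; rewrite -subr_eq0; apply/eqP.
apply: (@roots_geq_poly_eq0 F _ [seq i%:R | i <- iota 0 (size (p - q))]).
- by apply/allP=> t _; rewrite rootE hornerD hornerN h subrr.
- by rewrite map_inj_uniq ?iota_uniq // => i j /eqP; rewrite eqr_nat => /eqP.
- by rewrite size_map size_iota.
Qed.

Definition poly_fun n f := exists2 p : {poly F}, (size p <= n)%N & forall t, f t = p.[t].

Lemma poly_fun_horner n p : poly_fun n (horner p) <-> (size p <= n)%N.
Proof.
split=> [[q qn h]|]; last by exists p.
by rewrite (_ : p = q) //; apply: horner_eq.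
Qed.

Lemma poly_fun_ext n f g : f =1 g -> poly_fun n f -> poly_fun n g.
Proof. by move=> fg [p pn h]; exists p => // t; rewrite -fg. Qed.

Lemma poly_funD n f g :
  poly_fun n f -> poly_fun n g -> poly_fun n (fun t => f t + g t).
Proof.
move=> [p pn hf] [q qn hg]; exists (p + q) => [|t]; last by rewrite hornerD hf hg.
by rewrite (leq_trans (size_polyD _ _)) // geq_max pn.
Qed.

Lemma poly_funZ n f a : poly_fun n f -> poly_fun n (fun t => a * f t).
Proof.
move=> [p pn hf]; exists (a *: p) => [|t]; last by rewrite hornerZ hf.
exact: leq_trans (size_scale_leq _ _) pn.
Qed.

Lemma poly_funB n f g :
  poly_fun n f -> poly_fun n g -> poly_fun n (fun t => f t - g t).
Proof.
move=> hf /(poly_funZ (-1)) hg.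
by apply: poly_fun_ext (poly_funD hf hg) => t; rewrite mulN1r.
Qed.

Lemma poly_fun_eq0 n f (s : seq F) : poly_fun n f -> uniq s -> (n <= size s)%N ->
  {in s, forall t, f t = 0} -> forall t, f t = 0.
Proof.
move=> [p pn h] us ns f0 t; rewrite h (@roots_geq_poly_eq0 _ p s) ?horner0 //.
- by apply/allP=> x xs; rewrite rootE -h f0.
- exact: leq_trans ns.
Qed.

Lemma bump_poly (s : seq F) x h : x \notin s ->
  exists p : {poly F}, [/\ (size p <= (size s).+1)%N, p.[x] = h & {in s, forall t, p.[t] = 0}].
Proof.
move=> xs; pose q := \prod_(t <- s) ('X - t%:P); exists ((h / q.[x]) *: q); split.
- by rewrite (leq_trans (size_scale_leq _ _)) // size_prod_XsubC.
- rewrite hornerZ divfK // -rootE /q root_prod_XsubC //.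
- move=> t ts; rewrite hornerZ (_ : q.[t] = 0) ?mulr0 //.
  by apply/eqP; rewrite -rootE /q root_prod_XsubC.
Qed.

(** The points x + m + 1, ..., x + m + n avoid x. The offset m allows two node sets shifted by one
    against each other in [second_difference]. *)
Definition nodes x m n : seq F := [seq x + i%:R | i <- iota m.+1 n].

Lemma nodes_uniq x m n : uniq (nodes x m n).
Proof.
rewrite map_inj_uniq ?iota_uniq // => i j /addrI/eqP.
by rewrite eqr_nat => /eqP.
Qed.

Lemma nodes_notin x m n : x \notin nodes x m n.
Proof.
apply/mapP=> -[i]; rewrite mem_iota => /andP[i0 _] /eqP.
by rewrite -subr_eq0 opprD addNKr oppr_eq0 pnatr_eq0; case: i i0.
Qed.

Lemma size_nodes x m n : size (nodes x m n) = n.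
Proof. by rewrite size_map size_iota. Qed.

(* A polynomial of degree at most n can be changed at one point while keeping
   its values at n others. *)
Lemma poly_fun_indep n (f : F -> F -> F) :
  (forall u : {poly F}, (size u <= n.+1)%N -> poly_fun n (fun t => f t u.[t])) ->
  forall x (u v : F), f x u = f x v.
Proof.
move=> hf x u v; have [p [sp px ps]] := bump_poly (v - u) (nodes_notin x 0 n).
rewrite size_nodes in sp.
(* Both test curves are admissible, so this difference has degree below n; it vanishes at the n
   nodes where the curves agree, hence also at x. *)
have pf : poly_fun n (fun t => f t u - f t (u%:P + p).[t]).
  apply: poly_funB.
    apply: (poly_fun_ext (f := fun t => f t u%:P.[t])).
      by move=> t; rewrite hornerC.
    by apply: hf; rewrite (leq_trans (size_polyC_leq1 _)).
  apply: hf; rewrite (leq_trans (size_polyD _ _)) // geq_max sp andbT.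
  by rewrite (leq_trans (size_polyC_leq1 _)).
have := poly_fun_eq0 pf (nodes_uniq x 0 n).
rewrite size_nodes => /(_ (leqnn _)) H.
apply/eqP; rewrite -subr_eq0; apply/eqP.
have <- : (u%:P + p).[x] = v by rewrite hornerD hornerC px addrC subrK.
by apply: H => t ts; rewrite hornerD hornerC ps // addr0 subrr.
Qed.

(** In the alternating sum over z, z + p, z + q, z + p + q the terms with [a] cancel, because
    differentiation is linear. The zeros of p and q are shifted by one, so each of the n points x +
    1, ..., x + n is a zero of p or of q and annihilates the sum. It therefore vanishes at x, where
    p and q take the values h and h'. *)
Lemma second_difference n (g : F -> F -> F) (a : F -> F) : (1 < n)%N ->
  (forall z : {poly F}, (size z <= n)%N ->
     poly_fun n (fun t => g t z.[t] - (z^`()).[t] * a t)) ->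
  forall x z h h', g x (z + h + h') - g x (z + h) - g x (z + h') + g x z = 0.
Proof.
case: n => // n n0 hg x z h h'.
have [p [sp px ps]] := bump_poly h (nodes_notin x 0 n).
have [q [sq qx qs]] := bump_poly h' (nodes_notin x 1 n).
rewrite !size_nodes in sp sq.
have sz : (size z%:P <= n.+1)%N by rewrite (leq_trans (size_polyC_leq1 _)).
have sD (u v : {poly F}) : (size u <= n.+1 -> size v <= n.+1 -> size (u + v)%R <= n.+1)%N.
  by move=> su sv; rewrite (leq_trans (size_polyD _ _)) // geq_max su.
pose G t := g t (z%:P + p + q).[t] - g t (z%:P + p).[t] - g t (z%:P + q).[t]
            + g t z%:P.[t].
have GP : poly_fun n.+1 G.
  have := poly_funD (poly_funB (poly_funB (hg _ (sD _ _ (sD _ _ sz sp) sq))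
     (hg _ (sD _ _ sz sp))) (hg _ (sD _ _ sz sq))) (hg _ sz).
  by apply: poly_fun_ext => t; rewrite /G !derivD derivC !hornerD horner0; ring.
have := poly_fun_eq0 GP (nodes_uniq x 0 n.+1).
rewrite size_nodes => /(_ (leqnn _)) H.
have {H} : G x = 0.
  apply: H => t /mapP[i]; rewrite mem_iota => /andP[i0 iN] ->.
  rewrite /G !hornerD !hornerC; have [iN'|iN'] := ltnP i n.+1.
    rewrite ps; last by apply/map_f; rewrite mem_iota; lia.
    by rewrite addr0; ring.
  rewrite qs; last by apply/map_f; rewrite mem_iota; lia.
  by rewrite !addr0; ring.
by rewrite /G !hornerD !hornerC px qx.
Qed.

(** The choice z = 1 makes c a polynomial, and z = x then makes a one. For z = x^m the terms of
    degree n and above must vanish, which is [co]. Comparing m = n - 1 with m = n - 2, both positive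
    as n > 2, removes all coefficients of a above degree 2; m = n - 1 alone gives the relation
    between the top coefficients. *)
Lemma degree_bound n (a c : F -> F) : (2 < n)%N ->
  (forall z : {poly F}, (size z <= n)%N ->
     poly_fun n (fun t => c t * z.[t] - (z^`()).[t] * a t)) ->
  exists2 p : {poly F}, (size p <= 3)%N /\ a =1 horner p &
  exists2 q : {poly F}, (size q <= 2)%N /\ c =1 horner q & q`_1 = n.-1%:R * p`_2.
Proof.
move=> n3 h.
have [q0 sq hq] : poly_fun n c.
  apply: poly_fun_ext (h 1 _) => [t|]; last by rewrite size_poly1; lia.
  by rewrite hornerC mulr1 derivC horner0 mul0r subr0.
have [p0 hp] : exists p : {poly F}, a =1 horner p.
  have [|r sr hr] := h 'X; first by rewrite size_polyX; lia.
  exists (q0 * 'X - r) => t; rewrite !hornerE -hr -hq derivX !hornerE.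
  by ring.
have {}h (z : {poly F}) : (size z <= n)%N -> (size (q0 * z - z^`() * p0)%R <= n)%N.
  move=> /h; rewrite -poly_fun_horner; apply: poly_fun_ext => t.
  by rewrite !hornerE hp hq.
have co m j : (0 < m < n)%N -> (n <= j + m)%N -> q0`_j = m%:R * p0`_j.+1.
  case: m => // m /andP[_ mn] nj.
  have /h : (size ('X^(m.+1) : {poly F})%R <= n)%N by rewrite size_polyXn.
  move=> /leq_sizeP /(_ _ nj); rewrite coefB derivXn /= coefMXn.
  rewrite mulrnAl coefMn coefXnM addnK !ifN; [|by lia|by lia].
  rewrite (_ : (j + m.+1 - m = j.+1)%N); last by lia.
  by rewrite mulr_natl => /eqP; rewrite subr_eq0 => /eqP.
have p00 j : (2 < j)%N -> p0`_j = 0.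
  case: j => // j j2.
  have e1 := co n.-1 j ltac:(lia) ltac:(lia).
  have e2 := co n.-2 j ltac:(lia) ltac:(lia).
  have : n.-1%:R * p0`_j.+1 - n.-2%:R * p0`_j.+1 = 0 by rewrite -e1 -e2 subrr.
  rewrite (_ : n.-1 = n.-2.+1); last by lia.
  by rewrite -mulrBl -natr1 [_ + 1]addrC addrK mul1r.
exists p0.
  by split=> //; apply/leq_sizeP => j; apply: p00.
exists q0; last by apply: co; lia.
split=> //; apply/leq_sizeP => j j2.
by rewrite (co n.-1 j) ?p00 ?mulr0 //; lia.
Qed.

End PolyFun.

(** * Bivariate polynomials and weighted degree *)

Section Bivariate.
Variable F : numFieldType.
Implicit Types (p u : {poly F}) (P Q : {poly {poly F}}).

(* The outer variable of [{poly {poly F}}] stands for y, the inner one for x. *)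
Definition ev Q (x y : F) : F := Q.[y%:P].[x].

Lemma evD P Q x y : ev (P + Q) x y = ev P x y + ev Q x y.
Proof. by rewrite /ev !hornerE. Qed.
Lemma evN P x y : ev (- P) x y = - ev P x y.
Proof. by rewrite /ev !hornerE. Qed.
Lemma evM P Q x y : ev (P * Q) x y = ev P x y * ev Q x y.
Proof. by rewrite /ev !hornerE. Qed.
Lemma evC p x y : ev p%:P x y = p.[x].
Proof. by rewrite /ev !hornerE. Qed.
Lemma evX x y : ev 'X x y = y.
Proof. by rewrite /ev !hornerE. Qed.
Lemma ev0 x y : ev 0 x y = 0.
Proof. by rewrite /ev !hornerE. Qed.

Lemma ev_sum I (r : seq I) (P : pred I) (G : I -> {poly {poly F}}) x y :
  ev (\sum_(i <- r | P i) G i) x y = \sum_(i <- r | P i) ev (G i) x y.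
Proof. by elim/big_rec2: _ => [|i a b _ <-]; rewrite ?ev0 ?evD. Qed.

Lemma ev_prod I (r : seq I) (P : pred I) (G : I -> {poly {poly F}}) x y :
  ev (\prod_(i <- r | P i) G i) x y = \prod_(i <- r | P i) ev (G i) x y.
Proof.
by elim/big_rec2: _ => [|i a b _ <-]; rewrite ?evM // /ev !hornerE.
Qed.

Lemma ev_coef Q x y n : (size Q <= n)%N ->
  ev Q x y = \sum_(j < n) (Q`_j).[x] * y ^+ j.
Proof.
move=> sQ; rewrite /ev (horner_coef_wide _ sQ) horner_sum.
by apply: eq_bigr => j _; rewrite hornerM horner_exp hornerC.
Qed.

Lemma ev_curve Q u t : ev Q t u.[t] = Q.[u].[t].
Proof.
rewrite (ev_coef _ _ (leqnn _)) [Q.[u]]horner_coef horner_sum.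
by apply: eq_bigr => j _; rewrite hornerM horner_exp.
Qed.

Lemma ev_inj P Q : (forall x y, ev P x y = ev Q x y) -> P = Q.
Proof.
move=> h; suff H R' : (forall x y, ev R' x y = 0) -> R' = 0.
  by apply/subr0_eq/H => x y; rewrite evD evN h subrr.
move=> h0; apply/polyP=> j; rewrite coef0; apply: horner_eq => x; rewrite horner0.
have : \poly_(i < size R') (R'`_i).[x] = 0.
  apply: horner_eq => y; rewrite horner_poly horner0.
  by rewrite -(ev_coef _ _ (leqnn _)) h0.
move/(congr1 (fun p : {poly F} => p`_j)); rewrite coef_poly coef0.
by case: ltnP => // sj _; rewrite nth_default // horner0.
Qed.

(* Along the parallel lines y = t + i the function is known, and each
   horizontal line meets them in nodes whose differences do not depend on y. *)
Lemma poly_fun_lines n (f : F -> F -> F) :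
  (forall u, (size u <= 2)%N -> poly_fun n (fun t => f t u.[t])) ->
  exists Q, forall x y, f x y = ev Q x y.
Proof.
move=> hf.
have hl (i : 'I_n) : exists g : {poly F}, forall t, f t (t + i%:R) = g.[t].
  have [|g _ hg] := hf ('X + i%:R%:P); first by rewrite size_XaddC.
  by exists g => t; rewrite -hg hornerD hornerX hornerC.
have [g hg] := fin_all_exists hl.
pose sh (i : nat) : {poly {poly F}} := 'X - i%:R%:P.
(* Lagrange interpolation in x at the nodes y - i, where f takes the value g_i (y - i). The
   denominators j - i are constants, so the formula is polynomial in y too. *)
exists (\sum_(i < n) (map_poly polyC (g i) \Po sh i)
    * \prod_(j < n | j != i) (('X%:P - sh j) * (j%:R - i%:R)^-1%:P%:P)).
move=> x y; rewrite ev_sum.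
have [p sp hp] : poly_fun n (fun t => f t y).
  apply: poly_fun_ext (hf y%:P _) => [t|]; first by rewrite hornerC.
  by rewrite (leq_trans (size_polyC_leq1 _)).
have evsh i t : ev (sh i) t y = y - i%:R.
  by rewrite evD evX evN -polyC_natr evC !hornerE.
have evg (i : 'I_n) t : ev (map_poly polyC (g i) \Po sh i) t y = (g i).[y - i%:R].
  rewrite /ev horner_comp /sh -polyC_natr !hornerE -polyCB.
  by rewrite horner_map /= hornerC.
rewrite hp; under eq_bigr => i _.
  rewrite evM evg -hg subrK ev_prod.
  under eq_bigr => j _ do rewrite evM evD evN evsh !evC hornerX hornerC.
  over.
pose q := \sum_(i < n) (f (y - i%:R) y)%:P
    * \prod_(j < n | j != i) (('X - (y - j%:R)%:P) * (j%:R - i%:R)^-1%:P).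
transitivity q.[x]; last first.
  rewrite horner_sum; apply: eq_bigr => i _; rewrite hornerM hornerC horner_prod.
  by congr (_ * _); apply: eq_bigr => j _; rewrite !hornerE.
apply/eqP; rewrite -subr_eq0 -hornerN -hornerD; apply/eqP.
apply: (@poly_fun_eq0 _ n (horner (p - q)) [seq y - i%:R | i <- iota 0 n]).
- apply/poly_fun_horner; rewrite (leq_trans (size_polyD _ _)) // geq_max sp size_polyN.
  apply: (leq_trans (size_sum _ _ _)); apply/bigmax_leqP => i _.
  apply: (leq_trans (size_polyMleq _ _)).
  have s1 := size_polyC_leq1 (f (y - i%:R) y).
  set pr := \prod_(j < n | _) _.
  suff s2 : (size pr <= n)%N.
    by rewrite -subn1 leq_subLR leq_add.
  apply: (leq_trans (size_prod_leq _ _)).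
  have -> : #|[pred j | j != i]| = n.-1 by rewrite cardC1 card_ord.
  have : (\sum_(j < n | j != i)
      size (('X - (y - j%:R)%:P) * (j%:R - i%:R)^-1%:P : {poly F})%R
    <= \sum_(j < n | j != i) 2)%N.
    apply: leq_sum => j _; apply: (leq_trans (size_polyMleq _ _)).
    rewrite size_XsubC -subn1 leq_subLR.
    by rewrite -[(1 + 2)%N]/(2 + 1)%N leq_add2l size_polyC_leq1.
  rewrite sum_nat_const cardC1 card_ord leq_subLR => hs.
  by apply: (leq_ltn_trans hs); have := ltn_ord i; lia.
- rewrite map_inj_uniq ?iota_uniq // => i j /addrI/eqP.
  by rewrite eqr_opp eqr_nat => /eqP.
- by rewrite size_map size_iota.
move=> t /mapP[i]; rewrite mem_iota /= add0n => iN ->.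
rewrite hornerD hornerN -hp horner_sum (bigD1 (Ordinal iN)) //=.
rewrite [X in _ - (_ + X)]big1 ?addr0.
  rewrite hornerM hornerC horner_prod big1 ?mulr1 ?subrr // => j ji.
  rewrite !hornerE (_ : y - i%:R - (y - j%:R) = j%:R - i%:R); last by ring.
  by rewrite divff // subr_eq0 eqr_nat.
move=> j ji; rewrite hornerM horner_prod (bigD1 (Ordinal iN)) ?(eq_sym _ j) //=.
by rewrite hornerM hornerXsubC subrr !mul0r mulr0.
Qed.

Definition weight_lt m n Q := forall i j, (n <= i + m * j)%N -> (Q`_j)`_i = 0.

(* The part of weight [N] of [Q], where x has weight 1 and y weight [m],
   evaluated at x = 1. *)
Definition weight_part m N Q : {poly F} :=
  \poly_(j < size Q) (if (m * j <= N)%N then (Q`_j)`_(N - m * j) else 0).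

Lemma coef_weight_part m N Q j :
  (weight_part m N Q)`_j = if (m * j <= N)%N then (Q`_j)`_(N - m * j) else 0.
Proof.
rewrite coef_poly; case: ltnP => // sj; rewrite [Q`_j]nth_default // coef0.
by case: ifP.
Qed.

(** On y = s x^m the monomial x^i y^j becomes s^j x^(i + m j): weight turns into degree, and the
    power of s separates monomials of equal weight. *)
Lemma coef_weight_curve m N Q (s : F) :
  (Q.[s%:P * 'X^m])`_N = (weight_part m N Q).[s].
Proof.
rewrite horner_poly horner_coef coef_sum; apply: eq_bigr => j _.
rewrite exprMn -exprM -polyC_exp mulrCA coefCM mulrC; congr (_ * _).
by rewrite coefMXn ltnNge if_neg.
Qed.

Lemma weight_ltP m n Q :
  (forall s, poly_fun n (horner Q.[s%:P * 'X^m])) -> weight_lt m n Q.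
Proof.
move=> h i j nij; have : weight_part m (i + m * j) Q = 0.
  apply: horner_eq => s; rewrite -coef_weight_curve horner0.
  by have /poly_fun_horner/leq_sizeP := h s; apply.
move/(congr1 (fun p : {poly F} => p`_j)).
by rewrite coef_weight_part leq_addl addnK coef0.
Qed.

Lemma size_weight_curve m n Q u : weight_lt m n Q -> (size u <= m.+1)%N ->
  (size Q.[u] <= n)%N.
Proof.
move=> wQ su; rewrite horner_coef; apply: (leq_trans (size_sum _ _ _)).
apply/bigmax_leqP => j _; have [->|Qj] := eqVneq Q`_j 0.
  by rewrite mul0r size_poly0.
apply: (leq_trans (size_polyMleq _ _)).
have h1 := size_exp_leq u j.
have h2 : (size (Q`_j)%R + m * j <= n)%N.
  case E : (size Q`_j) => [|i]; first by move: Qj; rewrite -size_poly_eq0 E.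
  rewrite leqNgt; apply/negP => hn; have := wQ i j.
  rewrite -ltnS -addSn => /(_ hn) /eqP.
  by rewrite -[i]/(i.+1.-1) -E -lead_coefE lead_coef_eq0 (negPf Qj).
have h3 : ((size u).-1 * j <= m * j)%N by rewrite leq_mul2r; lia.
by move: (size (u ^+ j)) h1 => e h1; lia.
Qed.
End Bivariate.

(** * Fields that preserve the solution curves to first order *)

Section Classification.
Variables (F : numFieldType) (k l : nat).

(* The vector field A d/dx + B d/dy + C d/dz maps the solution curves
   (t, y(t), z(t)) of the system to solutions, to first order. *)
Definition curve_cond (A B C : F -> F -> F -> F) :=
  forall y z : {poly F}, (size y <= k)%N -> (size z <= l)%N ->
    poly_fun k (fun t => B t y.[t] z.[t] - (y^`()).[t] * A t y.[t] z.[t]) /\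
    poly_fun l (fun t => C t y.[t] z.[t] - (z^`()).[t] * A t y.[t] z.[t]).

Variables A B C : F -> F -> F -> F.
Hypotheses (hk : (1 < k)%N) (hkl : (k < l)%N) (hABC : curve_cond A B C).
(** Non-affine additive functions also have vanishing second differences. Over the reals this
    implication follows from differentiability in z, by [affine_second_difference]. *)
Hypothesis hC : forall x y,
  (forall z h h',
     C x y (z + h + h') - C x y (z + h) - C x y (z + h') + C x y z = 0) ->
  forall z, C x y z = (C x y 1 - C x y 0) * z + C x y 0.

Let size_cst (c : F) n : (0 < n)%N -> (size c%:P <= n)%N.
Proof. by move=> n0; rewrite (leq_trans (size_polyC_leq1 _)). Qed.

(** A constant curve y removes the term y' A, and k < l admits curves z of degree k, one above the
    degree bound k - 1 of B: exactly the freedom that [poly_fun_indep] exploits. *)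
Let B_indep x y z z' : B x y z = B x y z'.
Proof.
apply: (@poly_fun_indep _ k (fun x z => B x y z)) => u su.
have [h _] := hABC (size_cst y (ltnW hk)) (leq_trans su hkl).
by apply: poly_fun_ext h => t; rewrite derivC !hornerC mul0r subr0.
Qed.

(** On the line of slope 1 through (x, y) the condition concerns B - A, and B is already known to be
    free of z. *)
Let A_indep x y z z' : A x y z = A x y z'.
Proof.
pose Y := 'X - (x - y)%:P : {poly F}.
have Yx : Y.[x] = y by rewrite !hornerE opprB addrC subrK.
have := @poly_fun_indep _ k (fun x z => B x Y.[x] z - A x Y.[x] z) _ x z z'.
rewrite Yx (B_indep x y z z') => H; apply/oppr_inj/(@addrI _ (B x y z')).
apply: H => u su.
have sY : (size Y <= k)%N by rewrite size_XsubC.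
have [h _] := hABC sY (leq_trans su hkl).
by apply: poly_fun_ext h => t; rewrite derivB derivX derivC subr0 hornerC mul1r.
Qed.

Let C_affine x y z : C x y z = (C x y 1 - C x y 0) * z + C x y 0.
Proof.
apply: hC => {}z h h'.
apply: (@second_difference _ l (fun x z => C x y z) (fun x => A x y 0)).
  exact: ltn_trans hkl.
move=> u su; have [_ g] := hABC (size_cst y (ltnW hk)) su.
by apply: poly_fun_ext g => t; rewrite !hornerC (A_indep _ _ _ 0).
Qed.

Let c1 x y := C x y 1 - C x y 0.

Let C0_poly (y : {poly F}) : (size y <= k)%N -> poly_fun l (fun t => C t y.[t] 0).
Proof.
move=> sy; have [_ h] := hABC sy (size_cst 0 (leq_ltn_trans (leq0n k) hkl)).
by apply: poly_fun_ext h => t; rewrite derivC !hornerC mul0r subr0.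
Qed.

Let Ac1_poly (y : {poly F}) : (size y <= k)%N ->
  exists2 p : {poly F}, (size p <= 3)%N /\ (fun t => A t y.[t] 0) =1 horner p &
  exists2 q : {poly F}, (size q <= 2)%N /\ (fun t => c1 t y.[t]) =1 horner q
    & q`_1 = l.-1%:R * p`_2.
Proof.
move=> sy; apply: degree_bound => [|z sz]; first exact: leq_ltn_trans hkl.
(* Subtracting the condition at z = 0 leaves c1 z - z' A, the expression treated by
   [degree_bound]. *)
have [_ h] := hABC sy sz; apply: poly_fun_ext (poly_funB h (C0_poly sy)) => t.
rewrite C_affine (A_indep _ _ _ 0) -/(c1 _ _); ring.
Qed.

(** B is y' A plus a remainder of degree below k, and y' A has degree at most (k - 2) + 2; so the
    coefficient of degree k comes from y' A alone. *)
Let B_poly (y : {poly F}) : (size y <= k)%N ->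
  exists2 p : {poly F}, (size p <= 3)%N /\ (fun t => A t y.[t] 0) =1 horner p &
  exists2 q : {poly F}, (size q <= k.+1)%N /\ (fun t => B t y.[t] 0) =1 horner q
    & q`_k = (y^`() * p)`_k.
Proof.
move=> sy; have [p [sp hp] _] := Ac1_poly sy; exists p => //.
have [[r sr hr] _] := hABC sy (size_cst 0 (leq_ltn_trans (leq0n k) hkl)).
have sd : (size y^`() <= k.-1)%N.
  apply/leq_sizeP => j kj; rewrite coef_deriv nth_default ?mul0rn //.
  by rewrite (leq_trans sy) //; lia.
exists (r + y^`() * p).
  split=> [|t]; last first.
    by rewrite hornerD hornerM -hr -hp hornerC subrK.
  rewrite (leq_trans (size_polyD _ _)) // geq_max (leq_trans sr) //=.
  by apply: (leq_trans (size_polyMleq _ _)); lia.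
by rewrite coefD [r`_k]nth_default ?add0r.
Qed.

(** The last two equations arise by reading the relations between top coefficients in [Ac1_poly] and
    [B_poly] along y = s x^(k-1) as identities of polynomials in s. *)
Lemma curve_cond_poly : exists a b c d : {poly {poly F}},
  [/\ forall x y z, A x y z = ev a x y, forall x y z, B x y z = ev b x y,
      forall x y z, C x y z = ev c x y * z + ev d x y &
  [/\ weight_lt k.-1 3 a, weight_lt k.-1 k.+1 b, weight_lt k.-1 2 c,
      weight_lt k.-1 l d &
      weight_part k.-1 1 c = l.-1%:R *: weight_part k.-1 2 a /\
      weight_part k.-1 k b = k.-1%:R *: ('X * weight_part k.-1 2 a)]].
Proof.
have le2k (u : {poly F}) : (size u <= 2 -> size u <= k)%N.
  by move/leq_trans; apply.
have [|a ha] := @poly_fun_lines F 3 (fun x y => A x y 0).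
  by move=> u /le2k /Ac1_poly[p [sp hp] _]; exists p.
have [|b hb] := @poly_fun_lines F k.+1 (fun x y => B x y 0).
  by move=> u /le2k /B_poly[p _ [q [sq hq] _]]; exists q.
have [|c hc] := @poly_fun_lines F 2 c1.
  by move=> u /le2k /Ac1_poly[p _ [q [sq hq] _]]; exists q.
have [|d hd] := @poly_fun_lines F l (fun x y => C x y 0).
  by move=> u /le2k /C0_poly.
pose Y (s : F) : {poly F} := s%:P * 'X^(k.-1).
have sY s : (size (Y s) <= k)%N.
  rewrite /Y mul_polyC (leq_trans (size_scale_leq _ _)) // size_polyXn.
  by rewrite prednK // ltnW.
have curve (f : F -> F -> F) Q s (p : {poly F}) : (forall x y, f x y = ev Q x y) ->
    (fun t => f t (Y s).[t]) =1 horner p -> Q.[Y s] = p.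
  by move=> hQ hp; apply: horner_eq => t; rewrite -hp hQ ev_curve.
exists a, b, c, d; split=> [x y z|x y z|x y z|].
- by rewrite (A_indep _ _ _ 0) ha.
- by rewrite (B_indep _ _ _ 0) hb.
- by rewrite C_affine -/(c1 x y) hc hd.
split.
- apply: weight_ltP => s; apply/poly_fun_horner.
  by have [p [sp /(curve _ _ _ _ ha) ->]] := Ac1_poly (sY s).
- apply: weight_ltP => s; apply/poly_fun_horner.
  by have [q _ [p [sp /(curve _ _ _ _ hb) ->]]] := B_poly (sY s).
- apply: weight_ltP => s; apply/poly_fun_horner.
  by have [q _ [p [sp /(curve _ _ _ _ hc) ->]]] := Ac1_poly (sY s).
- apply: weight_ltP => s.
  by apply: poly_fun_ext (C0_poly (sY s)) => t; rewrite hd ev_curve.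
split; apply: horner_eq => s.
  have [p [sp /(curve _ _ _ _ ha) ap] [q [sq /(curve _ _ _ _ hc) cq]]] :=
    Ac1_poly (sY s).
  by rewrite hornerZ -!coef_weight_curve -/(Y s) ap cq.
have [p [sp /(curve _ _ _ _ ha) ap] [q [sq /(curve _ _ _ _ hb) bq]]] :=
  B_poly (sY s).
rewrite hornerZ hornerM hornerX -!coef_weight_curve -/(Y s) ap bq => ->.
(* Here y' = (k-1) s x^(k-2), so the coefficient of degree k in y' p is (k-1) s times the
   coefficient of degree 2 in p; this is the origin of the factor ['X] in the statement. *)
rewrite /Y derivM derivC mul0r add0r derivXn mulrnAr mulrnAl coefMn -mulrA.
rewrite coefCM coefXnM ifN; last by lia.
rewrite (_ : k - k.-1.-1 = 2)%N; last by lia.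
by rewrite mulr_natl.
Qed.

End Classification.

(** * Normal forms of the components *)

Section ExplicitSolutions.
Variable F : numFieldType.

Lemma ev_weight3 m (Q : {poly {poly F}}) x y : (0 < m)%N -> weight_lt m 3 Q ->
  ev Q x y = (Q`_0)`_0 + (Q`_0)`_1 * x + (Q`_0)`_2 * x ^+ 2
    + ((Q`_1)`_0 + (Q`_1)`_1 * x) * y + (Q`_2)`_0 * y ^+ 2.
Proof.
move=> m0 wQ; rewrite (@ev_coef _ _ _ _ 3); last first.
  apply/leq_sizeP => j nj; apply/polyP=> i; rewrite coef0 wQ //.
  by rewrite (leq_trans nj) // (leq_trans (leq_pmull _ m0)) // leq_addl.
rewrite !big_ord_recl big_ord0 /= /bump /=.
rewrite (@horner_coef_wide _ 3 Q`_0); last first.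
  by apply/leq_sizeP => i ni; apply: wQ; lia.
rewrite (@horner_coef_wide _ 2 Q`_1); last first.
  by apply/leq_sizeP => i ni; apply: wQ; lia.
rewrite (@horner_coef_wide _ 1 Q`_2); last first.
  by apply/leq_sizeP => i ni; apply: wQ; lia.
by rewrite !big_ord_recl !big_ord0 /= /bump /= !expr0; ring.
Qed.

Lemma weight_ltW m n n' (Q : {poly {poly F}}) : (n <= n')%N ->
  weight_lt m n Q -> weight_lt m n' Q.
Proof. by move=> nn' wQ i j ij; apply: wQ; apply: leq_trans ij. Qed.

Let natF0 n : (0 < n)%N -> n%:R != 0 :> F.
Proof. by rewrite pnatr_eq0; case: n. Qed.

Lemma curve_cond_2 l (A B C : F -> F -> F -> F) : (2 < l)%N ->
  curve_cond 2 l A B C ->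
  (forall x y, (forall z h h',
     C x y (z + h + h') - C x y (z + h) - C x y (z + h') + C x y z = 0) ->
   forall z, C x y z = (C x y 1 - C x y 0) * z + C x y 0) ->
  exists (p0 p1 p2 q0 q1 q2 u v r : F) (d : {poly {poly F}}),
  [/\ forall x y z, A x y z = p0 + p1 * x + p2 * y + x * (u * x + v * y),
      forall x y z, B x y z = q0 + q1 * x + q2 * y + y * (u * x + v * y),
      forall x y z,
        C x y z = (r + l.-1%:R * (u * x + v * y)) * z + ev d x y &
      weight_lt 1 l d].
Proof.
move=> hl hc hC.
have [a [b [c [d [hA hB hC' [wa wb wc wd [e1 e2]]]]]]] :=
  curve_cond_poly (isT : 1 < 2)%N hl hc hC.
have c1 j := congr1 (fun p : {poly F} => p`_j) e1.
have b1 j := congr1 (fun p : {poly F} => p`_j) e2.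
have l0 := @natF0 l.-1 ltac:(lia).
(* Coefficients of s^0, s^1, s^2. In the relation between c and a, the last one removes y^2 from A;
   the remaining equations make A, B and the z-coefficient of C share the linear form u x + v y. *)
have := c1 0; have := c1 1; have := c1 2.
rewrite /= !coefZ !coef_weight_part /= !subn0.
move=> /esym/eqP; rewrite mulf_eq0 (negPf l0) => /eqP a20 c10 c01.
have := b1 0; have := b1 1; have := b1 2.
rewrite /= !coefZ !coefXM !coef_weight_part /= !subn0 !mul1r.
move=> b20 b11 b02.
exists (a`_0)`_0, (a`_0)`_1, (a`_1)`_0, (b`_0)`_0, (b`_0)`_1, (b`_1)`_0,
  (a`_0)`_2, (a`_1)`_1, (c`_0)`_0, d.
split=> // x y z.
- by rewrite hA (ev_weight3 _ _ _ wa) // a20; ring.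
- by rewrite hB (ev_weight3 _ _ _ wb) // b20 b11 b02; ring.
- rewrite hC' (ev_weight3 _ _ _ (weight_ltW _ wc)) // c10 c01.
  by rewrite (wc 2 0)%N 1?(wc 1 1)%N 1?(wc 0 2)%N //; ring.
Qed.

Lemma curve_cond_gt2 k l (A B C : F -> F -> F -> F) : (2 < k < l)%N ->
  curve_cond k l A B C ->
  (forall x y, (forall z h h',
     C x y (z + h + h') - C x y (z + h) - C x y (z + h') + C x y z = 0) ->
   forall z, C x y z = (C x y 1 - C x y 0) * z + C x y 0) ->
  exists (p0 p1 p2 q r : F) (b0 : {poly F}) (d : {poly {poly F}}),
  [/\ forall x y z, A x y z = p0 + p1 * x + p2 * x ^+ 2,
      forall x y z, B x y z = (q + k.-1%:R * p2 * x) * y + b0.[x],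
      forall x y z,
        C x y z = (r + l.-1%:R * p2 * x) * z + ev d x y &
      (size b0 <= k)%N /\ weight_lt k.-1 l d].
Proof.
move=> /andP[hk hl] hc hC.
have [a [b [c [d [hA hB hC' [wa wb wc wd [e1 e2]]]]]]] :=
  curve_cond_poly (ltnW hk) hl hc hC.
have c1 j := congr1 (fun p : {poly F} => p`_j) e1.
have b1 j := congr1 (fun p : {poly F} => p`_j) e2.
have l0 := @natF0 l.-1 ltac:(lia).
have m0 : (0 < k.-1)%N by lia.
(* The variable y has weight k - 1. It fits into A only for k = 3, where the coefficient of s in the
   relation with c excludes it; for k > 3 its weight exceeds the bound. *)
have a1 : (a`_1)`_0 = 0 /\ (c`_0)`_1 = l.-1%:R * (a`_0)`_2.
  have := c1 0; have := c1 1.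
  rewrite /= !coefZ !coef_weight_part !muln1 !muln0 /= !subn0.
  rewrite (_ : (k.-1 <= 1)%N = false); last by lia.
  case: ifP => [k2 /esym/eqP|k2 _ ->].
    rewrite mulf_eq0 (negPf l0) => /eqP; rewrite (_ : (2 - k.-1 = 0)%N) //; lia.
  by split=> //; apply: wa; lia.
case: a1 => a10 c01.
have := b1 0; have := b1 1.
rewrite /= !coefZ !coefXM !coef_weight_part !muln1 !muln0 /= !subn0 mulr0.
rewrite leq_pred (_ : k - k.-1 = 1)%N; last by lia.
move=> b11 bk0.
exists (a`_0)`_0, (a`_0)`_1, (a`_0)`_2, (b`_1)`_0, (c`_0)`_0, b`_0, d.
split=> [x y z|x y z|x y z|].
- rewrite hA (ev_weight3 _ _ _ wa) // a10 (wa 1 1)%N 1?(wa 0 2)%N; try lia.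
  by ring.
- rewrite hB (@ev_coef _ _ _ _ 2).
    rewrite !big_ord_recl !big_ord0 /= /bump /= !expr0 mulr1 addr0 addrC.
    rewrite (@horner_coef_wide _ 2 (b`_1)).
      by rewrite !big_ord_recl !big_ord0 /= /bump /= !expr0 b11; ring.
    by apply/leq_sizeP => i i2; apply: wb; lia.
  (* For k > 2 the weight 2 (k-1) of y^2 is at least k + 1, so B is affine in y. *)
  apply/leq_sizeP => j j2; apply/polyP=> i; rewrite coef0 wb //.
  have : (k.-1 * 2 <= k.-1 * j)%N by rewrite leq_mul2l j2 orbT.
  by lia.
- rewrite hC' (ev_weight3 _ _ _ (weight_ltW _ wc)) // c01.
  rewrite (wc 2 0)%N 1?(wc 0 1)%N 1?(wc 1 1)%N 1?(wc 0 2)%N; try lia.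
  by ring.
(* The weight bound still allows x^k in [b0]; its coefficient vanishes by the comparison at s^0. *)
split=> //; apply/leq_sizeP => i; rewrite leq_eqVlt => /orP[/eqP <- //|ki].
by apply: wb; lia.
Qed.

End ExplicitSolutions.

(** * Partial derivatives and degree estimates *)

Section PartialDerivatives.
Variable F : numFieldType.
Implicit Types (p : {poly F}) (P Q : {poly {poly F}}).

(** The derivative in x, the inner variable; conjugation by [swapXY] transfers the rules known for
    the outer derivative. *)
Definition dX Q : {poly {poly F}} := swapXY (swapXY Q)^`().

Lemma dXD P Q : dX (P + Q) = dX P + dX Q.
Proof. by rewrite /dX (rmorphD (@swapXY F)) derivD (rmorphD (@swapXY F)). Qed.
Lemma coef_dX Q i j : ((dX Q)`_j)`_i = (Q`_j)`_i.+1 *+ i.+1.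
Proof. by rewrite /dX coef_swapXY coef_deriv coefMn coef_swapXY. Qed.

Lemma dXN P : dX (- P) = - dX P.
Proof.
by apply/polyP=> j; apply/polyP=> i; rewrite coef_dX !coefN coef_dX mulNrn.
Qed.
Lemma dXB P Q : dX (P - Q) = dX P - dX Q.
Proof. by rewrite dXD dXN. Qed.
Lemma dXM P Q : dX (P * Q) = dX P * Q + P * dX Q.
Proof.
rewrite /dX (rmorphM (@swapXY F)) derivM (rmorphD (@swapXY F)).
by rewrite !(rmorphM (@swapXY F)); congr (_ * _ + _ * _); apply: swapXYK.
Qed.
Lemma dXC p : dX p%:P = (p^`())%:P.
Proof. by rewrite /dX swapXY_polyC deriv_map swapXY_map_polyC. Qed.
Lemma dXX : dX 'X = 0.
Proof. by rewrite /dX swapXY_X derivC rmorph0. Qed.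

Lemma dX_deriv Q : dX Q^`() = (dX Q)^`().
Proof.
apply/polyP=> j; apply/polyP=> i.
by rewrite coef_dX !coef_deriv !coefMn coef_dX -!mulrnA mulnC.
Qed.

End PartialDerivatives.

Section ProjectiveDegree.
Variable F : numFieldType.
Implicit Types (p z : {poly F}).

Lemma size_deriv_le n z : (size z <= n)%N -> (size z^`() <= n.-1)%N.
Proof.
move=> sz; apply/leq_sizeP => j nj; rewrite coef_deriv nth_default ?mul0rn //.
by rewrite (leq_trans sz) //; lia.
Qed.

Lemma size_mul_le n m p z : (size p <= n.+1)%N -> (size z <= m)%N ->
  (size (p * z)%R <= n + m)%N.
Proof. by move=> sp sz; apply: (leq_trans (size_polyMleq _ _)); lia. Qed.

Lemma size_add_le n p z : (size p <= n)%N -> (size z <= n)%N ->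
  (size (p + z)%R <= n)%N.
Proof. by move=> sp sz; rewrite (leq_trans (size_polyD _ _)) // geq_max sp. Qed.

Lemma size_sub_le n p z : (size p <= n)%N -> (size z <= n)%N ->
  (size (p - z)%R <= n)%N.
Proof. by move=> sp sz; apply: size_add_le => //; rewrite size_polyN. Qed.

Lemma size_euler n z : (size z <= n)%N ->
  (size (n.-1%:R * z - 'X * z^`())%R <= n.-1)%N.
Proof.
move=> sz; apply/leq_sizeP => j nj; rewrite coefB mulr_natl coefMn coefXM.
have -> : (if j == 0%N then 0 else (z^`())`_j.-1) = z`_j *+ j.
  by case: j {nj} => [|j]; rewrite ?mulr0n // coef_deriv.
have [jn|jn] := ltnP j n; last by rewrite nth_default ?mul0rn ?subrr // (leq_trans sz).
by rewrite (_ : n.-1 = j) ?subrr //; lia.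
Qed.

(* The degree n terms cancel: in degree n - 1 the operator
   n - 1 - x d/dx vanishes. *)
Lemma size_projective n (L0 L1 z : {poly F}) : (0 < n)%N ->
  (size L0 <= 2)%N -> (size L1 <= 2)%N -> (size z <= n)%N ->
  (size (n.-1%:R * L1 * z + z^`() * (L0 - 'X * L1))%R <= n)%N.
Proof.
move=> n0 s0 s1 sz.
rewrite (_ : _ + _ = L1 * (n.-1%:R * z - 'X * z^`()) + L0 * z^`()); last by ring.
apply: size_add_le.
  by rewrite -[n in (_ <= n)%N](prednK n0) -add1n size_mul_le // size_euler.
by rewrite -[n in (_ <= n)%N](prednK n0) -add1n size_mul_le // size_deriv_le.
Qed.

End ProjectiveDegree.

(** * Binary and ternary forms *)

Module Dehomogenization.
From mathcomp Require Import mpoly.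

Section Dehomogenization.
Variable F : numFieldType.
Implicit Types (f g : {mpoly F[3]}) (m : 'X_{1..3}) (Q : {poly {poly F}}).

Definition o0 : 'I_3 := ord0.
Definition o1 : 'I_3 := lift ord0 ord0.
Definition o2 : 'I_3 := lift ord0 (lift ord0 ord0).

Definition affine_chart (i : 'I_3) : {poly {poly F}} :=
  nth 0 [:: 'X%:P; 'X; 1] i.

Definition deh f : {poly {poly F}} := mmap (polyC \o polyC) affine_chart f.

Lemma deh0 : deh 0 = 0. Proof. exact: mmap0. Qed.
Lemma dehD f g : deh (f + g) = deh f + deh g. Proof. exact: mmapD. Qed.
Lemma dehZ c f : deh (c *: f) = c%:P%:P * deh f. Proof. exact: mmapZ. Qed.
Lemma dehM f g : deh (f * g) = deh f * deh g. Proof. exact: rmorphM. Qed.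
Lemma deh_var i : deh 'X_i = affine_chart i.
Proof. by rewrite /deh mmapX mmap1U. Qed.

Lemma deh_monomial m : deh 'X_[m] = ('X^(m o0))%:P * 'X^(m o1).
Proof.
rewrite /deh mmapX /mmap1 !big_ord_recl big_ord0 /affine_chart /=.
by rewrite expr1n !mulr1 polyC_exp.
Qed.

Lemma deh_sum I (r : seq I) (G : I -> {mpoly F[3]}) :
  deh (\sum_(i <- r) G i) = \sum_(i <- r) deh (G i).
Proof. by elim/big_rec2: _ => [|i a b _ <-]; rewrite ?deh0 ?dehD. Qed.

Lemma dX_sum I (r : seq I) (G : I -> {poly {poly F}}) :
  dX (\sum_(i <- r) G i) = \sum_(i <- r) dX (G i).
Proof.
by elim/big_rec2: _ => [|i a b _ <-]; rewrite ?dXD // -[0]polyC0 dXC derivC.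
Qed.

Lemma dehE f : deh f =
  \sum_(m <- msupp f) (f@_m)%:P%:P * (('X^(m o0))%:P * 'X^(m o1)).
Proof.
by rewrite {1}[f]mpolyE deh_sum; apply: eq_bigr => m _; rewrite dehZ deh_monomial.
Qed.

Lemma deh_mderiv i f : deh (mderiv i f) =
  \sum_(m <- msupp f) (f@_m)%:P%:P * deh (mderiv i 'X_[m]).
Proof.
rewrite {1}[f]mpolyE raddf_sum deh_sum; apply: eq_bigr => m _.
by rewrite /= mderivZ dehZ.
Qed.

Lemma deh_mderiv_monomial i m : deh (mderiv i 'X_[m]) =
  (m i)%:R%:P%:P * (('X^(m o0 - (i == o0)))%:P * 'X^(m o1 - (i == o1))).
Proof. by rewrite mderivX dehZ deh_monomial !mnmBE !mnm1E. Qed.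

Lemma dX_deh f : dX (deh f) = deh (mderiv o0 f).
Proof.
rewrite dehE deh_mderiv dX_sum; apply: eq_bigr => m _.
rewrite deh_mderiv_monomial !dXM !dXC !derivC polyC0 mul0r add0r.
have dXYn n : dX ('X^n : {poly {poly F}}) = 0.
  elim: n => [|n IH]; first by rewrite expr0 -[1]polyC1 dXC derivC.
  by rewrite exprS dXM dXX IH mul0r mulr0 addr0.
rewrite dXYn mulr0 addr0 derivXn eqxx subn1 subn0.
by rewrite -mulr_natl polyCM !polyC_natr !mulrA.
Qed.

Lemma deriv_deh f : (deh f)^`() = deh (mderiv o1 f).
Proof.
rewrite dehE deh_mderiv raddf_sum; apply: eq_bigr => m _ /=.
rewrite deh_mderiv_monomial !derivM !derivC !mul0r !add0r derivXn.
rewrite subn0 subn1 -mulr_natl !polyC_natr; congr (_ * _).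
by rewrite mulrCA.
Qed.

(** Euler's identity at third variable 1. It eliminates the derivative in that variable, which the
    chart cannot express directly. *)
Lemma deh_euler d f : f \is d.-homog ->
  'X%:P * deh (mderiv o0 f) + 'X * deh (mderiv o1 f) + deh (mderiv o2 f)
    = d%:R * deh f.
Proof.
move=> /dhomogP hf; rewrite !deh_mderiv dehE !mulr_sumr -!big_split /=.
rewrite !big_seq; apply: eq_bigr => m /hf <-.
rewrite !deh_mderiv_monomial /= !subn0 !subn1 mdegE !big_ord_recl big_ord0.
rewrite addn0 !natrD !polyC_natr -/o0 -/o1 -/o2 !polyC_exp.
(* The predecessor in the exponent is harmless at n = 0, where the factor [n%:R] is zero. *)
have sh (x : {poly {poly F}}) n : x * (n%:R * x ^+ n.-1) = n%:R * x ^+ n.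
  by case: n => [|n]; rewrite ?mul0r ?mulr0 // mulrCA -exprS.
have hx := sh 'X%:P (m o0); have hy := sh 'X (m o1).
set c := (f@_m)%:P%:P.
transitivity (c * (('X%:P * ((m o0)%:R * 'X%:P ^+ (m o0).-1)) * 'X^(m o1)
  + ('X * ((m o1)%:R * 'X ^+ (m o1).-1)) * 'X%:P ^+ (m o0)
  + (m o2)%:R * 'X%:P ^+ (m o0) * 'X^(m o1))); first by ring.
by rewrite hx hy; ring.
Qed.

Lemma coef_monomial (a b i j : nat) (c : F) :
  ((c%:P%:P * (('X^a)%:P * 'X^b))`_j)`_i = c *+ ((i == a) && (j == b)).
Proof.
rewrite !coefCM coefXn; case: (j == b); last by rewrite mulr0 coef0 mulr0 andbF.
by rewrite mulr1 coefXn andbT; case: (i == a); rewrite ?mulr1 ?mulr0.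
Qed.

Lemma mdeg3 m : mdeg m = (m o0 + m o1 + m o2)%N.
Proof. by rewrite mdegE !big_ord_recl big_ord0 addn0 addnA. Qed.

(** In a fixed degree the exponent of the third variable is determined by the other two, so setting
    that variable to 1 merges no monomials. *)
Lemma coef_deh d f m : f \is d.-homog -> mdeg m = d ->
  ((deh f)`_(m o1))`_(m o0) = f@_m.
Proof.
move=> /dhomogP hf dm; rewrite dehE coef_sum coef_sum.
under eq_bigr => m' _ do rewrite coef_monomial.
rewrite big_seq; have mm m' : m' \in msupp f ->
    (m o0 == m' o0) && (m o1 == m' o1) = (m == m').
  move=> /hf dm'; apply/andP/eqP => [[/eqP e0 /eqP e1]|-> //].
  have e2 : m o2 = m' o2 by move: dm' dm; rewrite /= !mdeg3 e0 e1; lia.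
  apply/mnmP => i; case: (unliftP ord0 i) => [i' ->|-> //].
  case: (unliftP ord0 i') => [i'' ->|-> //].
  by case: (unliftP ord0 i'') => [[]//|->].
under eq_bigr => m' hm' do rewrite mm //.
rewrite -big_seq; case: (boolP (m \in msupp f)) => ms.
  rewrite (bigD1_seq m) ?msupp_uniq //= eqxx big1 ?addr0 // => m'.
  by rewrite eq_sym => /negPf ->.
rewrite big_seq big1 ?(memN_msupp_eq0 ms) // => m' hm'.
by case: eqP => // e; rewrite -e (negPf ms) in hm'.
Qed.

Lemma deh_inj d f g : f \is d.-homog -> g \is d.-homog -> deh f = deh g -> f = g.
Proof.
move=> hf hg e; apply/mpolyP => m; have [dm|dm] := eqVneq (mdeg m) d.
  by rewrite -(coef_deh hf dm) -(coef_deh hg dm) e.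
by rewrite (dhomog_nemf_coeff hf dm) (dhomog_nemf_coeff hg dm).
Qed.

Lemma deh_weight d f : f \is d.-homog -> weight_lt 1 d.+1 (deh f).
Proof.
move=> /dhomogP hf i j; rewrite mul1n => dij; rewrite dehE !coef_sum.
rewrite big_seq big1 // => m /hf /=; rewrite mdeg3 => dm.
rewrite coef_monomial (_ : _ && _ = false) //.
by apply/negP => /andP[/eqP ei /eqP ej]; lia.
Qed.

Lemma weight_deh d Q : weight_lt 1 d.+1 Q -> exists2 f, f \is d.-homog & deh f = Q.
Proof.
(* Homogenization by the third exponent d - (i + j). For i + j > d the truncated subtraction gives a
   monomial of the wrong degree, but there the coefficient of Q is zero. *)
move=> wQ; pose mn (ij : 'I_d.+1 * 'I_d.+1) : 'X_{1..3} :=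
  [multinom nth 0%N [:: ij.1 : nat; ij.2 : nat; d - (ij.1 + ij.2)]%N i | i < 3].
have mnE ij : (mn ij o0 = ij.1 :> nat) * (mn ij o1 = ij.2 :> nat)
    * (mn ij o2 = d - (ij.1 + ij.2))%N by rewrite !mnmE.
exists (\sum_(ij : 'I_d.+1 * 'I_d.+1) ((Q`_ij.2)`_ij.1) *: 'X_[mn ij]).
  apply: rpred_sum => ij _; have [le|gt] := leqP (ij.1 + ij.2) d.
    by apply: rpredZ; rewrite dhomogX /= mdeg3 !mnE subnKC.
  by rewrite wQ ?mul1n // scale0r rpred0.
rewrite deh_sum; apply/polyP=> j; apply/polyP=> i; rewrite !coef_sum.
under eq_bigr => ij _ do rewrite dehZ deh_monomial coef_monomial !mnE.
have [ij|ij] := leqP (i + j) d; last first.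
  rewrite wQ ?mul1n // big1 // => -[a b] _ /=; case: eqP => [ei|//].
  case: eqP => [ej|//]; rewrite -ej -ei wQ ?mul0rn // mul1n; lia.
have id : (i < d.+1)%N by lia.
have jd : (j < d.+1)%N by lia.
rewrite (bigD1 (Ordinal id, Ordinal jd)) //= !eqxx big1 ?addr0 // => -[a b].
rewrite -pair_eqE /pair_eq /= -!val_eqE /= ![nat_of_ord _ == _]eq_sym.
by move/negPf => ->.
Qed.

Lemma deh_gl_der (A : 'M[F]_3) f : deh (SymmetricPower.gl_der A f) =
  \sum_j (\sum_i (A i j)%:P%:P * affine_chart i) * deh (mderiv j f).
Proof.
rewrite /SymmetricPower.gl_der exchange_big deh_sum; apply: eq_bigr => j _.
rewrite deh_sum mulr_suml; apply: eq_bigr => i _.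
by rewrite dehZ dehM deh_var mulrA.
Qed.

Definition deh_sym d (f : SymmetricPower.sym_space F 3 d) :=
  deh (mpoly_of_dhomog f).

Lemma deh_sym_linear d a (f g : SymmetricPower.sym_space F 3 d) :
  deh_sym (a *: f + g) = a%:P%:P * deh_sym f + deh_sym g.
Proof. by rewrite /deh_sym /= dehD dehZ. Qed.

Lemma deh_sym0 d : deh_sym (0 : SymmetricPower.sym_space F 3 d) = 0.
Proof.
have := deh_sym_linear 0 (0 : SymmetricPower.sym_space F 3 d) 0.
by rewrite scaler0 addr0 !polyC0 mul0r add0r => h; rewrite /deh_sym deh0.
Qed.

Lemma deh_sym_inj d : injective (@deh_sym d).
Proof.
move=> f g e; apply: val_inj.
exact: deh_inj (dhomog_is_dhomog f) (dhomog_is_dhomog g) e.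
Qed.

Lemma deh_sym_weight d (f : SymmetricPower.sym_space F 3 d) :
  weight_lt 1 d.+1 (deh_sym f).
Proof. exact/deh_weight/dhomog_is_dhomog. Qed.

Lemma weight_deh_sym d Q : weight_lt 1 d.+1 Q ->
  exists f : SymmetricPower.sym_space F 3 d, deh_sym f = Q.
Proof. by move=> /weight_deh[f hf fQ]; exists (DHomog hf). Qed.

(** Column j of A, read in the chart, is the coefficient [L j] of the derivative in variable j.
    Replacing the third derivative by Euler's identity turns the linear field into a projective one
    plus multiplication by d times [L o2]. *)
Lemma deh_sym_act d (A : 'M[F]_3) (f : SymmetricPower.sym_space F 3 d) :
  let L j := (A o0 j)%:P%:P * 'X%:P + (A o1 j)%:P%:P * 'X + (A o2 j)%:P%:P in
  let Q := deh_sym f in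
  deh_sym (SymmetricPower.sym_pow F 3 d A f) =
    L o0 * dX Q + L o1 * Q^`() + L o2 * (d%:R * Q - 'X%:P * dX Q - 'X * Q^`()).
Proof.
move=> L Q; rewrite /deh_sym /= deh_gl_der /Q /deh_sym dX_deh deriv_deh.
rewrite -(deh_euler (dhomog_is_dhomog f)).
rewrite !big_ord_recl !big_ord0 /affine_chart /= -/o0 -/o1 -/o2 /L.
by move: (deh _) (deh _) (deh _) => a b c; ring.
Qed.

End Dehomogenization.
End Dehomogenization.

(** * Binary forms as representations of gl(2) *)

Section GL2Representations.
Variable F : numFieldType.
Implicit Types (A B : 'M[F]_2) (p q : {poly F}).

Definition i0 : 'I_2 := ord0.
Definition i1 : 'I_2 := lift ord0 ord0.

Lemma matrix2_entries (a00 a01 a10 a11 : F) : exists A : 'M[F]_2,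
  [/\ A i0 i0 = a00, A i0 i1 = a01, A i1 i0 = a10 & A i1 i1 = a11].
Proof.
exists (\matrix_(i, j) nth 0 (nth [::] [:: [:: a00; a01]; [:: a10; a11]] i) j).
by rewrite !mxE.
Qed.

Lemma ord2_ind (P : 'I_2 -> Prop) : P i0 -> P i1 -> forall i, P i.
Proof.
move=> P0 P1 i; case: (unliftP ord0 i) => [i' ->|-> //].
by case: (unliftP ord0 i') => [[]//|->].
Qed.

Definition gl2_form A j : {poly F} := (A i0 j)%:P * 'X + (A i1 j)%:P.

(** The quotient rule for x = X_0 / X_1, taken at X_1 = 1, under the derivation that sends X_j to
    [gl2_form A j]. *)
Definition gl2_field A := gl2_form A i0 - 'X * gl2_form A i1.

(* The action of gl(2) on binary forms of degree n, in the chart (x, 1). *)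
Definition gl2_act n A p := gl2_field A * p^`() + n%:R * gl2_form A i1 * p.

Lemma gl2_formZ a A B j :
  gl2_form (a *: A + B) j = a%:P * gl2_form A j + gl2_form B j.
Proof. by rewrite /gl2_form !mxE !polyCD !polyCM; ring. Qed.

Lemma gl2_fieldZ a A B :
  gl2_field (a *: A + B) = a%:P * gl2_field A + gl2_field B.
Proof. by rewrite /gl2_field !gl2_formZ; ring. Qed.

Lemma gl2_bracketE A B i j : lie_bracket (A : gl F 2) B i j =
  A i i0 * B i0 j + A i i1 * B i1 j - (B i i0 * A i0 j + B i i1 * A i1 j).
Proof. by rewrite /lie_bracket /= !mxE !big_ord_recl !big_ord0 /= !addr0. Qed.

Lemma deriv_gl2_form A j : (gl2_form A j)^`() = (A i0 j)%:P.
Proof. by rewrite /gl2_form derivD derivM !derivC derivX mul0r add0r mulr1 addr0. Qed.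

Lemma deriv_gl2_field A :
  (gl2_field A)^`() = (A i0 i0)%:P - gl2_form A i1 - 'X * (A i0 i1)%:P.
Proof.
by rewrite /gl2_field derivB derivM derivX !deriv_gl2_form mul1r opprD addrA.
Qed.

Lemma gl2_form_bracket A B : gl2_form (lie_bracket (A : gl F 2) B) i1 =
  gl2_field A * (gl2_form B i1)^`() - gl2_field B * (gl2_form A i1)^`().
Proof.
rewrite !deriv_gl2_form /gl2_field /gl2_form !gl2_bracketE.
by rewrite !(polyCB, polyCD, polyCM); ring.
Qed.

Lemma gl2_field_bracket A B : gl2_field (lie_bracket (A : gl F 2) B) =
  gl2_field A * (gl2_field B)^`() - gl2_field B * (gl2_field A)^`().
Proof.
rewrite !deriv_gl2_field /gl2_field /gl2_form !gl2_bracketE.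
by rewrite !(polyCB, polyCD, polyCM); ring.
Qed.

Lemma gl2_act_bracket n A B p : gl2_act n (lie_bracket (A : gl F 2) B) p =
  gl2_act n A (gl2_act n B p) - gl2_act n B (gl2_act n A p).
Proof.
rewrite /gl2_act gl2_field_bracket gl2_form_bracket.
move: (gl2_field A) (gl2_field B) (gl2_form A i1) (gl2_form B i1) => a b c d.
have dn : (n%:R : {poly F})^`() = 0 by rewrite -polyC_natr derivC.
by rewrite !(derivD, derivM) !dn; ring.
Qed.

Lemma gl2_act_linearl n p a A B :
  gl2_act n (a *: A + B) p = a *: gl2_act n A p + gl2_act n B p.
Proof. by rewrite /gl2_act gl2_fieldZ gl2_formZ -mul_polyC; ring. Qed.

Lemma gl2_act_linearr n A a p q :
  gl2_act n A (a *: p + q) = a *: gl2_act n A p + gl2_act n A q.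
Proof. by rewrite /gl2_act derivD derivZ -!mul_polyC; ring. Qed.

Lemma size_gl2_form A j : (size (gl2_form A j) <= 2)%N.
Proof.
rewrite /gl2_form; apply: size_add_le.
  by rewrite mul_polyC (leq_trans (size_scale_leq _ _)) // size_polyX.
by rewrite (leq_trans (size_polyC_leq1 _)).
Qed.

Lemma size_gl2_act r A p : (size p <= r)%N -> (size (gl2_act r.-1 A p) <= r)%N.
Proof.
case: r => [|r] sp; last first.
  rewrite /gl2_act addrC [gl2_field A * _]mulrC.
  by apply: size_projective => //; exact: size_gl2_form.
move: sp; rewrite leqn0 size_poly_eq0 => /eqP ->.
by rewrite /gl2_act linear0 !mulr0 addr0 size_poly0.
Qed.

Definition col_poly r (v : 'cV[F]_r) : {poly F} := rVpoly v^T.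
Definition poly_col r p : 'cV[F]_r := (poly_rV p)^T.

Lemma col_polyK r : cancel (@col_poly r) (@poly_col r).
Proof. by move=> v; rewrite /col_poly /poly_col rVpolyK trmxK. Qed.

Lemma poly_colK r p : (size p <= r)%N -> col_poly (poly_col r p) = p.
Proof. by move=> sp; rewrite /col_poly /poly_col trmxK poly_rV_K. Qed.

Lemma size_col_poly r (v : 'cV[F]_r) : (size (col_poly v) <= r)%N.
Proof. exact: size_poly. Qed.

Lemma col_poly_linear r a (u v : 'cV[F]_r) :
  col_poly (a *: u + v) = a *: col_poly u + col_poly v.
Proof. by rewrite /col_poly linearP /= linearP. Qed.

Lemma poly_col_linear r a p q :
  poly_col r (a *: p + q) = a *: poly_col r p + poly_col r q.
Proof. by rewrite /poly_col linearP /= linearP. Qed.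

Lemma col_poly0 r : col_poly (0 : 'cV[F]_r) = 0.
Proof. by rewrite /col_poly !linear0. Qed.

Lemma poly_colZ r a p : poly_col r (a *: p) = a *: poly_col r p.
Proof. by rewrite /poly_col !linearZ. Qed.

Definition gl2_rep_act r (A : gl F 2) (v : 'cV[F]_r) : 'cV[F]_r :=
  poly_col r (gl2_act r.-1 A (col_poly v)).

Lemma col_poly_rep r A (v : 'cV[F]_r) :
  col_poly (gl2_rep_act A v) = gl2_act r.-1 A (col_poly v).
Proof. by rewrite poly_colK // size_gl2_act // size_col_poly. Qed.

Fact gl2_rep_linearl r (v : 'cV[F]_r) : linear (fun A : gl F 2 => gl2_rep_act A v).
Proof. by move=> a A B; rewrite /gl2_rep_act gl2_act_linearl poly_col_linear. Qed.

Fact gl2_rep_linearr r (A : gl F 2) : linear (@gl2_rep_act r A).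
Proof.
by move=> a u v; rewrite /gl2_rep_act col_poly_linear gl2_act_linearr poly_col_linear.
Qed.

Fact gl2_rep_bracket r (A B : gl F 2) (v : 'cV[F]_r) :
  gl2_rep_act (lie_bracket A B) v =
  gl2_rep_act A (gl2_rep_act B v) - gl2_rep_act B (gl2_rep_act A v).
Proof.
rewrite /gl2_rep_act gl2_act_bracket.
rewrite !poly_colK ?size_gl2_act ?size_col_poly //.
by rewrite addrC -scaleN1r poly_col_linear scaleN1r addrC.
Qed.

Definition gl2_rep r : lieRep (gl F 2) 'cV[F]_r :=
  LieRep (@gl2_rep_linearl r) (@gl2_rep_linearr r) (@gl2_rep_bracket r).

(* Lowering a nonzero vector with d/dx gives 1, and raising 1 gives all powers
   of x. *)
Lemma gl2_rep_irreducible r : (0 < r)%N -> irreducible_rep (gl2_rep r).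
Proof.
case: r => // r _; split.
  move=> e; have := memvf (poly_col r.+1 1); rewrite e memv0.
  move=> /eqP/(congr1 (@col_poly r.+1)).
  by rewrite poly_colK ?size_poly1 // col_poly0 => /eqP; rewrite oner_eq0.
move=> U hU; have [U0|Un0] := eqVneq U 0%VS; [by left|right].
pose inU p := poly_col r.+1 p \in U.
have inUE v : v \in U -> inU (col_poly v) by rewrite /inU col_polyK.
have step A p : (size p <= r.+1)%N -> inU p -> inU (gl2_act r A p).
  by move=> sp /(hU A); rewrite /= /gl2_rep_act poly_colK.
(* The field of [E] is d/dx, without multiplier; that of [E'] is - x^2 d/dx, with multiplier r x. *)
have [E [E00 E01 E10 E11]] := matrix2_entries 0 0 1 0.
have [E' [E00' E01' E10' E11']] := matrix2_entries 0 1 0 0.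
have lower p : gl2_act r E p = p^`().
  rewrite /gl2_act /gl2_field /gl2_form E00 E01 E10 E11 !polyC0 polyC1.
  by ring.
have raise p : gl2_act r E' p = r%:R * 'X * p - 'X^2 * p^`().
  rewrite /gl2_act /gl2_field /gl2_form E00' E01' E10' E11' !polyC0 polyC1.
  by ring.
have cst n p : (size p <= n.+1)%N -> p != 0 -> (n <= r)%N -> inU p -> inU 1.
  elim: n p => [|n IH] p sp p0 nr pU.
    move: pU; rewrite [p]size1_polyC // /inU -[(p`_0)%:P]mulr1 mul_polyC.
    rewrite poly_colZ => /(memvZ (p`_0)^-1); rewrite scalerK //.
    by apply: contraNneq p0 => c0; rewrite [p]size1_polyC // c0.
  have [sp'|sp'] := leqP (size p) n.+1; first by apply: IH pU => //; exact: ltnW.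
  apply: (IH p^`()); [| |exact: ltnW|].
  - by rewrite (leq_trans (size_deriv_le sp)).
  - apply: contraNneq p0 => /(congr1 (fun q : {poly F} => q`_n)) /eqP.
    rewrite coef_deriv coef0 mulrn_eq0 /= => /eqP pn.
    by rewrite -lead_coef_eq0 lead_coefE (_ : (size p).-1 = n.+1) ?pn //; lia.
  by rewrite -lower; apply: step pU; rewrite (leq_trans sp).
have [v vU v0] : exists2 v, v \in U & v != 0.
  by exists (vpick U); rewrite ?memv_pick ?vpick0.
have one : inU 1.
  apply: (cst r (col_poly v)); rewrite ?size_col_poly ?inUE //.
  apply: contraNneq v0 => e; rewrite -[v]col_polyK e.
  by rewrite -(scale0r 0) poly_colZ scale0r.
(* Raising x^n gives (r - n) x^(n+1), and the factor is nonzero as long as n < r. *)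
have pow n : (n <= r)%N -> inU 'X^n.
  elim: n => [|n IH] nr; first by rewrite expr0.
  have := step E' 'X^n _ (IH (ltnW nr)); rewrite size_polyXn => /(_ (ltnW nr)).
  rewrite raise (_ : _ - _ = (r - n)%:R *: 'X^(n.+1)); last first.
    rewrite derivXn natrB ?(ltnW nr) // scalerBl !scaler_nat !mulr_natl.
    rewrite mulrnAl -exprS; congr (_ - _); case: n {IH nr} => [|n].
      by rewrite !mulr0n mulr0.
    by rewrite mulrnAr -exprD.
  rewrite /inU poly_colZ => /(memvZ (r - n)%:R^-1); rewrite scalerK //.
  by rewrite pnatr_eq0; lia.
apply/eqP; rewrite eqEsubv subvf /=; apply/subvP => u _.
rewrite -[u]col_polyK /col_poly /rVpoly poly_def /poly_col !linear_sum.
apply: memv_suml => i _; rewrite !linearZ memvZ //.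
by apply: (pow i); rewrite -ltnS.
Qed.

End GL2Representations.

(** * First-order operators and the ideal for k > 2 *)

Section AffineOperator.
Variable F : numFieldType.
Implicit Types a b c Q : {poly {poly F}}.

(** The bracket of a d/dx + b d/dy + c z d/dz with the vertical field Q d/dz is this function times
    d/dz; hence the sign of c. *)
Definition field_op a b c Q := a * dX Q + b * Q^`() - c * Q.

Lemma field_op_bracket a b c a' b' c' Q :
  field_op a b c (field_op a' b' c' Q) - field_op a' b' c' (field_op a b c Q) =
  field_op (a * dX a' + b * a'^`() - (a' * dX a + b' * a^`()))
           (a * dX b' + b * b'^`() - (a' * dX b + b' * b^`()))
           (a * dX c' + b * c'^`() - (a' * dX c + b' * c^`())) Q.
Proof.
rewrite /field_op !(dXD, dXN, dXM, derivD, derivN, derivM) !dX_deriv; ring.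
Qed.

End AffineOperator.

Section SemidirectAction.
Variables (F : numFieldType) (k l : nat).
Hypotheses (hk : (1 < k)%N) (hkl : (k <= l)%N).
Implicit Types P Q : {poly {poly F}}.
Local Notation gl2_center := (lie_prod (lie_abelian F^o) (gl F 2)).

(** The central factor is the scaling of z, which commutes with the fields v(x) d/dy that make up
    V_k. *)
Definition center_rep_act (x : gl2_center) (v : 'cV[F]_k) := gl2_rep F k x.2 v.

Fact center_rep_linearl v : linear (center_rep_act^~ v).
Proof. by move=> a x y; exact: lie_act_linearl. Qed.

Fact center_rep_linearr x : linear (center_rep_act x).
Proof. exact: lie_act_linearr. Qed.

Fact center_rep_bracket x y v : center_rep_act (lie_bracket x y) v =
  center_rep_act x (center_rep_act y v) - center_rep_act y (center_rep_act x v).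
Proof. exact: lie_act_bracket. Qed.

Definition center_rep : lieRep gl2_center 'cV[F]_k :=
  LieRep center_rep_linearl center_rep_linearr center_rep_bracket.

Local Notation L := (semidirect center_rep).
(** Dimension of the block of y^j, whose coefficient has degree below l - (k-1) j in x. The last of
    the [N] blocks has dimension 0 when k - 1 divides l. *)
Local Notation deg j := (l - k.-1 * j)%N.
Local Notation N := (l %/ k.-1).+1.
Local Notation W := 'cV[F]_(\sum_(i < N) deg i).

(** With [op_y] and [op_z], the components of the field attached to an element of [L]. The matrix
    moves x projectively and rescales y and z by multiples of [gl2_form _ i1]. The minus signs make
    the brackets with v d/dy and with p y^j d/dz reproduce [gl2_act] in degrees k - 1 and l - 1 -
    (k-1) j. *)
Definition op_x (x : L) : {poly {poly F}} := (gl2_field x.1.2)%:P.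
Definition op_y (x : L) : {poly {poly F}} :=
  - (k.-1%:R * (gl2_form x.1.2 i1)%:P) * 'X + (col_poly x.2)%:P.
Definition op_z (x : L) : {poly {poly F}} :=
  ((x.1.1 : F)%:P - l.-1%:R * gl2_form x.1.2 i1)%:P.

Definition op (x : L) Q := field_op (op_x x) (op_y x) (op_z x) Q.

Definition enc (w : W) : {poly {poly F}} :=
  \poly_(j < N) (if insub j is Some i then col_poly (submxcol w i) else 0).

Definition dec (Q : {poly {poly F}}) : W := \mxcol_i poly_col (deg i) Q`_i.

Let m0 : (0 < k.-1)%N. Proof. by lia. Qed.

Lemma coef_enc (w : W) (j : 'I_N) : (enc w)`_j = col_poly (submxcol w j).
Proof. by rewrite coef_poly ltn_ord valK. Qed.

Lemma encK : cancel enc dec.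
Proof. by move=> w; apply/mxcolP => i; rewrite mxcolK coef_enc col_polyK. Qed.

Let deg_big j : (N <= j)%N -> (l <= k.-1 * j)%N.
Proof.
move=> Nj; rewrite [l](divn_eq _ k.-1) mulnC.
have h : (k.-1 * N <= k.-1 * j)%N by rewrite leq_mul2l Nj orbT.
by apply: leq_trans h; rewrite mulnS addnC leq_add2r ltnW // ltn_mod.
Qed.

Lemma weightP Q : weight_lt k.-1 l Q <-> forall j, (size (Q`_j)%R <= deg j)%N.
Proof.
split=> [wQ j|sQ i j ij]; first by apply/leq_sizeP => i ij; apply: wQ; lia.
by move/leq_sizeP: (sQ j); apply; lia.
Qed.

Lemma enc_weight (w : W) : weight_lt k.-1 l (enc w).
Proof.
apply/weightP => j; have [jN|jN] := ltnP j N.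
  by rewrite (coef_enc w (Ordinal jN)) size_col_poly.
by rewrite coef_poly ltnNge jN size_poly0.
Qed.

Lemma decK Q : weight_lt k.-1 l Q -> enc (dec Q) = Q.
Proof.
move=> /weightP sQ; apply/polyP=> j; have [jN|jN] := ltnP j N.
  by rewrite (coef_enc _ (Ordinal jN)) mxcolK poly_colK // sQ.
rewrite coef_poly ltnNge jN /=; apply/esym/eqP.
by rewrite -size_poly_eq0 -leqn0 (leq_trans (sQ j)) // leqn0 subn_eq0 deg_big.
Qed.

Let submxcol_linear a (u v : W) i :
  submxcol (a *: u + v) i = a *: submxcol u i + submxcol v i.
Proof. by apply/matrixP=> s t; rewrite !mxE. Qed.

Lemma enc_linear a (u v : W) : enc (a *: u + v) = a%:P%:P * enc u + enc v.
Proof.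
apply/polyP=> j; rewrite coefD coefCM; have [jN|jN] := ltnP j N.
  rewrite !(coef_enc _ (Ordinal jN)) mul_polyC -col_poly_linear.
  by rewrite submxcol_linear.
by rewrite !coef_poly ltnNge jN /= mulr0 addr0.
Qed.

Lemma dec_linear a P Q : dec (a%:P%:P * P + Q) = a *: dec P + dec Q.
Proof.
apply/mxcolP => i; rewrite submxcol_linear !mxcolK coefD coefCM mul_polyC.
exact: poly_col_linear.
Qed.

(** On y^j the part of [op_y] linear in y lowers the multiplier l - 1 by (k-1) j, which leaves the
    action on forms of degree deg j - 1; the V_k part shifts y^(j+1) to y^j. The bound on deg j
    keeps the truncated predecessor exact. *)
Lemma coef_op (x : L) Q j : (0 < deg j)%N -> (op x Q)`_j =
  gl2_act (deg j).-1 x.1.2 Q`_j - (x.1.1 : F)%:P * Q`_j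
  + (col_poly x.2 * Q`_j.+1) *+ j.+1.
Proof.
move=> dj; rewrite /op /field_op /op_x /op_y /op_z coefB coefD !coefCM.
rewrite [(_ * 'X + _) * _]mulrDl coefD coefCM.
have -> : (dX Q)`_j = (Q`_j)^`().
  by apply/polyP=> i; rewrite coef_dX coef_deriv.
have -> : (- (k.-1%:R * (gl2_form x.1.2 i1)%:P) * 'X * Q^`())`_j =
    - (k.-1%:R * gl2_form x.1.2 i1) * Q`_j *+ j.
  rewrite -polyC_natr -polyCM -polyCN -mulrA coefCM coefXM.
  by case: j {dj} => [|j] /=; rewrite ?mulr0 // coef_deriv mulrnAr.
rewrite coef_deriv /gl2_act mulrnAr.
have -> : (deg j).-1%:R = l.-1%:R - k.-1%:R * j%:R :> {poly F}.
  rewrite -natrM -natrB; last by lia.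
  by congr (_%:R); lia.
rewrite -[in X in _ + (X + _)]mulr_natr; ring.
Qed.

Lemma op_weight (x : L) Q : weight_lt k.-1 l Q -> weight_lt k.-1 l (op x Q).
Proof.
move=> /[dup] wQ /weightP sQ; apply/weightP => j.
(* If deg j = 0, all coefficients of Q from y^j on vanish, and therefore this coefficient of the
   image does too. *)
have [dj|dj] := posnP (deg j).
  have z i : (j <= i)%N -> Q`_i = 0.
    move=> ji; apply/eqP; rewrite -size_poly_eq0 -leqn0 (leq_trans (sQ i)) //.
    have h : (k.-1 * j <= k.-1 * i)%N by rewrite leq_mul2l ji orbT.
    by lia.
  rewrite dj leqn0 size_poly_eq0 /op /field_op coefB coefD !coefCM.
  rewrite [(_ * 'X + _) * _]mulrDl coefD coefCM coef_deriv (z j.+1) // mul0rn mulr0 addr0 z // mulr0.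
  have -> : (dX Q)`_j = 0.
    by apply/polyP=> i; rewrite coef_dX z // coef0 mul0rn coef0.
  rewrite mulr0 subr0 add0r -polyC_natr -polyCM -polyCN -mulrA coefCM coefXM.
  case: j {dj} z => [|j] z /=; first by rewrite mulr0.
  by rewrite coef_deriv z // mul0rn mulr0.
rewrite coef_op //; apply: size_add_le.
  apply: size_sub_le; first by rewrite size_gl2_act.
  by rewrite mul_polyC (leq_trans (size_scale_leq _ _)).
rewrite -scaler_nat (leq_trans (size_scale_leq _ _)) //.
have [Q0|Q0] := eqVneq Q`_j.+1 0; first by rewrite Q0 mulr0 size_poly0.
apply: (leq_trans (size_polyMleq _ _)).
(* Multiplication by an element of V_k raises the degree in x by at most k - 1, the gap allowed
   between the coefficients of y^(j+1) and y^j. *)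
have := size_col_poly x.2; have := sQ j.+1.
rewrite -size_poly_gt0 in Q0; rewrite mulnS; lia.
Qed.

Lemma op_x_bracket (x y : L) : op_x (lie_bracket x y) =
  op_x x * dX (op_x y) + op_y x * (op_x y)^`()
  - (op_x y * dX (op_x x) + op_y y * (op_x x)^`()).
Proof.
rewrite /op_x !dXC !derivC !mulr0 !addr0 -!polyCM -polyCB.
by rewrite -gl2_field_bracket.
Qed.

Lemma op_y_bracket (x y : L) : op_y (lie_bracket x y) =
  op_x x * dX (op_y y) + op_y x * (op_y y)^`()
  - (op_x y * dX (op_y x) + op_y y * (op_y x)^`()).
Proof.
have e : col_poly (lie_bracket x y).2 =
    gl2_act k.-1 x.1.2 (col_poly y.2) - gl2_act k.-1 y.1.2 (col_poly x.2).
  rewrite -!col_poly_rep /= /center_rep_act.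
  by rewrite addrC -scaleN1r col_poly_linear scaleN1r addrC.
rewrite /op_y e /op_x /= gl2_form_bracket /gl2_act.
have dXn n : dX (n%:R : {poly {poly F}}) = 0 by rewrite -!polyC_natr dXC derivC.
have dYn n : (n%:R : {poly {poly F}})^`() = 0 by rewrite -polyC_natr derivC.
move: (col_poly _) (col_poly _) => p q.
move: (gl2_field _) (gl2_field _) (gl2_form _ _) (gl2_form _ _) => a b c d.
rewrite !dXD !dXM !dXN !dXM !dXC dXX dXn !derivD !derivM !derivN !derivM !derivC.
rewrite dYn derivX !(polyCB, polyCD, polyCM) !polyC_natr; ring.
Qed.

Lemma op_z_bracket (x y : L) : op_z (lie_bracket x y) =
  op_x x * dX (op_z y) + op_y x * (op_z y)^`()
  - (op_x y * dX (op_z x) + op_y y * (op_z x)^`()).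
Proof.
rewrite /op_z /op_x !dXC !derivC !mulr0 !addr0 -!polyCM -polyCB; congr (_%:P).
have dn n : (n%:R : {poly F})^`() = 0 by rewrite -polyC_natr derivC.
rewrite /= gl2_form_bracket.
move: (gl2_field _) (gl2_field _) (gl2_form _ _) (gl2_form _ _) => a b c d.
by rewrite !derivB !derivC !derivM dn polyC0; ring.
Qed.

Lemma op_bracket (x y : L) Q :
  op (lie_bracket x y) Q = op x (op y Q) - op y (op x Q).
Proof.
by rewrite /op field_op_bracket -op_x_bracket -op_y_bracket -op_z_bracket.
Qed.

Lemma op_xZ a (x y : L) : op_x (a *: x + y) = a%:P%:P * op_x x + op_x y.
Proof. by rewrite /op_x gl2_fieldZ polyCD polyCM. Qed.

Lemma op_yZ a (x y : L) : op_y (a *: x + y) = a%:P%:P * op_y x + op_y y.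
Proof.
rewrite /op_y gl2_formZ col_poly_linear -mul_polyC !(polyCD, polyCM); ring.
Qed.

Lemma op_zZ a (x y : L) : op_z (a *: x + y) = a%:P%:P * op_z x + op_z y.
Proof.
rewrite /op_z gl2_formZ -polyCM -polyCD; congr (_%:P).
by rewrite /= polyCD polyCM; ring.
Qed.

Definition sigma_act (x : L) (w : W) : W := dec (op x (enc w)).

Lemma enc_sigma x w : enc (sigma_act x w) = op x (enc w).
Proof. by rewrite decK //; apply/op_weight/enc_weight. Qed.

Fact sigma_linearl w : linear (sigma_act^~ w).
Proof.
move=> a x y; rewrite /sigma_act -dec_linear; congr (dec _).
by rewrite /op /field_op op_xZ op_yZ op_zZ; ring.
Qed.

Fact sigma_linearr x : linear (sigma_act x).
Proof.
move=> a u v; rewrite /sigma_act -dec_linear enc_linear; congr (dec _).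
rewrite /op /field_op dXD derivD dXM derivM dXC !derivC polyC0.
by ring.
Qed.

Fact sigma_bracket x y w : sigma_act (lie_bracket x y) w =
  sigma_act x (sigma_act y w) - sigma_act y (sigma_act x w).
Proof.
rewrite /sigma_act !enc_sigma op_bracket addrC -mulN1r -polyC1 -polyCN -polyC1 -polyCN.
by rewrite dec_linear scaleN1r addrC.
Qed.

Definition sigma : lieRep L W := LieRep sigma_linearl sigma_linearr sigma_bracket.

(** Without a V_k component nothing shifts the power of y, so each block is preserved; a block of
    dimension 0 is handled apart because of the predecessor of its dimension. *)
Lemma sigma_rep_sum (A : gl F 2) w : sigma ((0, A), 0) w =
  rep_sum (fun i : 'I_N => gl2_rep F (l - k.-1 * i)%N) A w.
Proof.
apply/mxcolP => i; rewrite !mxcolK /= /gl2_rep_act.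
have [d0|d0] := posnP (deg i).
  by apply/matrixP => -[s hs]; exfalso; rewrite d0 in hs.
by rewrite coef_op //= coef_enc col_poly0 polyC0 !mul0r mul0rn addr0 subr0.
Qed.

End SemidirectAction.

From mathcomp Require Import all_classical all_reals all_analysis.
Import numFieldNormedType.Exports.
Import SymmetricPower Dehomogenization.
Local Open Scope classical_set_scope.
Local Open Scope ring_scope.

(** * Smooth and polynomial functions on row vectors *)

Section SmoothScalar.
Variables (R : realType) (V : normedModType R).
Implicit Types f g : V -> R.

Lemma CkW (W : normedModType R) n (f : V -> W) : Ck n.+1 f -> Ck n f.
Proof.
elim: n f => [|n IH] f [df cf]; first by move=> p; exact: differentiable_continuous.
by split=> // v; apply: IH.
Qed.

Lemma smooth_diff (W : normedModType R) (f : V -> W) p :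
  smooth f -> differentiable f p.
Proof. by move/(_ 1) => [+ _]; apply. Qed.

Lemma smooth_derive (W : normedModType R) (f : V -> W) v :
  smooth f -> smooth ('D_v f).
Proof. by move=> sf n; have [_] := sf n.+1; apply. Qed.

Lemma smooth_cst (W : normedModType R) (w : W) : smooth (fun _ : V => w).
Proof.
have Ck0 n : Ck n (fun _ : V => 0 : W).
  elim: n => [|n IH]; first exact: cst_continuous.
  split=> [p|v]; first exact: differentiable_cst.
  rewrite (_ : 'D_v _ = (fun=> 0)) //; apply/funext => p; exact: derive_cst.
case=> [|n]; first exact: cst_continuous.
split=> [p|v]; first exact: differentiable_cst.
by rewrite (_ : 'D_v _ = (fun=> 0)) //; apply/funext => p; exact: derive_cst.
Qed.

Lemma deriveD_fun (f g : V -> R) v p : differentiable f p -> differentiable g p ->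
  'D_v (fun x => f x + g x) p = 'D_v f p + 'D_v g p.
Proof. by move=> df dg; rewrite -deriveD //; apply: diff_derivable. Qed.

Lemma deriveM_fun (f g : V -> R) v p : differentiable f p -> differentiable g p ->
  'D_v (fun x => f x * g x) p = f p * 'D_v g p + g p * 'D_v f p.
Proof.
move=> df dg; rewrite -[RHS](_ : 'D_v (f * g) p = _) //.
by rewrite deriveM //; apply: diff_derivable.
Qed.

Lemma CkD n f g : Ck n f -> Ck n g -> Ck n (fun x => f x + g x).
Proof.
elim: n f g => [|n IH] f g; first by move=> cf cg p; apply: continuousD; [exact: cf|exact: cg].
move=> [df cf] [dg cg]; split=> [p|v]; first exact: differentiableD.
rewrite (_ : 'D_v _ = fun x => 'D_v f x + 'D_v g x).
  by apply: IH; [exact: cf|exact: cg].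
by apply/funext => p; exact: deriveD_fun.
Qed.

Lemma CkM n f g : Ck n f -> Ck n g -> Ck n (fun x => f x * g x).
Proof.
elim: n f g => [|n IH] f g; first by move=> cf cg p; apply: continuousM; [exact: cf|exact: cg].
move=> /[dup] /CkW cf [df cdf] /[dup] /CkW cg [dg cdg].
split=> [p|v]; first exact: differentiableM.
rewrite (_ : 'D_v _ = fun x => f x * 'D_v g x + g x * 'D_v f x).
  by apply: CkD; apply: IH; [exact: cf|exact: cdg|exact: cg|exact: cdf].
by apply/funext => p; exact: deriveM_fun.
Qed.

Lemma smoothD f g : smooth f -> smooth g -> smooth (fun x => f x + g x).
Proof. by move=> sf sg n; apply: CkD. Qed.

Lemma smoothM f g : smooth f -> smooth g -> smooth (fun x => f x * g x).
Proof. by move=> sf sg n; apply: CkM. Qed.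

Lemma smooth_sum I (r : seq I) (F : I -> V -> R) :
  (forall i, smooth (F i)) -> smooth (fun p => \sum_(i <- r) F i p).
Proof.
move=> sF; elim: r => [|i r IH].
  by under eq_fun => p do rewrite big_nil; exact: smooth_cst.
by under eq_fun => p do rewrite big_cons; apply: smoothD.
Qed.

End SmoothScalar.

Section RowVectors.
Variables (R : realType) (N : nat).
Local Notation E := 'rV[R]_N.+1.
Local Notation e_ i := (delta_mx ord0 i : E).
Implicit Types (f g : E -> R) (S T : E -> E).

Lemma rV_decomp (S : E -> E) : S = fun p => \sum_i S p ord0 i *: e_ i.
Proof.
apply/funext => p; rewrite [LHS]matrix_sum_delta big_ord1.
by [].
Qed.

Lemma differentiable_rV (V : normedModType R) (S : V -> E) p :
  (forall i, differentiable (fun q => S q ord0 i) p) -> differentiable S p.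
Proof.
move=> dS; rewrite (_ : S = \sum_(i < N.+1) (fun q => S q ord0 i *: e_ i)).
  by apply: differentiable_sum => i; apply: differentiableZl.
by apply/funext => q; rewrite fct_sumE [LHS]matrix_sum_delta big_ord1.
Qed.

Lemma differentiable_comp_rV (V : normedModType R) (S : V -> E) p i :
  differentiable S p -> differentiable (fun q => S q ord0 i) p.
Proof.
move=> dS; apply: (@differentiable_comp _ _ _ _ S (fun M : E => M ord0 i)) => //.
exact: differentiable_coord.
Qed.

Lemma derive_rV (V : normedModType R) (S : V -> E) p v i :
  differentiable S p -> ('D_v S p) ord0 i = 'D_v (fun q => S q ord0 i) p.
Proof. by move=> dS; rewrite derive_mx ?mxE //; apply: diff_derivable. Qed.

Lemma smooth_rV (V : normedModType R) (S : V -> E) :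
  smooth S <-> forall i, smooth (fun p => S p ord0 i).
Proof.
split=> [sS i n|sS n].
  elim: n S {sS} (sS n) => [|n IH] S.
    move=> cS p; apply: (@continuous_comp _ _ _ S (fun M : E => M ord0 i)); first exact: cS.
    exact: coord_continuous.
  move=> [dS cS]; split=> [p|v]; first exact: differentiable_comp_rV.
  rewrite (_ : 'D_v _ = fun p => ('D_v S) p ord0 i).
    by apply: IH; exact: cS.
  by apply/funext => p; rewrite derive_rV.
have {sS} : forall i, Ck n (fun p => S p ord0 i) by move=> i; exact: sS.
elim: n S => [|n IH] S cS.
  move=> p; apply/cvgrPdist_le => e e0; near=> q.
  rewrite [leLHS]/Num.Def.normr/= mx_normrE (bigmax_le _ (ltW e0)) //= => i _.
  rewrite !mxE (ord1 i.1); move: (i.2); near: q; apply: filter_forall => j.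
  exact: ((cvgrPdist_le _ _).1 (cS j p)).
have dS p : differentiable S p by apply: differentiable_rV => i; have [] := cS i.
split=> // v; apply: IH => i; have [_ /(_ v)] := cS i.
rewrite (_ : 'D_v _ = fun p => ('D_v S) p ord0 i) //.
by apply/funext => p; rewrite derive_rV.
Unshelve. all: by end_near. Qed.

Lemma smooth_coord i : smooth (fun p : E => p ord0 i).
Proof.
case=> [|n] /=.
  by move=> p; exact/differentiable_continuous/differentiable_coord.
split=> [p|v]; first exact: differentiable_coord.
rewrite (_ : 'D_v _ = fun=> v ord0 i); first exact: smooth_cst.
apply/funext => p; rewrite -(@derive_rV _ id) ?derive_id //.
Qed.

Lemma derive_coord (v p : E) i : 'D_v (fun q : E => q ord0 i) p = v ord0 i.
Proof. by rewrite -(@derive_rV _ id) ?derive_id. Qed.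

Lemma derive_sum_coord f v p : differentiable f p ->
  'D_v f p = \sum_i v ord0 i * 'D_(e_ i) f p.
Proof.
move=> df; rewrite deriveE // [v in LHS]matrix_sum_delta big_ord1 linear_sum.
by apply: eq_bigr => i _; rewrite linearZ [in RHS]deriveE.
Qed.

Lemma derive_smooth S f : smooth S -> smooth f -> smooth (fun p => 'D_(S p) f p).
Proof.
move=> /smooth_rV sS sf.
rewrite (_ : (fun p => _) = fun p => \sum_i S p ord0 i * 'D_(e_ i) f p).
  by apply: smooth_sum => i; apply: smoothM; [exact: sS|exact: smooth_derive].
by apply/funext => p; apply/derive_sum_coord/smooth_diff.
Qed.

(** An inductive class, so that smoothness, closure under derivatives and symmetry of second
    derivatives all follow by induction. *)
Inductive coord_poly : (E -> R) -> Prop :=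
| coord_poly_cst c : coord_poly (fun=> c)
| coord_poly_coord i : coord_poly (fun p => p ord0 i)
| coord_polyD f g : coord_poly f -> coord_poly g -> coord_poly (fun p => f p + g p)
| coord_polyM f g : coord_poly f -> coord_poly g -> coord_poly (fun p => f p * g p).

Lemma coord_poly_ext f g : f =1 g -> coord_poly g -> coord_poly f.
Proof. by move=> /funext ->. Qed.

Lemma coord_poly_diff f p : coord_poly f -> differentiable f p.
Proof.
elim=> {f} [c|i|f g _ df _ dg|f g _ df _ dg].
- exact: differentiable_cst.
- exact: differentiable_coord.
- exact: differentiableD.
- exact: differentiableM.
Qed.

Lemma coord_poly_smooth f : coord_poly f -> smooth f.
Proof.
elim=> {f} [c|i|f g _ sf _ sg|f g _ sf _ sg].
- exact: smooth_cst.
- exact: smooth_coord.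
- exact: smoothD.
- exact: smoothM.
Qed.

Lemma coord_poly_derive v f : coord_poly f -> coord_poly ('D_v f).
Proof.
elim=> {f} [c|i|f g pf df pg dg|f g pf df pg dg].
- rewrite (_ : 'D_v _ = fun=> 0); first exact: coord_poly_cst.
  by apply/funext => p; exact: derive_cst.
- rewrite (_ : 'D_v _ = fun=> v ord0 i); first exact: coord_poly_cst.
  by apply/funext => p; exact: derive_coord.
- rewrite (_ : 'D_v _ = fun p => 'D_v f p + 'D_v g p); first exact: coord_polyD.
  by apply/funext => p; apply: deriveD_fun; exact: coord_poly_diff.
- rewrite (_ : 'D_v _ = fun p => f p * 'D_v g p + g p * 'D_v f p).
    by apply: coord_polyD; apply: coord_polyM.
  by apply/funext => p; apply: deriveM_fun; exact: coord_poly_diff.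
Qed.

Lemma coord_poly_derive_comm u v f p : coord_poly f ->
  'D_u ('D_v f) p = 'D_v ('D_u f) p.
Proof.
move=> pf; elim: pf u v p => {f} [c|i|f g pf hf pg hg|f g pf hf pg hg] u v p.
- have D w : 'D_w (fun _ : E => c) = fun=> 0.
    by apply/funext => q; exact: derive_cst.
  by rewrite !D !derive_cst.
- have D w : 'D_w (fun q : E => q ord0 i) = fun=> w ord0 i.
    by apply/funext => q; exact: derive_coord.
  by rewrite !D !derive_cst.
- have D w : 'D_w (fun q => f q + g q) = fun q => 'D_w f q + 'D_w g q.
    by apply/funext => q; apply: deriveD_fun; exact: coord_poly_diff.
  have pD w h : coord_poly h -> differentiable ('D_w h) p.
    by move=> ph; apply/coord_poly_diff/coord_poly_derive.
  rewrite !D (deriveD_fun u (pD v f pf) (pD v g pg)).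
  by rewrite (deriveD_fun v (pD u f pf) (pD u g pg)) hf hg.
- have D w : 'D_w (fun q => f q * g q) = fun q => f q * 'D_w g q + g q * 'D_w f q.
    by apply/funext => q; apply: deriveM_fun; exact: coord_poly_diff.
  have pD w h : coord_poly h -> differentiable ('D_w h) p.
    by move=> ph; apply/coord_poly_diff/coord_poly_derive.
  have [df dg] := (coord_poly_diff p pf, coord_poly_diff p pg).
  have DD w w' : 'D_w (fun q => f q * 'D_w' g q + g q * 'D_w' f q) p =
      f p * 'D_w ('D_w' g) p + 'D_w' g p * 'D_w f p
      + (g p * 'D_w ('D_w' f) p + 'D_w' f p * 'D_w g p).
    have [dg' df'] := (pD w' g pg, pD w' f pf).
    rewrite (@deriveD_fun _ _ (fun q => f q * 'D_w' g q)
      (fun q => g q * 'D_w' f q)); [|exact: differentiableM|exact: differentiableM].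
    by rewrite (deriveM_fun w df dg') (deriveM_fun w dg df').
  rewrite (D v) (D u) (DD u v) (DD v u) (hf u v) (hg u v).
  move: (f p) (g p) ('D_v ('D_u f) p) ('D_v ('D_u g) p).
  by move: ('D_u f p) ('D_v f p) ('D_u g p) ('D_v g p) => *; ring.
Qed.

Definition coord_poly_field S := forall i, coord_poly (fun p => S p ord0 i).

Lemma coord_poly_sum I (r : seq I) (F : I -> E -> R) :
  (forall i, coord_poly (F i)) -> coord_poly (fun p => \sum_(i <- r) F i p).
Proof.
move=> pF; elim: r => [|i r IH].
  by under eq_fun => p do rewrite big_nil; exact: coord_poly_cst.
by under eq_fun => p do rewrite big_cons; apply: coord_polyD.
Qed.

Lemma derive_coord_poly S f :
  coord_poly_field S -> coord_poly f -> coord_poly (fun p => 'D_(S p) f p).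
Proof.
move=> pS pf; rewrite (_ : (fun p => _) = fun p => \sum_i S p ord0 i * 'D_(e_ i) f p).
  by apply: coord_poly_sum => i; apply: coord_polyM => //; apply: coord_poly_derive.
by apply/funext => p; apply/derive_sum_coord/coord_poly_diff.
Qed.

Lemma coord_poly_field_diff S p : coord_poly_field S -> differentiable S p.
Proof. by move=> pS; apply: differentiable_rV => i; apply: coord_poly_diff. Qed.

Lemma coord_poly_field_smooth S : coord_poly_field S -> smooth S.
Proof. by move=> pS; apply/smooth_rV => i; apply: coord_poly_smooth. Qed.

End RowVectors.

(** * Jets of polynomial curves *)

Section Curves.
Variable R : realType.
Implicit Types (p y : {poly R}) (f a : R -> R).

Lemma poly_antiderivative n p : (size p <= n)%N ->
  exists2 q : {poly R}, (size q <= n.+1)%N & q^`() = p.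
Proof.
move=> sp; exists (\poly_(i < n.+1) (p`_i.-1 / i%:R)); first exact: size_poly.
apply/polyP=> i; rewrite coef_deriv coef_poly ltnS; case: ltnP => [_|ni].
  by rewrite -[LHS]mulr_natr divfK // pnatr_eq0.
by rewrite mul0rn nth_default // (leq_trans sp).
Qed.

Lemma poly_fun_is_derive n f p : (size p <= n)%N ->
  (forall t, is_derive t (1 : R) f p.[t]) -> poly_fun n.+1 f.
Proof.
move=> /poly_antiderivative[q sq qp] df; exists (q + (f 0 - q.[0])%:P) => [|t].
  rewrite (leq_trans (size_polyD _ _)) // geq_max sq.
  by rewrite (leq_trans (size_polyC_leq1 _)).
have H u : is_derive u (1 : R) (f - horner q) 0.
  by rewrite -(subrr p.[u]) -{2}qp; apply: is_deriveB.
have := is_derive_0_is_cst t 0 H; rewrite !fctE hornerD hornerC => <-.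
by rewrite subrKC.
Qed.

Lemma is_derive_unique f t d d' :
  is_derive t (1 : R) f d -> is_derive t (1 : R) f d' -> d = d'.
Proof. by move=> [_ <-] [_ <-]. Qed.

Section Tower.
Variables (k : nat) (y : {poly R}) (b : nat -> R -> R) (a a' : R -> R).
Hypothesis sy : (size y <= k)%N.
Hypothesis da : forall t, is_derive t (1 : R) a (a' t).

(** The i-th derivative of the characteristic b_0 - y' a: the prolongation recursion for b_(i+1)
    says precisely that q_i' = q_(i+1). *)
Let q i t := b i t - y^`(i.+1).[t] * a t.

Let dq i t d : is_derive t (1 : R) (b i) (d + y^`(i.+1).[t] * a' t) ->
  is_derive t (1 : R) (q i) (d - y^`(i.+2).[t] * a t).
Proof.
move=> db; have dM := is_deriveM (is_derive_poly y^`(i.+1) t) (da t).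
apply: is_derive_eq (is_deriveB db dM) _.
rewrite -[y^`(i.+2)]/((y^`(i.+1))^`()) -![_ *: _]/(_ * _); ring.
Qed.

Let derivn_y i : (k <= i)%N -> y^`(i) = 0.
Proof. by move=> ki; apply/derivn_poly0/(leq_trans sy). Qed.

(** The last member of the tower has derivative zero, since the derivatives of y of order k and
    above vanish; each integration back towards q_0 raises the degree bound by one. *)
Lemma tower_poly_fun :
  (forall i, (i < k)%N -> forall t, is_derive t (1 : R) (b i)
     ((if (i.+1 < k)%N then b i.+1 t else 0) + y^`(i.+1).[t] * a' t)) ->
  (0 < k)%N -> poly_fun k (fun t => b 0 t - (y^`()).[t] * a t).
Proof.
move=> hb k0; suff H n : (0 < n <= k)%N -> poly_fun n (q (k - n)).
  by have := H k; rewrite k0 leqnn subnn => /(_ isT).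
elim: n => // n IH /andP[_ nk].
have [n0|n0] := posnP n.
  rewrite n0 in nk *; apply: (@poly_fun_is_derive 0 _ 0).
    by rewrite size_poly0.
  move=> t; have := hb (k - 1)%N ltac:(lia) t; rewrite ifF; last by lia.
  by move/dq; rewrite derivn_y ?horner0 ?mul0r ?subr0 //; lia.
have [p sp hp] := IH ltac:(lia).
apply: (poly_fun_is_derive sp) => t; rewrite -hp.
have := hb (k - n.+1)%N ltac:(lia) t; rewrite ifT; last by lia.
by move/dq; rewrite (_ : (k - n.+1).+1 = k - n)%N //; lia.
Qed.

(** The converse direction: each differentiation lowers the bound, so the last q is constant, and it
    equals the last b because y^(k) = 0. *)
Lemma tower_last :
  (forall i, (i.+1 < k)%N -> forall t,
     is_derive t (1 : R) (b i) (b i.+1 t + y^`(i.+1).[t] * a' t)) ->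
  (0 < k)%N -> poly_fun k (fun t => b 0 t - (y^`()).[t] * a t) ->
  exists c, forall t, b k.-1 t = c.
Proof.
move=> hb k0 b0; have H i : (i < k)%N -> poly_fun (k - i) (q i).
  elim: i => [|i IH] ik; first by rewrite subn0.
  have [p sp hp] := IH (ltnW ik); exists p^`() => [|t].
    apply/leq_sizeP => j kj; rewrite coef_deriv nth_default ?mul0rn //.
    by rewrite (leq_trans sp) //; lia.
  apply: (is_derive_unique (dq (hb i ik t))).
  by rewrite (_ : q i = horner p); [exact: is_derive_poly|exact/funext].
have [|p sp hp] := H k.-1; first by rewrite prednK.
exists p`_0 => t; have := hp t; rewrite /q prednK // derivn_y // horner0 mul0r subr0.
by move=> ->; rewrite [p]size1_polyC ?hornerC ?coefC //; apply: leq_trans sp _; lia.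
Qed.

End Tower.

Lemma poly_jet n (c : nat -> R) (x : R) : exists2 p : {poly R}, (size p <= n)%N &
  forall i, (i < n)%N -> p^`(i).[x] = c i.
Proof.
elim: n c => [|n IH] c; first by exists 0; rewrite ?size_poly0.
have [p sp hp] := IH (fun i => c i.+1).
have [q sq qp] := poly_antiderivative sp.
exists (q + (c 0 - q.[x])%:P) => [|[|i]].
- rewrite (leq_trans (size_polyD _ _)) // geq_max sq.
  by rewrite (leq_trans (size_polyC_leq1 _)).
- by rewrite hornerD hornerC subrKC.
- by move=> iN; rewrite derivSn derivD derivC addr0 qp hp.
Qed.

End Curves.

(** * The equation manifold and prolongations *)

Section Manifold.
Variables (R : realType) (k l : nat).
Hypotheses (hk : (0 < k)%N) (hl : (0 < l)%N).
Local Notation E := (eqn_mfd R k l).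
Local Notation e_ i := (delta_mx ord0 i : E).
Local Notation X := (@X_field R k l).
Local Notation xi := (x_idx k l).
Local Notation yi := (y_idx k l).
Local Notation zi := (z_idx k l).
Implicit Types (f : E -> R) (S T : vfield R k l) (p : E).

Lemma y_idxE i : (i < k)%N -> yi i = i.+1 :> nat.
Proof. by move=> ik; rewrite inordK // ltnS ltn_addr. Qed.

Lemma z_idxE j : (j < l)%N -> zi j = (k + j).+1 :> nat.
Proof. by move=> jl; rewrite inordK // ltnS ltn_add2l. Qed.

Lemma x_y_idx i : (i < k)%N -> (xi == yi i) = false.
Proof. by move=> ik; rewrite -val_eqE /= y_idxE. Qed.

Lemma x_z_idx j : (j < l)%N -> (xi == zi j) = false.
Proof. by move=> jl; rewrite -val_eqE /= z_idxE. Qed.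

Lemma y_y_idx i j : (i < k)%N -> (j < k)%N -> (yi i == yi j) = (i == j).
Proof. by move=> ik jk; rewrite -val_eqE /= !y_idxE. Qed.

Lemma z_z_idx i j : (i < l)%N -> (j < l)%N -> (zi i == zi j) = (i == j).
Proof. by move=> ik jk; rewrite -val_eqE /= !z_idxE // eqSS eqn_add2l. Qed.

Lemma y_z_idx i j : (i < k)%N -> (j < l)%N -> (yi i == zi j) = false.
Proof. by move=> ik jl; rewrite -val_eqE /= y_idxE // z_idxE //; lia. Qed.

Variant idx_spec : 'I_(k + l).+1 -> Type :=
| IdxX : idx_spec xi
| IdxY i of (i < k)%N : idx_spec (yi i)
| IdxZ j of (j < l)%N : idx_spec (zi j).

Lemma idxP i : idx_spec i.
Proof.
case: (unliftP ord0 i) => [j ->|->]; last exact: IdxX.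
case: (ltnP j k) => [jk|kj].
  rewrite (_ : lift ord0 j = yi j); first exact: IdxY.
  by apply: val_inj; rewrite /= y_idxE.
have jl : (j - k < l)%N by have := ltn_ord j; lia.
rewrite (_ : lift ord0 j = zi (j - k)); first exact: IdxZ.
by apply: val_inj; rewrite /= z_idxE // subnKC.
Qed.

Lemma mfdP (p q : E) : x_ p = x_ q -> (forall i, (i < k)%N -> y_ i p = y_ i q) ->
  (forall j, (j < l)%N -> z_ j p = z_ j q) -> p = q.
Proof.
by move=> hx hy hz; apply/rowP => i; case: (idxP i).
Qed.

Definition base_idx i := [|| i == xi, i == yi 0 | i == zi 0].

Section ComponentSums.
Variables (a b : nat -> R) (c : R) (m n : nat).
Hypotheses (mk : (m <= k)%N) (nl : (n <= l)%N).
(** The common shape of [X_field], whose sums stop one step early, and of [prolong], whose sums are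
    complete. *)
Let V : E := c *: e_ xi + \sum_(0 <= i < m) a i *: e_ (yi i)
  + \sum_(0 <= j < n) b j *: e_ (zi j).

Lemma x_component : V ord0 xi = c.
Proof.
rewrite !mxE !summxE big_nat big1 => [|i /andP[_ im]]; last first.
  by rewrite !mxE x_y_idx ?andbF ?mulr0 // (leq_trans im).
rewrite big_nat big1 => [|i /andP[_ im]]; last first.
  by rewrite !mxE x_z_idx ?andbF ?mulr0 // (leq_trans im).
by rewrite !eqxx mulr1 !addr0.
Qed.

Lemma y_component i : (i < k)%N -> V ord0 (yi i) = if (i < m)%N then a i else 0.
Proof.
move=> ik; rewrite !mxE !summxE (eq_sym (yi i)) x_y_idx // andbF mulr0 add0r.
rewrite [X in _ + X]big_nat [X in _ + X]big1 => [|j /andP[_ jm]]; last first.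
  by rewrite !mxE y_z_idx ?andbF ?mulr0 // (leq_trans jm).
rewrite addr0; under eq_big_nat => j /andP[_ jm].
  rewrite !mxE eqxx y_y_idx //; last exact: leq_trans mk.
  over.
case: ltnP => im.
  rewrite big_mkord (bigD1 (Ordinal im)) //= eqxx mulr1 big1 ?addr0 // => j.
  by rewrite -val_eqE /= eq_sym => /negPf ->; rewrite mulr0.
rewrite big_nat big1 // => j /andP[_ jm]; rewrite (_ : _ == _ = false) ?mulr0 //.
by apply/negbTE; rewrite gtn_eqF // (leq_trans jm).
Qed.

Lemma z_component i : (i < l)%N -> V ord0 (zi i) = if (i < n)%N then b i else 0.
Proof.
move=> il; rewrite !mxE !summxE (eq_sym (zi i)) x_z_idx // andbF mulr0 add0r.
rewrite [X in X + _]big_nat [X in X + _]big1 => [|j /andP[_ jm]]; last first.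
  by rewrite !mxE eq_sym y_z_idx ?andbF ?mulr0 // (leq_trans jm).
rewrite add0r; under eq_big_nat => j /andP[_ jm].
  rewrite !mxE eqxx z_z_idx //; last exact: leq_trans nl.
  over.
case: ltnP => im.
  rewrite big_mkord (bigD1 (Ordinal im)) //= eqxx mulr1 big1 ?addr0 // => j.
  by rewrite -val_eqE /= eq_sym => /negPf ->; rewrite mulr0.
rewrite big_nat big1 // => j /andP[_ jm]; rewrite (_ : _ == _ = false) ?mulr0 //.
by apply/negbTE; rewrite gtn_eqF // (leq_trans jm).
Qed.

End ComponentSums.

Lemma X_x p : X p ord0 xi = 1.
Proof.
by have := x_component (fun i => y_ i.+1 p) (fun j => z_ j.+1 p) 1
  (leq_pred k) (leq_pred l); rewrite scale1r.
Qed.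

Lemma X_y p i : (i < k)%N -> X p ord0 (yi i) = if (i.+1 < k)%N then y_ i.+1 p else 0.
Proof.
move=> ik; have := y_component (fun i => y_ i.+1 p) (fun j => z_ j.+1 p) 1
  (leq_pred k) (leq_pred l) ik; rewrite scale1r => ->.
by rewrite -ltnS prednK.
Qed.

Lemma X_z p i : (i < l)%N -> X p ord0 (zi i) = if (i.+1 < l)%N then z_ i.+1 p else 0.
Proof.
move=> ik; have := z_component (fun i => y_ i.+1 p) (fun j => z_ j.+1 p) 1
  (leq_pred k) (leq_pred l) ik; rewrite scale1r => ->.
by rewrite -ltnS prednK.
Qed.

Lemma X_coord_poly : coord_poly_field X.
Proof.
move=> i; case: (idxP i) => [|a ak|b bl].
- by apply: (coord_poly_ext (g := fun=> 1) X_x); exact: coord_poly_cst.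
- by apply: (coord_poly_ext
    (g := fun p => if (a.+1 < k)%N then y_ a.+1 p else 0) (fun p => X_y p ak)); case: (a.+1 < k)%N;
    [exact: coord_poly_coord|exact: coord_poly_cst].
- by apply: (coord_poly_ext
    (g := fun p => if (b.+1 < l)%N then z_ b.+1 p else 0) (fun p => X_z p bl)); case: (b.+1 < l)%N;
    [exact: coord_poly_coord|exact: coord_poly_cst].
Qed.

Definition lift_fun (f : R -> R -> R -> R) p := f (x_ p) (y_ 0 p) (z_ 0 p).

Section ProlongComponents.
Variable V : vfield3 R.
Let A := lift_fun (fun x y z => (V x y z).1.1).
Let B := lift_fun (fun x y z => (V x y z).1.2).
Let C := lift_fun (fun x y z => (V x y z).2).

Lemma prolong_x p : prolong k l V p ord0 xi = A p.
Proof. exact: x_component. Qed.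

Lemma prolong_y p i : (i < k)%N ->
  prolong k l V p ord0 (yi i) = prol_coef (@y_ R k l) A B i p.
Proof. by move=> ik; rewrite [LHS]y_component // ik. Qed.

Lemma prolong_z p j : (j < l)%N ->
  prolong k l V p ord0 (zi j) = prol_coef (@z_ R k l) A C j p.
Proof. by move=> jl; rewrite [LHS]z_component // jl. Qed.

End ProlongComponents.

End Manifold.

(** * Symmetries of first kind as conditions on components *)

Section Symmetries.
Variables (R : realType) (k l : nat).
Hypotheses (hk : (0 < k)%N) (hl : (0 < l)%N).
Local Notation E := (eqn_mfd R k l).
Local Notation e_ i := (delta_mx ord0 i : E).
Local Notation X := (@X_field R k l).
Local Notation xi := (x_idx k l).
Local Notation yi := (y_idx k l).
Local Notation zi := (z_idx k l).
Local Notation base_idx := (@base_idx k l).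
Implicit Types (f : E -> R) (S T V : vfield R k l) (p : E).

Let J := [seq yi i | i <- iota 1 k.-1] ++ [seq zi j | j <- iota 1 l.-1].

Let mem_J j : (j \in J) = ~~ base_idx j.
Proof.
rewrite mem_cat /base_idx; case: (idxP hk hl j) => [|a ak|b bl].
- rewrite eqxx /=; apply/negbTE; rewrite negb_or; apply/andP; split.
    apply/mapP=> -[i]; rewrite mem_iota => /andP[_ ik] /eqP.
    by rewrite x_y_idx //; lia.
  apply/mapP=> -[i]; rewrite mem_iota => /andP[_ ik] /eqP.
  by rewrite x_z_idx //; lia.
- rewrite eq_sym x_y_idx // y_y_idx // y_z_idx // orbF /= orbC.
  case: mapP => [[i]|_] /=.
    rewrite mem_iota => /andP[_ ik] /eqP; rewrite y_z_idx //; lia.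
  apply/mapP/idP => [[i]|a0].
    rewrite mem_iota => /andP[i0 ik] /eqP; rewrite y_y_idx // ?lia; last by lia.
    by move=> /eqP ->; rewrite -lt0n.
  by exists a => //; rewrite mem_iota; lia.
- rewrite eq_sym x_z_idx // [_ == yi 0]eq_sym y_z_idx // z_z_idx //=.
  case: mapP => [[i]|_] /=.
    by rewrite mem_iota => /andP[_ ik] /eqP; rewrite eq_sym y_z_idx //; lia.
  apply/mapP/idP => [[i]|a0].
    rewrite mem_iota => /andP[i0 ik] /eqP; rewrite z_z_idx //; last by lia.
    by move=> /eqP ->; rewrite -lt0n.
  by exists b => //; rewrite mem_iota; lia.
Qed.

Let uniq_J : uniq J.
Proof.
rewrite cat_uniq !map_inj_in_uniq ?iota_uniq ?andbT /=.
- apply/hasPn => j /mapP[b]; rewrite mem_iota => /andP[_ bl] ->.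
  apply/mapP=> -[a]; rewrite mem_iota => /andP[_ ak] /eqP.
  by rewrite eq_sym y_z_idx //; lia.
- move=> a b; rewrite !mem_iota => ha hb /eqP; rewrite z_z_idx; [|lia|lia].
  by move/eqP.
- move=> a b; rewrite !mem_iota => ha hb /eqP; rewrite y_y_idx; [|lia|lia].
  by move/eqP.
Qed.

Let F1_seq : [seq @d_dy R k l i | i <- iota 1 k.-1] ++
    [seq @d_dz R k l j | j <- iota 1 l.-1] = [seq (fun=> e_ j) | j <- J].
Proof. by rewrite map_cat -!map_comp. Qed.

Lemma F1_distP V : F1_dist V <->
  (forall i, smooth (fun p => V p ord0 i)) /\
  (forall i p, base_idx i -> V p ord0 i = 0).
Proof.
rewrite /F1_dist F1_seq; split=> [[c [sc ->]]|[sV V0]].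
  have cE i : (fun p => (\sum_(n < size [seq (fun=> e_ j) : vfield R k l | j <- J])
      c n p *: ([seq (fun=> e_ j) : vfield R k l | j <- J]`_n) p) ord0 i) =
      fun p => \sum_(n < size J) c n p * (i == nth xi J n)%:R.
    apply/funext => p; rewrite summxE size_map; apply: eq_bigr => n _.
    by rewrite !mxE (nth_map xi) // mxE eqxx.
  split=> [i|i p bi].
    rewrite cE; apply: smooth_sum => n; apply: smoothM => //.
    exact: smooth_cst.
  have /(congr1 (fun f => f p)) /= -> := cE i.
  rewrite big1 // => n _; case: eqP => [iJ|]; last by rewrite mulr0.
  have : i \in J by rewrite iJ mem_nth.
  by rewrite mem_J bi.
exists (fun n p => V p ord0 (nth xi J n)); split=> [n|]; first exact: sV.
apply/funext => p; rewrite {1}(rV_decomp V) size_map.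
transitivity (\sum_(j <- J) V p ord0 j *: e_ j).
  rewrite [RHS]big_uniq //= [LHS](bigID (mem J)) /= addrC big1 ?add0r //.
  by move=> i; rewrite mem_J negbK => /V0 ->; rewrite scale0r.
rewrite (big_nth xi) big_mkord; apply: eq_bigr => n _.
by rewrite (nth_map xi).
Qed.

Lemma E_distP V : E_dist V <->
  exists c : E -> R, smooth c /\ V = fun p => c p *: X p.
Proof.
split=> [[c [sc ->]]|[c [sc ->]]].
  by exists (c 0); split=> //; apply/funext => p; rewrite big_ord1.
exists (fun=> c); split=> //.
by apply/funext => p; rewrite big_ord1.
Qed.

Lemma vf_bracketE S T p i : differentiable S p -> differentiable T p ->
  vf_bracket S T p ord0 i =
  'D_(S p) (fun q => T q ord0 i) p - 'D_(T p) (fun q => S q ord0 i) p.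
Proof. by move=> dS dT; rewrite !mxE !derive_rV. Qed.

Lemma X_smooth : smooth X.
Proof. exact/coord_poly_field_smooth/X_coord_poly. Qed.

(** By the Leibniz rule the condition on E need only be tested on X, and the one on F_1 on its
    constant generators, where it says that the components along x, y_0, z_0 do not depend on the
    other coordinates. *)
Lemma sym_first_kindP S : sym_first_kind R k l S <->
  [/\ smooth S,
      exists2 c : E -> R, smooth c & forall p, vf_bracket S X p = c p *: X p &
      forall i j p, base_idx i -> ~~ base_idx j ->
        'D_(e_ j) (fun q => S q ord0 i) p = 0].
Proof.
split=> [[sS SE SF]|[sS [c sc hc] hS]]; split=> //.
- have /SE/E_distP[c [sc hc]] : E_dist X.
    apply/E_distP; exists (fun=> 1); split; first exact: smooth_cst.
    by apply/funext => p; rewrite scale1r.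
  by exists c => // p; rewrite hc.
- move=> i j p bi bj; have /SF/F1_distP[_ H] : F1_dist (fun=> e_ j).
    apply/F1_distP; split=> [i'|i' q bi']; first exact: smooth_cst.
    by rewrite mxE eqxx /=; case: eqP => // ij; move: bj; rewrite -ij bi'.
  have := H i p bi; rewrite vf_bracketE; [|exact: smooth_diff|exact: differentiable_cst].
  by rewrite derive_cst sub0r => /eqP; rewrite oppr_eq0 => /eqP.
- move=> V /E_distP[b [sb ->]]; apply/E_distP.
  (* From [S, b X] = S(b) X + b [S, X]. *)
  exists (fun p => 'D_(S p) b p + b p * c p); split.
    by apply: smoothD; [exact: derive_smooth|exact: smoothM].
  have dX p : differentiable X p by apply/smooth_diff/X_smooth.
  have dS p : differentiable S p by apply: smooth_diff.
  have db p : differentiable b p by apply: smooth_diff.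
  have dXi i p : differentiable (fun q => X q ord0 i) p.
    exact: differentiable_comp_rV.
  apply/funext => p; apply/rowP => i.
  have sbX : differentiable (fun q => b q *: X q) p.
    apply: differentiable_rV => j; rewrite (_ : (fun _ => _) = fun q => b q * X q ord0 j).
      exact: differentiableM.
    by apply/funext => q; rewrite mxE.
  rewrite vf_bracketE // (_ : (fun q => (b q *: X q) ord0 i) = fun q => b q * X q ord0 i).
    have scE (a : R) (M : E) : (a *: M) ord0 i = a * M ord0 i by rewrite mxE.
    rewrite deriveM_fun // scE mulrDl.
    have := congr1 (fun M : E => M ord0 i) (hc p).
    rewrite /= vf_bracketE // scE => /eqP.
    rewrite subr_eq => /eqP ->.
    have -> : 'D_(b p *: X p) (fun q => S q ord0 i) p =
              b p * 'D_(X p) (fun q => S q ord0 i) p.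
      have dSi : differentiable (fun q => S q ord0 i) p by apply: differentiable_comp_rV.
      by rewrite !deriveE // linearZ.
    move: ('D_(X p) _ p) ('D_(S p) b p) (X p ord0 i) (b p) (c p) => *; ring.
  by apply/funext => q; rewrite mxE.
move=> V /F1_distP[sV V0]; have {}sV' : smooth V by apply/smooth_rV.
apply/F1_distP; split=> [i|i p bi].
  rewrite (_ : (fun p => _) = fun p => 'D_(S p) (fun q => V q ord0 i) p
      + (-1) * 'D_(V p) (fun q => S q ord0 i) p).
    apply: smoothD; first exact: derive_smooth.
    apply: smoothM; first exact: smooth_cst.
    by apply: derive_smooth => //; exact: (smooth_rV S).1.
  apply/funext => p; rewrite vf_bracketE ?mulN1r //; exact: smooth_diff.
rewrite vf_bracketE; [|exact: smooth_diff|exact: smooth_diff].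
rewrite (_ : (fun q => V q ord0 i) = fun=> 0); last by apply/funext => q; rewrite V0.
rewrite derive_cst sub0r derive_sum_coord; last first.
  by apply: differentiable_comp_rV; apply: smooth_diff.
(* For base indices j the component of V vanishes, for the others the derivative of S. *)
rewrite big1 ?oppr0 // => j _; case: (boolP (base_idx j)) => bj.
  by rewrite V0 // mul0r.
by rewrite hS // mulr0.
Qed.

End Symmetries.

Section Affine.
Variable R : realType.

(** The hypothesis makes the difference quotient independent of the base point. The derivative is
    therefore constant, and g minus a linear function has derivative zero. *)
Lemma affine_second_difference (g : R -> R) :
  (forall t, derivable g t 1) ->
  (forall z h h', g (z + h + h') - g (z + h) - g (z + h') + g z = 0) ->
  forall z, g z = (g 1 - g 0) * z + g 0.
Proof.
move=> dg hg; set c := 'D_1 g 0.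
have dgc t : 'D_1 g t = c.
  rewrite /c /derive; set F1 := (fun h : R => _); set F2 := (fun h : R => _).
  suff -> : F1 = F2 by []; apply/funext => h; rewrite /F1 /F2 /=.
  have := hg 0 t (h *: 1); rewrite !add0r addr0 [_ + t]addrC => H.
  by congr (_ *: _); apply/subr0_eq; apply: etrans H; ring.
have H t : is_derive t (1 : R) (g - c *: id) 0.
  have h1 : is_derive t (1 : R) g c by apply: DeriveDef.
  have h2 := is_deriveZ c (is_derive_id t (1 : R)).
  by apply: is_derive_eq (is_deriveB h1 h2) _; rewrite [_ *: _]mulr1 subrr.
have lin z : g z = c * z + g 0.
  have := is_derive_0_is_cst z 0 H; rewrite !fctE scaler0 subr0 => <-.
  by rewrite -[_ *: _]/(c * z) subrKC.
by move=> z; rewrite (lin 1) mulr1 addrK; exact: lin.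
Qed.

End Affine.

(** * Functions on the base and integral curves of X *)

Section Prolongation.
Variables (R : realType) (k l : nat).
Hypotheses (hk : (0 < k)%N) (hl : (0 < l)%N).
Local Notation E := (eqn_mfd R k l).
Local Notation e_ i := (delta_mx ord0 i : E).
Local Notation X := (@X_field R k l).
Local Notation X_der := (@X_der R k l).
Local Notation xi := (x_idx k l).
Local Notation yi := (y_idx k l).
Local Notation zi := (z_idx k l).
Local Notation base_idx := (@base_idx k l).
Local Notation lift_fun := (@lift_fun R k l).
Implicit Types (f : E -> R) (S T : vfield R k l) (V W : vfield3 R) (p q : E).

Lemma is_derive_curve f (c : R -> E) t v : differentiable f (c t) ->
  differentiable c t -> 'D_1 c t = v ->
  is_derive t (1 : R) (fun t => f (c t)) ('D_v f (c t)).
Proof.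
move=> df dc <-; have dfc : differentiable (f \o c) t by apply: differentiable_comp.
apply: DeriveDef; first exact: diff_derivable.
rewrite -[LHS]/('D_1 (f \o c) t) deriveE // diff_comp //=.
by rewrite (deriveE _ df) (deriveE _ dc).
Qed.

(** On the segment from q to p only non-base coordinates move, and f has no derivative in these
    directions. *)
Lemma base_fun_const f p q : (forall p, differentiable f p) ->
  (forall j p, ~~ base_idx j -> 'D_(e_ j) f p = 0) ->
  (forall i, base_idx i -> p ord0 i = q ord0 i) -> f p = f q.
Proof.
move=> df hf pq; pose c (t : R) : E := q + t *: (p - q).
have cE i : (fun t => c t ord0 i) =
    horner ((p ord0 i - q ord0 i) *: 'X + (q ord0 i)%:P).
  by apply/funext => t; rewrite !mxE !hornerE addrC mulrC.
have dc t : differentiable c t.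
  apply: differentiable_rV => i; rewrite cE.
  exact/derivable1_diffP/derivable_horner.
have dg (t : R) : is_derive t (1 : R) (fun t => f (c t)) 0.
  have Dc : 'D_1 c t = p - q.
    apply/rowP => i; rewrite derive_rV // cE !mxE.
    by rewrite derive_val derivD derivZ derivX derivC !hornerE.
  apply: is_derive_eq (is_derive_curve (df _) (dc t) Dc) _.
  rewrite derive_sum_coord // big1 // => j _.
  case: (boolP (base_idx j)) => bj; last by rewrite hf // mulr0.
  by rewrite !mxE pq // subrr mul0r.
have := is_derive_0_is_cst 1 0 dg.
by rewrite /c scale1r scale0r addr0 subrKC.
Qed.

Definition base_pt (x y z : R) : E :=
  x *: e_ xi + y *: e_ (yi 0) + z *: e_ (zi 0).

Lemma base_pt_x x y z : base_pt x y z ord0 xi = x.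
Proof. by rewrite !mxE !eqxx x_y_idx // x_z_idx //= !mulr0 !addr0 mulr1. Qed.

Lemma base_pt_y x y z : base_pt x y z ord0 (yi 0) = y.
Proof.
by rewrite !mxE !eqxx eq_sym x_y_idx // y_z_idx //= !mulr0 addr0 add0r mulr1.
Qed.

Lemma base_pt_z x y z : base_pt x y z ord0 (zi 0) = z.
Proof.
rewrite !mxE !eqxx eq_sym x_z_idx // eq_sym y_z_idx //= !mulr0 !add0r.
by rewrite mulr1.
Qed.

Lemma base_fun_lift f p : (forall p, differentiable f p) ->
  (forall j p, ~~ base_idx j -> 'D_(e_ j) f p = 0) ->
  f p = lift_fun (fun x y z => f (base_pt x y z)) p.
Proof.
move=> df hf; apply: base_fun_const => // i /or3P[]/eqP ->.
- by rewrite base_pt_x.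
- by rewrite base_pt_y.
- by rewrite base_pt_z.
Qed.

Lemma derive_lift_fun F p j : ~~ base_idx j -> 'D_(e_ j) (lift_fun F) p = 0.
Proof.
rewrite !negb_or => /and3P[jx jy jz]; apply/lim_near_cst => //; near=> h.
rewrite /= /lift_fun /x_ /y_ /z_ !mxE eqxx /= (eq_sym xi) (eq_sym (yi 0)).
rewrite (eq_sym (zi 0)) (negPf jx) (negPf jy) (negPf jz) mulr0 !add0r.
by rewrite subrr scaler0.
Unshelve. all: by end_near. Qed.

(** The jet of the curve (t, y(t), z(t)), an integral curve of X when y and z solve the system. The
    shifts undo the numbering of y_i by i + 1 and of z_j by k + j + 1. *)
Definition gam (y z : {poly R}) (t : R) : E :=
  \row_i (if i == xi then t else if (i <= k)%N then y^`(i.-1).[t]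
          else z^`(i - k.+1).[t]).

Lemma gam_x y z t : gam y z t ord0 xi = t.
Proof. by rewrite mxE eqxx. Qed.

Lemma gam_y y z t i : (i < k)%N -> gam y z t ord0 (yi i) = y^`(i).[t].
Proof. by move=> ik; rewrite mxE eq_sym x_y_idx // y_idxE // ik. Qed.

Lemma gam_z y z t j : (j < l)%N -> gam y z t ord0 (zi j) = z^`(j).[t].
Proof.
move=> jl; rewrite mxE eq_sym x_z_idx // z_idxE // ifF; last by lia.
by rewrite subSS addKn.
Qed.

(** It lets identities on the manifold be checked along solution curves. *)
Lemma gam_through p : exists y z : {poly R},
  [/\ (size y <= k)%N, (size z <= l)%N & gam y z (x_ p) = p].
Proof.
have [y sy hy] := poly_jet k (fun i => y_ i p) (x_ p).
have [z sz hz] := poly_jet l (fun i => z_ i p) (x_ p).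
exists y, z; split=> //; apply: (mfdP hk hl) => [|i ik|j jl].
- exact: gam_x.
- by rewrite /y_ gam_y // hy.
- by rewrite /z_ gam_z // hz.
Qed.

Section AlongCurve.
Variables y z : {poly R}.
Hypotheses (sy : (size y <= k)%N) (sz : (size z <= l)%N).
Local Notation g := (gam y z).

Let gam_poly i : {p : {poly R} | (fun t => g t ord0 i) = horner p}.
Proof.
case: (idxP hk hl i) => [|a ak|b bl].
- by exists 'X; apply/funext => t; rewrite gam_x hornerX.
- by exists y^`(a); apply/funext => t; rewrite gam_y.
- by exists z^`(b); apply/funext => t; rewrite gam_z.
Qed.

Lemma gam_diff t : differentiable g t.
Proof.
apply: differentiable_rV => i; have [p ->] := gam_poly i.
exact/derivable1_diffP/derivable_horner.
Qed.

Lemma derive_gam t : 'D_1 g t = X (g t).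
Proof.
have dp (p : {poly R}) : 'D_1 (horner p) t = (p^`()).[t].
  by have [_ ->] := is_derive_poly p t.
apply/rowP => i; rewrite derive_rV; last exact: gam_diff.
case: (idxP hk hl i) => [|a ak|b bl].
- rewrite (_ : (fun _ => _) = id) ?derive_id ?X_x //.
  by apply/funext => u; rewrite gam_x.
- rewrite (_ : (fun _ => _) = horner y^`(a)) ?dp ?X_y //; last first.
    by apply/funext => u; rewrite gam_y.
  rewrite -derivnS; case: ltnP => ak'; first by rewrite /y_ gam_y.
  by rewrite derivn_poly0 ?horner0 // (leq_trans sy).
- rewrite (_ : (fun _ => _) = horner z^`(b)) ?dp ?X_z //; last first.
    by apply/funext => u; rewrite gam_z.
  rewrite -derivnS; case: ltnP => bl'; first by rewrite /z_ gam_z.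
  by rewrite derivn_poly0 ?horner0 // (leq_trans sz).
Qed.

Lemma is_derive_gam f t : differentiable f (g t) ->
  is_derive t (1 : R) (fun t => f (g t)) (X_der f (g t)).
Proof.
by move=> df; apply: is_derive_curve => //; [exact: gam_diff|exact: derive_gam].
Qed.

End AlongCurve.
End Prolongation.

(** * Prolongations and the curve condition *)

Section ProlongationTheorems.
Variables (R : realType) (k l : nat).
Hypotheses (hk : (0 < k)%N) (hl : (0 < l)%N).
Local Notation E := (eqn_mfd R k l).
Local Notation e_ i := (delta_mx ord0 i : E).
Local Notation X := (@X_field R k l).
Local Notation X_der := (@X_der R k l).
Local Notation xi := (x_idx k l).
Local Notation yi := (y_idx k l).
Local Notation zi := (z_idx k l).
Local Notation base_idx := (@base_idx k l).
Local Notation lift_fun := (@lift_fun R k l).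
Local Notation comp S i := (fun p : E => S p ord0 i).
Implicit Types (f : E -> R) (S T : vfield R k l) (V W : vfield3 R) (p q : E).

Let dX p : differentiable X p.
Proof. by apply: coord_poly_field_diff; exact: X_coord_poly. Qed.

(* Treats the fibre coordinates y_0, ..., y_(k-1) and z_0, ..., z_(l-1) alike. *)
Section Block.
Variables (n : nat) (idx : nat -> 'I_(k + l).+1) (u : nat -> E -> R).
Hypotheses (n0 : (0 < n)%N) (uE : forall i p, u i p = p ord0 (idx i)).
Hypothesis X_idx : forall p i, (i < n)%N ->
  X p ord0 (idx i) = if (i.+1 < n)%N then u i.+1 p else 0.

(** The x component of [S, X] = c X identifies c as minus the X-derivative of the x component of S;
    the components of the block then become the prolongation recursion, with right-hand side zero at
    the last index. *)
Lemma X_der_block S c : (forall p, differentiable S p) ->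
  (forall p, vf_bracket S X p = c p *: X p) ->
  forall i p, (i < n)%N -> X_der (comp S (idx i)) p =
    if (i.+1 < n)%N then S p ord0 (idx i.+1) + u i.+1 p * X_der (comp S xi) p
    else 0.
Proof.
move=> dS hc i p iN.
have br j : 'D_(S p) (comp X j) p - X_der (comp S j) p = c p * X p ord0 j.
  by rewrite -vf_bracketE // hc mxE.
have := br xi; rewrite (_ : comp X xi = fun=> 1); last exact/funext/X_x.
rewrite derive_cst sub0r X_x // mulr1 => cE.
have := br (idx i); rewrite -cE X_idx //.
rewrite (_ : comp X (idx i) = fun p => if (i.+1 < n)%N then u i.+1 p else 0);
  last by apply/funext => q; rewrite X_idx.
case: ltnP => iN'; last by rewrite derive_cst sub0r mulr0 => /eqP; rewrite oppr_eq0 => /eqP.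
rewrite (_ : (fun p => u i.+1 p) = comp id (idx i.+1)); last exact/funext/uE.
rewrite derive_coord mulNr => /eqP; rewrite subr_eq addrC -subr_eq => /eqP <-.
by rewrite opprK mulrC.
Qed.

Lemma block_prol_coef S c : (forall p, differentiable S p) ->
  (forall p, vf_bracket S X p = c p *: X p) ->
  forall i p, (i < n)%N ->
    S p ord0 (idx i) = prol_coef u (comp S xi) (comp S (idx 0)) i p.
Proof.
move=> dS hc; elim=> // i IH p iN /=.
rewrite -(_ : comp S (idx i) = prol_coef u (comp S xi) (comp S (idx 0)) i).
  by rewrite (X_der_block dS hc) ?iN ?addrK // ltnW.
by apply/funext => q; rewrite IH // ltnW.
Qed.

Section BlockCurve.
Variables (y z w : {poly R}).
Hypotheses (sy : (size y <= k)%N) (sz : (size z <= l)%N) (sw : (size w <= n)%N).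
Hypothesis gam_idx : forall t i, (i < n)%N ->
  gam k l y z t ord0 (idx i) = w^`(i).[t].

Lemma block_curve S c : (forall p, differentiable S p) ->
  (forall p, vf_bracket S X p = c p *: X p) ->
  poly_fun n (fun t => S (gam k l y z t) ord0 (idx 0)
                       - (w^`()).[t] * S (gam k l y z t) ord0 xi).
Proof.
move=> dS hc; have dSi i p : differentiable (comp S i) p.
  exact: differentiable_comp_rV.
apply: (@tower_poly_fun _ n w (fun i t => S (gam k l y z t) ord0 (idx i))
  (fun t => S (gam k l y z t) ord0 xi)
  (fun t => X_der (comp S xi) (gam k l y z t))) => // [t|i iN t].
  exact: (is_derive_gam hk hl sy sz (dSi xi _)).
apply: is_derive_eq (is_derive_gam hk hl sy sz (dSi (idx i) _)) _.
rewrite (X_der_block dS hc) //; case: ltnP => iN'.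
  by rewrite uE gam_idx.
by rewrite derivn_poly0 ?horner0 ?mul0r ?addr0 // (leq_trans sw).
Qed.

(** The recursion holds by definition for all coefficients but the last; the curve condition
    supplies the missing equation, that X annihilates the last coefficient. *)
Lemma block_curve_last (A B : E -> R) : coord_poly A ->
  (forall i, (i < n)%N -> coord_poly (prol_coef u A B i)) ->
  poly_fun n (fun t => B (gam k l y z t) - (w^`()).[t] * A (gam k l y z t)) ->
  forall t, X_der (prol_coef u A B n.-1) (gam k l y z t) = 0.
Proof.
move=> pA pB hB t; have dB i : (i.+1 < n)%N -> forall t, is_derive t (1 : R)
    (fun t => prol_coef u A B i (gam k l y z t))
    (prol_coef u A B i.+1 (gam k l y z t)
     + (w^`(i.+1)).[t] * X_der A (gam k l y z t)).
  move=> iN t'; have pBi := coord_poly_diff (gam k l y z t') (pB i (ltnW iN)).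
  apply: is_derive_eq (is_derive_gam hk hl sy sz pBi) _.
  by rewrite -gam_idx // -uE /= subrK.
have dA t' := is_derive_gam hk hl sy sz (coord_poly_diff (gam k l y z t') pA).
have [c hc] := tower_last sw dA dB n0 hB.
have pBn := coord_poly_diff (gam k l y z t) (pB n.-1 ltac:(lia)).
apply: (is_derive_unique (is_derive_gam hk hl sy sz pBn)).
rewrite (_ : (fun t => _) = fun=> c); last exact/funext.
exact: is_derive_cst.
Qed.

End BlockCurve.

Lemma prol_coef_coord_poly (A B : E -> R) i :
  coord_poly A -> coord_poly B -> coord_poly (prol_coef u A B i).
Proof.
move=> pA pB; elim: i => //= i IH; have pX := X_coord_poly R hk hl.
have uP : coord_poly (u i.+1).
  by rewrite (_ : u i.+1 = comp id (idx i.+1));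
    [exact: coord_poly_coord|exact/funext/uE].
apply: (coord_poly_ext (g := fun p =>
    X_der (prol_coef u A B i) p + (-1) * (u i.+1 p * X_der A p))) => [p|].
  by rewrite mulN1r.
apply: coord_polyD; first exact: derive_coord_poly.
apply: coord_polyM; first exact: coord_poly_cst.
by apply: coord_polyM => //; exact: derive_coord_poly.
Qed.

End Block.

Let X_y' p i (ik : (i < k)%N) := @X_y R k l hk hl p i ik.
Let X_z' p i (il : (i < l)%N) := @X_z R k l hk hl p i il.

Definition comp_x V x y z := (V x y z).1.1.
Definition comp_y V x y z := (V x y z).1.2.
Definition comp_z V x y z := (V x y z).2.
Definition field_curve_cond V := curve_cond k l (comp_x V) (comp_y V) (comp_z V).
Definition coord_poly3 V := [/\ coord_poly (lift_fun (comp_x V)),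
  coord_poly (lift_fun (comp_y V)) & coord_poly (lift_fun (comp_z V))].

Lemma lift_gam F y z t : lift_fun F (gam k l y z t) = F t y.[t] z.[t].
Proof. by rewrite /lift_fun /x_ /y_ /z_ gam_x gam_y // gam_z. Qed.

(** Proportionality to X determines all higher components from the three base ones. It serves for
    symmetries and again for brackets of prolongations. *)
Lemma prolong_unique S c V : (forall p, differentiable S p) ->
  (forall p, vf_bracket S X p = c p *: X p) ->
  (forall p, S p ord0 xi = lift_fun (comp_x V) p) ->
  (forall p, S p ord0 (yi 0) = lift_fun (comp_y V) p) ->
  (forall p, S p ord0 (zi 0) = lift_fun (comp_z V) p) ->
  S = prolong k l V /\ field_curve_cond V.
Proof.
move=> dS hc hx hy hz.
have [[hx' hy'] hz'] := (funext hx, funext hy, funext hz).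
split; last first.
  move=> y z sy sz; split.
    have := block_curve hk (fun _ _ => erefl) X_y' sy sz sy
      (fun t i ik => gam_y l y z t ik) dS hc.
    by apply: poly_fun_ext => t; rewrite hx hy !lift_gam.
  have := block_curve hl (fun _ _ => erefl) X_z' sy sz sz
      (fun t i ik => gam_z hk hl y z t ik) dS hc.
  by apply: poly_fun_ext => t; rewrite hx hz !lift_gam.
apply/funext => p; apply/rowP => i; case: (idxP hk hl i) => [|a ak|b bl].
- by rewrite prolong_x // hx.
- rewrite prolong_y // (block_prol_coef (fun _ _ => erefl) X_y' dS hc) //.
  by rewrite hx' hy'.
- rewrite prolong_z // (block_prol_coef (fun _ _ => erefl) X_z' dS hc) //.
  by rewrite hx' hz'.
Qed.

Lemma prolong_coord_poly V : coord_poly3 V -> coord_poly_field (prolong k l V).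
Proof.
move=> [px py pz] i; case: (idxP hk hl i) => [|a ak|b bl].
- exact: coord_poly_ext (@prolong_x R k l V) px.
- apply: coord_poly_ext (fun p => prolong_y hk hl V p ak) _.
  by apply: (@prol_coef_coord_poly yi) => // ? ?.
- apply: coord_poly_ext (fun p => prolong_z hk hl V p bl) _.
  by apply: (@prol_coef_coord_poly zi) => // ? ?.
Qed.

(** All components except the last of each block agree by construction of the prolongation; those
    two are checked along the solution curve through p. *)
Lemma prolong_bracket_X V p : coord_poly3 V -> field_curve_cond V ->
  vf_bracket (prolong k l V) X p = (- X_der (lift_fun (comp_x V)) p) *: X p.
Proof.
move=> pV cV; have [px py pz] := pV.
have pS := coord_poly_field_diff _ (prolong_coord_poly pV).
have [y [z [sy sz gp]]] := gam_through hk hl p.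
have [hy hz] := cV y z sy sz.
have compE j f : (forall q, prolong k l V q ord0 j = f q) ->
    comp (prolong k l V) j = f by move=> /funext.
have cx := compE _ _ (@prolong_x R k l V).
apply/rowP => i; rewrite vf_bracketE // [RHS]mxE.
case: (idxP hk hl i) => [|a ak|b bl].
- rewrite (_ : comp X xi = fun=> 1); last exact/funext/X_x.
  by rewrite derive_cst sub0r X_x // mulr1 cx.
- rewrite (_ : comp X (yi a) = fun q => if (a.+1 < k)%N then y_ a.+1 q else 0);
    last by apply/funext => q; rewrite X_y.
  rewrite X_y // (compE _ _ (fun q => prolong_y hk hl V q ak)).
  case: ltnP => ak'.
    by rewrite derive_coord prolong_y //= mulNr addrAC subrr sub0r mulrC.
  rewrite derive_cst mulr0 sub0r (_ : a = k.-1); last by lia.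
  rewrite -gp -[X in - X]/(X_der _ _).
  rewrite (@block_curve_last k yi (@y_ R k l) hk _ y z y sy sz sy) ?oppr0 //.
  + by move=> t j jk; exact: gam_y.
  + by move=> j _; apply: (@prol_coef_coord_poly yi) => // ? ?.
  + by apply: poly_fun_ext hy => t; rewrite !lift_gam.
- rewrite (_ : comp X (zi b) = fun q => if (b.+1 < l)%N then z_ b.+1 q else 0);
    last by apply/funext => q; rewrite X_z.
  rewrite X_z // (compE _ _ (fun q => prolong_z hk hl V q bl)).
  case: ltnP => bl'.
    by rewrite derive_coord prolong_z //= mulNr addrAC subrr sub0r mulrC.
  rewrite derive_cst mulr0 sub0r (_ : b = l.-1); last by lia.
  rewrite -gp -[X in - X]/(X_der _ _).
  rewrite (@block_curve_last l zi (@z_ R k l) hl _ y z z sy sz sz) ?oppr0 //.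
  + by move=> t j jl; exact: gam_z.
  + by move=> j _; apply: (@prol_coef_coord_poly zi) => // ? ?.
  + by apply: poly_fun_ext hz => t; rewrite !lift_gam.
Qed.

Lemma prolong_sym V : coord_poly3 V -> field_curve_cond V ->
  sym_first_kind R k l (prolong k l V).
Proof.
move=> pV cV; have [px py pz] := pV; apply/(sym_first_kindP hk hl).
split; first exact/coord_poly_field_smooth/prolong_coord_poly.
  exists (fun p => (-1) * X_der (lift_fun (comp_x V)) p).
    apply: smoothM; first exact: smooth_cst.
    by apply: derive_smooth; [exact: X_smooth|exact: coord_poly_smooth].
  by move=> p; rewrite prolong_bracket_X // mulN1r.
move=> i j p bi bj; suff [F ->] : exists F, comp (prolong k l V) i = lift_fun F.
  exact: derive_lift_fun.
case/or3P: bi => /eqP ->.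
- by exists (comp_x V); apply/funext => q; rewrite prolong_x.
- by exists (comp_y V); apply/funext => q; rewrite prolong_y.
- by exists (comp_z V); apply/funext => q; rewrite prolong_z.
Qed.

Lemma sym_prolong S : sym_first_kind R k l S -> exists V,
  [/\ S = prolong k l V, field_curve_cond V &
   forall x y, (forall z h h', comp_z V x y (z + h + h') - comp_z V x y (z + h)
       - comp_z V x y (z + h') + comp_z V x y z = 0) ->
     forall z, comp_z V x y z =
       (comp_z V x y 1 - comp_z V x y 0) * z + comp_z V x y 0].
Proof.
move=> /(sym_first_kindP hk hl)[sS [c _ hc] hS].
have dS p : differentiable S p by apply: smooth_diff.
have dSi i p : differentiable (comp S i) p by apply: differentiable_comp_rV.
(* The base components do not depend on the other coordinates, so they may be read off where those
   vanish. *)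
pose V x y z : R * R * R := let q := base_pt k l x y z in
  (S q ord0 xi, S q ord0 (yi 0), S q ord0 (zi 0)).
have hb i : base_idx i -> forall p, S p ord0 i =
    lift_fun (fun x y z => S (base_pt k l x y z) ord0 i) p.
  move=> bi p; apply: (base_fun_lift hk hl (f := comp S i)) => // j q bj.
  exact: hS.
have bx : base_idx xi by rewrite /base_idx eqxx.
have by_ : base_idx (yi 0) by rewrite /base_idx eqxx orbT.
have bz : base_idx (zi 0) by rewrite /base_idx eqxx !orbT.
have [SV cV] := prolong_unique (V := V) dS hc (hb _ bx) (hb _ by_) (hb _ bz).
exists V; split=> // x y; apply: affine_second_difference => t.
apply/derivable1_diffP.
apply: (@differentiable_comp _ _ _ _ (base_pt k l x y) (comp S (zi 0))).
  by [].
exact: dSi.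
Qed.

End ProlongationTheorems.

(** * Brackets of polynomial fields on the manifold *)

Section FieldBracket.
Variables (R : realType) (k l : nat).
Local Notation E := (eqn_mfd R k l).
Local Notation e_ i := (delta_mx ord0 i : E).
Local Notation comp S i := (fun p : E => S p ord0 i).
Local Notation "S # f" := (fun p : E => 'D_(S p) f p) (at level 40, left associativity).
Implicit Types (f : E -> R) (S T X : vfield R k l).

Lemma deriveB_fun f g (v p : E) : differentiable f p -> differentiable g p ->
  'D_v (fun x => f x - g x) p = 'D_v f p - 'D_v g p.
Proof. by move=> df dg; rewrite -deriveB //; apply: diff_derivable. Qed.

(** In coordinates the second-order parts of the two iterated derivatives agree, by
    [coord_poly_derive_comm]. *)
Lemma derive_bracket S T f p :
  coord_poly_field S -> coord_poly_field T -> coord_poly f ->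
  (S # (T # f)) p - (T # (S # f)) p = 'D_(vf_bracket S T p) f p.
Proof.
move=> pS pT pf; have df q : differentiable f q by apply: coord_poly_diff.
have pD i : coord_poly ('D_(e_ i) f) by apply: coord_poly_derive.
have expand S' T' : coord_poly_field S' -> coord_poly_field T' ->
    (S' # (T' # f)) p = \sum_i \sum_j T' p ord0 i * S' p ord0 j *
        'D_(e_ j) ('D_(e_ i) f) p
      + \sum_i 'D_(S' p) (comp T' i) p * 'D_(e_ i) f p.
  move=> pS' pT'; have -> : T' # f = \sum_i (fun q => T' q ord0 i * 'D_(e_ i) f q).
    by apply/funext => q; rewrite derive_sum_coord // fct_sumE.
  rewrite derive_sum => [|i]; last first.
    by apply/diff_derivable/coord_poly_diff/coord_polyM.
  rewrite -big_split /=; apply: eq_bigr => i _.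
  have d1 := coord_poly_diff p (pT' i); have d2 := coord_poly_diff p (pD i).
  rewrite (deriveM_fun _ d1 d2) [in X in _ * X + _](derive_sum_coord _ d2).
  rewrite mulr_sumr [X in _ + X]mulrC; congr (_ + _).
  by apply: eq_bigr => j _; rewrite mulrA.
rewrite expand // expand // opprD addrACA [X in X + _](_ : _ = 0) ?add0r.
  rewrite -sumrB derive_sum_coord //; apply: eq_bigr => i _.
  by rewrite vf_bracketE ?mulrBl //; apply: coord_poly_field_diff.
apply/eqP; rewrite subr_eq0; apply/eqP; rewrite exchange_big /=.
apply: eq_bigr => j _; apply: eq_bigr => i _.
by rewrite coord_poly_derive_comm // [T p ord0 i * _]mulrC.
Qed.

Lemma bracket_coord_poly S T :
  coord_poly_field S -> coord_poly_field T -> coord_poly_field (vf_bracket S T).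
Proof.
move=> pS pT i; have dS p := coord_poly_field_diff p pS.
have dT p := coord_poly_field_diff p pT.
apply: (coord_poly_ext (g := fun p => (S # comp T i) p + (-1) * (T # comp S i) p)).
  by move=> p; rewrite vf_bracketE // mulN1r.
apply: coord_polyD; first exact: derive_coord_poly.
apply: coord_polyM; [exact: coord_poly_cst|exact: derive_coord_poly].
Qed.

(** Jacobi's identity: [[S, T], X] = [S, t X] - [T, s X], where the two terms s t X cancel. It is
    verified componentwise. *)
Lemma bracket_multiplier S T X (s t : E -> R) p :
  coord_poly_field S -> coord_poly_field T -> coord_poly_field X ->
  coord_poly s -> coord_poly t ->
  (forall p, vf_bracket S X p = s p *: X p) ->
  (forall p, vf_bracket T X p = t p *: X p) ->
  vf_bracket (vf_bracket S T) X p = ((S # t) p - (T # s) p) *: X p.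
Proof.
move=> pS pT pX ps pt hS hT.
have dF (S' : vfield R k l) (pS' : coord_poly_field S') q :=
  coord_poly_field_diff q pS'.
have dU := dF _ (bracket_coord_poly pS pT).
apply/rowP => i; rewrite (vf_bracketE _ (dU p) (dF _ pX p)) [RHS]mxE.
have br S' c q : coord_poly_field S' ->
    (forall p, vf_bracket S' X p = c p *: X p) ->
    (X # comp S' i) q = (S' # comp X i) q - c q * X q ord0 i.
  move=> pS' /(_ q)/(congr1 (fun M : E => M ord0 i)).
  rewrite /= (vf_bracketE _ (dF _ pS' q) (dF _ pX q)).
  by rewrite [in X in X -> _]mxE => <-; rewrite subKr.
have XLf S' c f : coord_poly_field S' -> coord_poly f ->
    (forall p, vf_bracket S' X p = c p *: X p) ->
    (X # (S' # f)) p = (S' # (X # f)) p - c p * (X # f) p.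
  move=> pS' pf /(_ p) h; have := derive_bracket p pS' pX pf.
  rewrite h; have df := coord_poly_diff p pf.
  rewrite [in X in _ = X]deriveE // linearZ /= -deriveE // => /eqP.
  by rewrite subr_eq addrC -subr_eq => /eqP <-.
have XX S' T' c c' : coord_poly_field S' -> coord_poly_field T' ->
    coord_poly c' ->
    (forall p, vf_bracket S' X p = c p *: X p) ->
    (forall p, vf_bracket T' X p = c' p *: X p) ->
    (X # (S' # comp T' i)) p = (S' # (T' # comp X i)) p
      - ((S' # c') p * X p ord0 i + c' p * (S' # comp X i) p)
      - c p * ((T' # comp X i) p - c' p * X p ord0 i).
  move=> pS' pT' pc' hS' hT'; rewrite (XLf _ _ _ pS' (pT' i) hS') (br _ _ p pT' hT').
  congr (_ - _); rewrite (_ : X # comp T' i =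
      fun q => (T' # comp X i) q - c' q * X q ord0 i); last first.
    by apply/funext => q; exact: (br _ _ q pT' hT').
  have d1 : differentiable (T' # comp X i) p.
    by apply: coord_poly_diff; apply: derive_coord_poly.
  have dc := coord_poly_diff p pc'; have dXi := coord_poly_diff p (pX i).
  rewrite (deriveB_fun _ d1); last exact: differentiableM.
  by rewrite (deriveM_fun _ dc dXi) [X in _ - X]addrC [X in _ - (X + _)]mulrC.
rewrite -derive_bracket // (_ : comp (vf_bracket S T) i =
    fun q => (S # comp T i) q - (T # comp S i) q); last first.
  by apply/funext => q; rewrite vf_bracketE //; exact: dF.
rewrite deriveB_fun; try by apply: coord_poly_diff; apply: derive_coord_poly.
rewrite (XX S T s t) // (XX T S t s) //.
move: ((S # (T # comp X i)) p) ((T # (S # comp X i)) p) => /= a b.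
move: ('D_(S p) t p) ('D_(T p) s p) (X p ord0 i) (s p) (t p) => a1 a2 a3 a4 a5.
by move: ('D_(T p) _ p) ('D_(S p) _ p) => a6 a7; ring.
Qed.

End FieldBracket.

Section ProlongBracket.
Variables (R : realType) (k l : nat).
Hypotheses (hk : (0 < k)%N) (hl : (0 < l)%N).
Local Notation E := (eqn_mfd R k l).
Implicit Types V W Z : vfield3 R.

(** By [bracket_multiplier] the bracket falls under [prolong_unique], so only its three base
    components have to be computed. *)
Lemma prolong_bracket V W Z :
  coord_poly3 k l V -> coord_poly3 k l W ->
  field_curve_cond k l V -> field_curve_cond k l W ->
  let U := vf_bracket (prolong k l V) (prolong k l W) in
  (forall p, U p ord0 (x_idx k l) = lift_fun (comp_x Z) p) ->
  (forall p, U p ord0 (y_idx k l 0) = lift_fun (comp_y Z) p) ->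
  (forall p, U p ord0 (z_idx k l 0) = lift_fun (comp_z Z) p) ->
  U = prolong k l Z.
Proof.
move=> pV pW cV cW U hx hy hz.
have [pS pT] := (prolong_coord_poly hk hl pV, prolong_coord_poly hk hl pW).
have [[px _ _] [qx _ _]] := (pV, pW).
have pX := X_coord_poly R hk hl.
have pL F : coord_poly (@lift_fun R k l (comp_x F)) ->
    coord_poly (fun p : E => - X_der (lift_fun (comp_x F)) p).
  move=> pF; apply: (coord_poly_ext
    (g := fun p : E => (-1) * X_der (lift_fun (comp_x F)) p)) => [p|].
    by rewrite mulN1r.
  apply: coord_polyM; first exact: coord_poly_cst.
  exact: (derive_coord_poly pX pF).
have dU p := coord_poly_field_diff p (bracket_coord_poly pS pT).
have hU p := bracket_multiplier p pS pT pX (pL _ px) (pL _ qx)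
  (fun p => prolong_bracket_X hk hl p pV cV) (fun p => prolong_bracket_X hk hl p pW cW).
by have [] := prolong_unique hk hl dU hU hx hy hz.
Qed.

Lemma prolong_linear a V W Z : coord_poly3 k l V -> coord_poly3 k l W ->
  (forall x y z, [/\ comp_x Z x y z = a * comp_x V x y z + comp_x W x y z,
    comp_y Z x y z = a * comp_y V x y z + comp_y W x y z &
    comp_z Z x y z = a * comp_z V x y z + comp_z W x y z]) ->
  prolong k l Z = a *: prolong k l V + prolong k l W.
Proof.
move=> pV pW hZ; have [[p1 p2 p3] [q1 q2 q3]] := (pV, pW).
have XL (f g : E -> R) p : coord_poly f -> coord_poly g ->
    X_der (fun q => a * f q + g q) p = a * X_der f p + X_der g p.
  move=> pf pg; have [df dg] := (coord_poly_diff p pf, coord_poly_diff p pg).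
  have dc : differentiable (fun _ : E => a) p by exact: differentiable_cst.
  have da : differentiable (fun q => a * f q) p by exact: differentiableM.
  rewrite /X_der (deriveD_fun _ da dg) (deriveM_fun _ dc df).
  by rewrite derive_cst mulr0 addr0.
have prolL n idx (A A' B B' : E -> R) p : coord_poly A -> coord_poly A' ->
    coord_poly B -> coord_poly B' ->
    let u i p := p ord0 (idx i) in
    prol_coef u (fun q => a * A q + A' q) (fun q => a * B q + B' q) n p =
    a * prol_coef u A B n p + prol_coef u A' B' n p.
  move=> pA pA' pB pB' u; elim: n p => //= n IH p.
  rewrite (_ : prol_coef u _ _ n = fun q => a * prol_coef u A B n q
    + prol_coef u A' B' n q); last exact/funext.
  rewrite !XL //; try by apply: (@prol_coef_coord_poly R k l hk hl idx).
  by move: (X_der _ p) (X_der _ p) => b c; ring.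
have liftL (F G H : R -> R -> R -> R) :
    (forall x y z, H x y z = a * F x y z + G x y z) ->
    lift_fun H = (fun q : E => a * lift_fun F q + lift_fun G q).
  by move=> h; apply/funext => q; rewrite /lift_fun h.
have hx : lift_fun (comp_x Z) = (fun q : E => _) :=
  liftL _ _ _ (fun x y z => let: And3 h _ _ := hZ x y z in h).
have hy : lift_fun (comp_y Z) = (fun q : E => _) :=
  liftL _ _ _ (fun x y z => let: And3 _ h _ := hZ x y z in h).
have hz : lift_fun (comp_z Z) = (fun q : E => _) :=
  liftL _ _ _ (fun x y z => let: And3 _ _ h := hZ x y z in h).
apply/funext => p; apply/rowP => i; rewrite [RHS]mxE [X in _ = X + _]mxE.
case: (idxP hk hl i) => [|b bk|b bl].
- by rewrite !prolong_x -[lift_fun _]/(lift_fun (comp_x Z)) hx.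
- rewrite !prolong_y // -[lift_fun (fun x y z => (Z x y z).1.1)]/(lift_fun (comp_x Z)).
  rewrite -[lift_fun (fun x y z => (Z x y z).1.2)]/(lift_fun (comp_y Z)) hx hy.
  exact: (@prolL b (y_idx k l)).
- rewrite !prolong_z // -[lift_fun (fun x y z => (Z x y z).1.1)]/(lift_fun (comp_x Z)).
  rewrite -[lift_fun (fun x y z => (Z x y z).2)]/(lift_fun (comp_z Z)) hx hz.
  exact: (@prolL b (z_idx k l)).
Qed.

End ProlongBracket.

(** * Prolongations of polynomial fields on R^3 *)

Section PolynomialFields.
Variables (R : realType) (k l : nat).
Hypotheses (hk : (0 < k)%N) (hl : (0 < l)%N).
Local Notation E := (eqn_mfd R k l).
Local Notation lift_fun := (@lift_fun R k l).
Implicit Types (P Q a b c d : {poly {poly R}}).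

Let lift_ev Q : E -> R := fun p => ev Q (x_ p) (y_ 0 p).

Lemma lift_ev_coord_poly Q : coord_poly (lift_ev Q).
Proof.
elim/poly_ind: Q => [|Q q IH].
  by apply: (coord_poly_ext (g := fun=> 0)) => [p|];
    [exact: ev0|exact: coord_poly_cst].
have pq : coord_poly (fun p : E => q.[x_ p]).
  elim/poly_ind: q => [|q c pq].
    by apply: (coord_poly_ext (g := fun=> 0)) => [p|];
      [rewrite horner0|exact: coord_poly_cst].
  apply: (coord_poly_ext (g := fun p : E => q.[x_ p] * x_ p + c)) => [p|].
    by rewrite hornerD hornerM hornerX hornerC.
  apply: coord_polyD; last exact: coord_poly_cst.
  by apply: coord_polyM => //; exact: coord_poly_coord.
apply: (coord_poly_ext (g := fun p => lift_ev Q p * y_ 0 p + q.[x_ p])) => [p|].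
  by rewrite /lift_ev evD evM evX evC.
by apply: coord_polyD => //; apply: coord_polyM => //; exact: coord_poly_coord.
Qed.

Lemma derive_lift_ev Q (v p : E) : 'D_v (lift_ev Q) p =
  v ord0 (x_idx k l) * lift_ev (dX Q) p + v ord0 (y_idx k l 0) * lift_ev Q^`() p.
Proof.
have dQ Q' q := coord_poly_diff q (lift_ev_coord_poly Q').
have D P P' : 'D_v (lift_ev (P + P')) p = 'D_v (lift_ev P) p + 'D_v (lift_ev P') p.
  rewrite -deriveD_fun //; congr ('D_v _ p).
  by apply/funext => q; exact: evD.
have M P P' : 'D_v (lift_ev (P * P')) p =
    lift_ev P p * 'D_v (lift_ev P') p + lift_ev P' p * 'D_v (lift_ev P) p.
  rewrite -deriveM_fun //; congr ('D_v _ p).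
  by apply/funext => q; exact: evM.
have cst (c : R) : 'D_v (lift_ev c%:P%:P) p = 0.
  rewrite (_ : lift_ev _ = fun=> c) ?derive_cst //.
  by apply/funext => q; rewrite /lift_ev evC hornerC.
have DX : 'D_v (lift_ev 'X%:P) p = v ord0 (x_idx k l).
  rewrite (_ : lift_ev _ = fun q => q ord0 (x_idx k l)) ?derive_coord //.
  by apply/funext => q; rewrite /lift_ev evC hornerX.
have DY : 'D_v (lift_ev 'X) p = v ord0 (y_idx k l 0).
  rewrite (_ : lift_ev _ = fun q => q ord0 (y_idx k l 0)) ?derive_coord //.
  by apply/funext => q; rewrite /lift_ev evX.
elim/poly_ind: Q => [|Q q IH].
  rewrite -[0]/((0 : R)%:P%:P) cst dXC !derivC /lift_ev !evC horner0.
  by rewrite !mulr0 addr0.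
have Dq : 'D_v (lift_ev q%:P) p = v ord0 (x_idx k l) * lift_ev (dX q%:P) p.
  elim/poly_ind: q => [|q c hq].
    by rewrite cst dXC derivC /lift_ev evC horner0 mulr0.
  rewrite polyCD polyCM D M hq cst DX addr0.
  rewrite /lift_ev dXD dXM !dXC derivX -polyC1 derivC !(evD, evM, evC).
  by rewrite !(hornerX, hornerC, horner0); ring.
rewrite D M Dq IH DY /lift_ev derivD derivM derivX derivC dXD dXM dXX.
have ev1 x y : ev (1 : {poly {poly R}}) x y = 1 by rewrite -polyC1 evC hornerC.
by rewrite !(evD, evM, ev0, evX) ev1; ring.
Qed.

(** The shape left by the classification: z enters only the last component, affinely. *)
Definition poly_field a b c d : vfield3 R :=
  fun x y z => (ev a x y, ev b x y, ev c x y * z + ev d x y).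

Lemma poly_field_coord_poly a b c d : coord_poly3 k l (poly_field a b c d).
Proof.
split; [exact: lift_ev_coord_poly|exact: lift_ev_coord_poly|].
apply: coord_polyD; last exact: lift_ev_coord_poly.
by apply: coord_polyM; [exact: lift_ev_coord_poly|exact: coord_poly_coord].
Qed.

(** The rule for a coefficient of the bracket that depends on x and y. It also covers the
    coefficient of z, where the products c c' cancel. Stated for values, it reduces to [ring] on
    matrix entries. *)
Definition eq_bracket a b a' b' u u' w := forall x y : R, ev w x y =
  ev a x y * ev (dX u') x y + ev b x y * ev u'^`() x y
  - (ev a' x y * ev (dX u) x y + ev b' x y * ev u^`() x y).

Lemma eq_bracket_poly a b a' b' u u' w :
  w = a * dX u' + b * u'^`() - (a' * dX u + b' * u^`()) ->
  eq_bracket a b a' b' u u' w.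
Proof. by move=> -> x y; rewrite evD evN !evD !evM. Qed.

Lemma poly_field_bracket a b c d a' b' c' d' a2 b2 c2 d2 :
  field_curve_cond k l (poly_field a b c d) ->
  field_curve_cond k l (poly_field a' b' c' d') ->
  eq_bracket a b a' b' a a' a2 -> eq_bracket a b a' b' b b' b2 ->
  eq_bracket a b a' b' c c' c2 ->
  (forall x y, ev d2 x y =
     ev a x y * ev (dX d') x y + ev b x y * ev d'^`() x y + ev c' x y * ev d x y
     - (ev a' x y * ev (dX d) x y + ev b' x y * ev d^`() x y
        + ev c x y * ev d' x y)) ->
  vf_bracket (prolong k l (poly_field a b c d)) (prolong k l (poly_field a' b' c' d'))
    = prolong k l (poly_field a2 b2 c2 d2).
Proof.
move=> cc cc' ha hb hc hd.
have pV := poly_field_coord_poly a b c d.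
have pW := poly_field_coord_poly a' b' c' d'.
have dV p := coord_poly_field_diff p (prolong_coord_poly hk hl pV).
have dW p := coord_poly_field_diff p (prolong_coord_poly hk hl pW).
have ex a1 b1 c1 d1 : (fun q : E => prolong k l (poly_field a1 b1 c1 d1) q ord0
    (x_idx k l)) = lift_ev a1 by apply/funext => q; rewrite prolong_x.
have ey a1 b1 c1 d1 : (fun q : E => prolong k l (poly_field a1 b1 c1 d1) q ord0
    (y_idx k l 0)) = lift_ev b1 by apply/funext => q; rewrite prolong_y.
have ez a1 b1 c1 d1 : (fun q : E => prolong k l (poly_field a1 b1 c1 d1) q ord0
    (z_idx k l 0)) = fun q => lift_ev c1 q * z_ 0 q + lift_ev d1 q.
  by apply/funext => q; rewrite prolong_z.
apply: prolong_bracket => // p; rewrite vf_bracketE //.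
- rewrite !ex !derive_lift_ev !prolong_x !prolong_y //=.
  by rewrite [RHS]ha /lift_ev /Defs.x_.
- rewrite !ey !derive_lift_ev !prolong_x !prolong_y //=.
  by rewrite [RHS]hb.
have Dz c1 d1 v : 'D_v (fun q => lift_ev c1 q * z_ 0 q + lift_ev d1 q) p =
    lift_ev c1 p * v ord0 (z_idx k l 0) + z_ 0 p * 'D_v (lift_ev c1) p
    + 'D_v (lift_ev d1) p.
  have dc := coord_poly_diff p (lift_ev_coord_poly c1).
  have dd := coord_poly_diff p (lift_ev_coord_poly d1).
  have dz : differentiable (@z_ R k l 0) p by exact: differentiable_coord.
  rewrite (deriveD_fun _ _ dd); last exact: differentiableM.
  by rewrite (deriveM_fun _ dc dz) derive_coord.
rewrite !ez !Dz !derive_lift_ev !prolong_z // !prolong_y // !prolong_x //=.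
rewrite /lift_fun /comp_z /= hc hd /lift_ev /=.
by ring.
Qed.

Lemma prolong_inj (V W : vfield3 R) : prolong k l V = prolong k l W ->
  forall x y z, V x y z = W x y z.
Proof.
move=> h x y z; have [hx hy hz] : [/\ (V x y z).1.1 = (W x y z).1.1,
    (V x y z).1.2 = (W x y z).1.2 & (V x y z).2 = (W x y z).2].
  have e i := congr1 (fun S : vfield R k l => S (base_pt k l x y z) ord0 i) h.
  split.
  - have := e (x_idx k l); rewrite /= !prolong_x /lift_fun /x_ /y_ /z_.
    by rewrite base_pt_x // base_pt_y // base_pt_z.
  - have := e (y_idx k l 0); rewrite /= !prolong_y //= /lift_fun /x_ /y_ /z_.
    by rewrite base_pt_x // base_pt_y // base_pt_z.
  - have := e (z_idx k l 0); rewrite /= !prolong_z //= /lift_fun /x_ /y_ /z_.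
    by rewrite base_pt_x // base_pt_y // base_pt_z.
by rewrite [LHS]surjective_pairing [(V x y z).1]surjective_pairing hx hy hz
  -!surjective_pairing.
Qed.

End PolynomialFields.

(** * Spans of prolonged generators *)

Section Spans.
Variable R : realType.

Lemma lin_span_cat (M : lmodType R) (s1 s2 : seq M) (v : M) :
  lin_span (s1 ++ s2) v <->
  exists v1 v2, [/\ lin_span s1 v1, lin_span s2 v2 & v = v1 + v2].
Proof.
split=> [[c ->]|[v1 [v2 [[c ->] [d ->] ->]]]].
  exists (\sum_(i < size s1) c i *: s1`_i).
  exists (\sum_(i < size s2) c (size s1 + i)%N *: s2`_i); split.
  - by exists c.
  - by exists (fun i => c (size s1 + i)%N).
  rewrite size_cat big_split_ord /=; congr (_ + _); apply: eq_bigr => i _.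
    by rewrite nth_cat ltn_ord.
  by rewrite nth_cat ltnNge leq_addr /= addKn.
exists (fun i => if (i < size s1)%N then c i else d (i - size s1)%N).
rewrite size_cat big_split_ord /=; congr (_ + _); apply: eq_bigr => i _.
  by rewrite nth_cat !ltn_ord.
by rewrite nth_cat ltnNge leq_addr /= addKn.
Qed.

Lemma prol_span_cat k l (s1 s2 : seq (vfield3 R)) (S : vfield R k l) :
  prol_span k l (s1 ++ s2) S <->
  exists S1 S2, [/\ prol_span k l s1 S1, prol_span k l s2 S2 & S = S1 + S2].
Proof. by rewrite /prol_span map_cat; exact: lin_span_cat. Qed.

Variables k l : nat.
Hypotheses (hk : (0 < k)%N) (hl : (0 < l)%N).
Local Notation E := (eqn_mfd R k l).
Implicit Types (V W : vfield3 R) (s : seq (vfield3 R)).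

Lemma vfield3_ext V W : (forall x y z, [/\ comp_x V x y z = comp_x W x y z,
  comp_y V x y z = comp_y W x y z & comp_z V x y z = comp_z W x y z]) -> V = W.
Proof.
move=> h; apply/funext => x; apply/funext => y; apply/funext => z.
have [h1 h2 h3] := h x y z; rewrite [LHS]surjective_pairing.
rewrite [(V x y z).1]surjective_pairing [RHS]surjective_pairing.
by rewrite [(W x y z).1]surjective_pairing; congr (_, _, _).
Qed.

Definition zero_field : vfield3 R := fun _ _ _ => (0, 0, 0).

Definition comb (c : nat -> R) s n : vfield3 R := fun x y z =>
  (\sum_(i < n) c i * comp_x (nth zero_field s i) x y z,
   \sum_(i < n) c i * comp_y (nth zero_field s i) x y z,
   \sum_(i < n) c i * comp_z (nth zero_field s i) x y z).

Lemma zero_field_coord_poly : coord_poly3 k l zero_field.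
Proof. by split; exact: coord_poly_cst. Qed.

Lemma prolong0 : prolong k l zero_field = 0.
Proof.
rewrite (@prolong_linear R k l hk hl (-1) zero_field zero_field).
- by rewrite scaleN1r addNr.
- exact: zero_field_coord_poly.
- exact: zero_field_coord_poly.
by move=> x y z; split; rewrite mulr0 addr0.
Qed.

Lemma prolong_comb (c : nat -> R) s n :
  (forall i, (i < n)%N -> coord_poly3 k l (nth zero_field s i)) ->
  \sum_(i < n) c i *: prolong k l (nth zero_field s i) = prolong k l (comb c s n).
Proof.
elim: n => [|n IH] hs.
  rewrite big_ord0 -prolong0; congr (prolong k l _).
  by apply: vfield3_ext => x y z; split; rewrite /comp_x /comp_y /comp_z /= big_ord0.
have pc : coord_poly3 k l (comb c s n).
  split; apply: coord_poly_sum => i; apply: coord_polyM; try exact: coord_poly_cst.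
  - by have [] := hs i (ltnW (ltn_ord i)).
  - by have [] := hs i (ltnW (ltn_ord i)).
  - by have [] := hs i (ltnW (ltn_ord i)).
rewrite big_ord_recr /= IH => [|i iN]; last by apply: hs; exact: ltnW.
rewrite addrC -(@prolong_linear R k l hk hl _ _ _ (comb c s n.+1)) //.
- exact: hs.
by move=> x y z; split; rewrite /comp_x /comp_y /comp_z /= big_ord_recr addrC.
Qed.

Lemma prol_spanP s (S : vfield R k l) :
  (forall i, (i < size s)%N -> coord_poly3 k l (nth zero_field s i)) ->
  prol_span k l s S <-> exists c : nat -> R, S = prolong k l (comb c s (size s)).
Proof.
move=> hs; have e (c : nat -> R) : \sum_(i < size [seq prolong k l V | V <- s])
    c i *: [seq prolong k l V | V <- s]`_i = prolong k l (comb c s (size s)).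
  rewrite -prolong_comb // size_map; apply: eq_bigr => i _.
  by rewrite (nth_map zero_field).
by split=> -[c ->]; exists c; rewrite e.
Qed.

Lemma coord_polyX (f : E -> R) n :
  coord_poly f -> coord_poly (fun p => f p ^+ n).
Proof.
move=> pf; elim: n => [|n IH].
  by apply: (coord_poly_ext (g := fun=> 1)) => [p|];
    [rewrite expr0|exact: coord_poly_cst].
apply: (coord_poly_ext (g := fun p => f p * f p ^+ n)) => [p|].
  by rewrite exprS.
exact: coord_polyM.
Qed.

Lemma x_coord_poly : coord_poly (@x_ R k l).
Proof. exact: coord_poly_coord. Qed.

Lemma y_coord_poly i : coord_poly (@y_ R k l i).
Proof. exact: coord_poly_coord. Qed.

Lemma z_coord_poly i : coord_poly (@z_ R k l i).
Proof. exact: coord_poly_coord. Qed.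

Let indices := [seq ij <- [seq (i, j) | i <- iota 0 l, j <- iota 0 l]
                     | (ij.1 + k.-1 * ij.2 <= l.-1)%N].

(** Stated for k > 1 because at k = 2 this family coincides with [gens1_iv]. The same bound gives j
    <= (k-1) j, so the enumeration with i, j < l misses no admissible monomial. *)
Lemma gens2_iii_spanP (S : vfield R k l) : (1 < k)%N -> prol_span k l (gens2_iii k l) S <->
  exists2 Q, weight_lt k.-1 l Q & S = prolong k l (poly_field 0 0 0 Q).
Proof.
move=> k1; have [ui mi] : uniq indices /\ forall i j,
    ((i, j) \in indices) = (i + k.-1 * j < l)%N.
  split; first by rewrite filter_uniq // allpairs_uniq ?iota_uniq // => -[? ?] [].
  move=> i j; rewrite mem_filter /=; apply/andP/idP => [[h _]|h].
    by rewrite -(prednK hl) ltnS.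
  split; first by rewrite -ltnS prednK.
  have jk : (j <= k.-1 * j)%N by rewrite leq_pmull //; lia.
  by apply/allpairsP; exists (i, j); rewrite !mem_iota; split=> //=; lia.
pose mon (ij : nat * nat) : {poly {poly R}} := ('X^(ij.1))%:P * 'X^(ij.2).
have evmon ij x y : ev (mon ij) x y = x ^+ ij.1 * y ^+ ij.2.
  rewrite /mon evM evC hornerXn; congr (_ * _).
  by rewrite /ev hornerXn -polyC_exp hornerC.
have coefmon (ij : nat * nat) (c : R) i j : (((c%:P%:P * mon ij)`_j)`_i : R) = c *+ ((i, j) == ij).
  case: ij => a b; rewrite !coefCM coefXn xpair_eqE /=.
  case: (j == b); last by rewrite mulr0 coef0 mulr0 andbF.
  by rewrite mulr1 coefXn andbT; case: (i == a); rewrite ?mulr1 ?mulr0.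
have gE i : (i < size indices)%N -> nth zero_field (gens2_iii k l) i =
    fun x y z => (0, 0, x ^+ (nth (0, 0) indices i).1 * y ^+ (nth (0, 0) indices i).2).
  by move=> iN; rewrite (nth_map (0, 0)%N).
have sz : size (@gens2_iii R k l) = size indices by rewrite size_map.
rewrite prol_spanP => [|i]; last first.
  rewrite sz => iN; rewrite gE //; split; try exact: coord_poly_cst.
  by apply: coord_polyM; apply: coord_polyX;
    [exact: x_coord_poly|exact: y_coord_poly].
have combE (c : nat -> R) : comb c (gens2_iii k l) (size indices) = poly_field 0 0 0
    (\sum_(n < size indices) (c n)%:P%:P * mon (nth (0, 0)%N indices n)).
  apply: vfield3_ext => x y z; rewrite /comp_x /comp_y /comp_z /= ev0.
  split; try by rewrite big1 // => i _; rewrite gE //= mulr0.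
  rewrite mul0r add0r ev_sum; apply: eq_bigr => i _; rewrite gE //= evM evmon.
  by rewrite !evC hornerC.
rewrite sz; split=> [[c ->]|[Q wQ ->]].
  exists (\sum_(n < size indices) (c n)%:P%:P * mon (nth (0, 0)%N indices n)).
    move=> i j ij; rewrite !coef_sum big1 // => n _; rewrite coefmon.
    case: eqP => // e; have : (i, j) \in indices by rewrite e mem_nth.
    by rewrite mi ltnNge ij.
  by rewrite combE.
exists (fun n => (Q`_(nth (0, 0)%N indices n).2)`_(nth (0, 0)%N indices n).1).
rewrite combE; congr (prolong _ _ (poly_field _ _ _ _)).
transitivity (\sum_(ij <- indices) ((Q`_ij.2)`_ij.1)%:P%:P * mon ij); last first.
  by rewrite (big_nth (0, 0)%N) big_mkord.
apply/polyP=> j; apply/polyP=> i; rewrite !coef_sum.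
under eq_bigr => ij _ do rewrite coefmon.
have [ij|ij] := ltnP (i + k.-1 * j) l.
  rewrite (bigD1_seq (i, j)) ?mi //= eqxx big1 ?addr0 // => u.
  by rewrite eq_sym => /negPf ->.
rewrite wQ // big_seq big1 // => u; case: eqP => // <-; rewrite mi.
by rewrite ltnNge ij.
Qed.

End Spans.

(** * The case k = 2 *)

Lemma poly_field_curve (R : realType) (k l : nat) (a b c d : {poly {poly R}}) :
  (1 < k)%N -> weight_lt k.-1 l d ->
  (forall y : {poly R}, (size y <= k)%N ->
    (size (b.[y] - y^`() * a.[y])%R <= k)%N /\
    forall z : {poly R}, (size z <= l)%N ->
      (size (c.[y] * z - z^`() * a.[y])%R <= l)%N) ->
  field_curve_cond k l (poly_field a b c d).
Proof.
move=> k1 wd h y z sy sz; have [hb hc] := h y sy; split.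
  exists (b.[y] - y^`() * a.[y]) => // t.
  by rewrite /comp_x /comp_y /= !ev_curve hornerD hornerN hornerM.
exists (c.[y] * z - z^`() * a.[y] + d.[y]) => [|t].
  apply: size_add_le; first exact: hc.
  by apply: size_weight_curve wd _; rewrite (leq_trans sy) //; lia.
rewrite /comp_x /comp_z /= !ev_curve !(hornerD, hornerN, hornerM); ring.
Qed.

Section ProjectiveCase.
Import Dehomogenization.
Variables (R : realType) (l : nat).
Hypothesis hl : (2 < l)%N.
Implicit Types A B : 'M[R]_3.

Lemma ord3_ind (P : 'I_3 -> Prop) : P o0 -> P o1 -> P o2 -> forall i, P i.
Proof.
move=> P0 P1 P2 i; case: (unliftP ord0 i) => [i' ->|-> //].
case: (unliftP ord0 i') => [i'' ->|-> //].
by case: (unliftP ord0 i'') => [[]//|->].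
Qed.

Definition proj_form A j : {poly {poly R}} :=
  (A o0 j)%:P%:P * 'X%:P + (A o1 j)%:P%:P * 'X + (A o2 j)%:P%:P.

Definition proj_x A := proj_form A o0 - 'X%:P * proj_form A o2.
Definition proj_y A := proj_form A o1 - 'X * proj_form A o2.
Definition proj_z A := - (l.-1%:R * proj_form A o2).

(* gl(3) acts by linear vector fields on R^3; in the chart (x, y, 1), with z a
   function of homogeneity l - 1, this is the projective action. *)
Definition proj_field A d := poly_field (proj_x A) (proj_y A) (proj_z A) d.

Lemma ev_proj_form A j x y :
  ev (proj_form A j) x y = A o0 j * x + A o1 j * y + A o2 j.
Proof. by rewrite !(evD, evM, evX, evC, hornerC, hornerX). Qed.

Lemma ev_natr n (x y : R) : ev n%:R x y = n%:R.
Proof. by rewrite -!polyC_natr evC hornerC. Qed.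

Lemma ev_proj_x A x y : ev (proj_x A) x y =
  A o0 o0 * x + A o1 o0 * y + A o2 o0 - x * (A o0 o2 * x + A o1 o2 * y + A o2 o2).
Proof. by rewrite /proj_x evD evN evM !ev_proj_form evC hornerX. Qed.

Lemma ev_proj_y A x y : ev (proj_y A) x y =
  A o0 o1 * x + A o1 o1 * y + A o2 o1 - y * (A o0 o2 * x + A o1 o2 * y + A o2 o2).
Proof. by rewrite /proj_y evD evN evM !ev_proj_form evX. Qed.

Lemma ev_proj_z A x y : ev (proj_z A) x y =
  - (l.-1%:R * (A o0 o2 * x + A o1 o2 * y + A o2 o2)).
Proof. by rewrite /proj_z evN evM ev_proj_form ev_natr. Qed.

Lemma proj_curve A d : weight_lt 1 l d ->
  field_curve_cond 2 l (proj_field A d).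
Proof.
move=> wd; apply: poly_field_curve => // y sy.
pose L j := (proj_form A j).[y].
have sL j : (size (L j) <= 2)%N.
  rewrite /L /proj_form !hornerE.
  have sC (c : R) (p : {poly R}) : (size p <= 2)%N -> (size (c%:P * p)%R <= 2)%N.
    by move=> sp; rewrite mul_polyC (leq_trans (size_scale_leq _ _)).
  apply: size_add_le; last by rewrite (leq_trans (size_polyC_leq1 _)).
  by apply: size_add_le; apply: sC => //; rewrite size_polyX.
have ex : (proj_x A).[y] = L o0 - 'X * L o2.
  by rewrite /proj_x hornerD hornerN hornerM hornerC.
have ey : (proj_y A).[y] = L o1 - y * L o2.
  by rewrite /proj_y hornerD hornerN hornerM hornerX.
have ez : (proj_z A).[y] = - (l.-1%:R * L o2).
  by rewrite /proj_z hornerN hornerM -polyC_natr hornerC.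
split=> [|z sz]; rewrite ex ?ey ?ez.
  (* For y the cancellation of [size_projective] is used with n = 2. *)
  rewrite (_ : _ - _ = L o1 - (1%:R * L o2 * y + y^`() * (L o0 - 'X * L o2)));
    last by ring.
  by apply: size_sub_le => //; exact: (@size_projective _ 2).
rewrite -mulNr -size_polyN opprB addrC mulNr mulNr opprK.
by apply: size_projective => //; lia.
Qed.

Lemma proj_linear a A B d e w : 
  (forall x y, ev w x y = a * ev d x y + ev e x y) ->
  prolong 2 l (proj_field (a *: A + B) w) =
    a *: prolong 2 l (proj_field A d) + prolong 2 l (proj_field B e).
Proof.
move=> hw; apply: prolong_linear; [by []|by lia|exact: poly_field_coord_poly..|].
move=> x y z; split; rewrite /comp_x /comp_y /comp_z /=.
- by rewrite !ev_proj_x !mxE; ring.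
- by rewrite !ev_proj_y !mxE; ring.
- by rewrite !ev_proj_z hw !mxE; ring.
Qed.

(** Scalar matrices do not move (x, y) and are detected by the z-coefficient, which recovers the
    third column as l - 1 is nonzero; the x and y components then give the other two. *)
Lemma proj_inj A B d e :
  prolong 2 l (proj_field A d) = prolong 2 l (proj_field B e) -> A = B /\ d = e.
Proof.
move=> h; have {}h x y z : proj_field A d x y z = proj_field B e x y z.
  by apply: prolong_inj h _ _ _ => //; lia.
have hx x y := congr1 (fun v => v.1.1) (h x y 0).
have hy x y := congr1 (fun v => v.1.2) (h x y 0).
have hz x y z := congr1 snd (h x y z).
have ed : d = e.
  by apply: ev_inj => x y; have := hz x y 0; rewrite /= !mulr0 !add0r.
split=> //; have l0 : l.-1%:R != 0 :> R by rewrite pnatr_eq0; lia.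
have zf x y : A o0 o2 * x + A o1 o2 * y + A o2 o2 =
              B o0 o2 * x + B o1 o2 * y + B o2 o2.
  have := hz x y 1; rewrite /= ed !mulr1 => /addIr.
  by rewrite !ev_proj_z => /oppr_inj /(mulfI l0).
have lin (a0 a1 a2 b0 b1 b2 : R) :
    (forall x y, a0 * x + a1 * y + a2 = b0 * x + b1 * y + b2) ->
    [/\ a0 = b0, a1 = b1 & a2 = b2].
  move=> H; have H00 := H 0 0; have H10 := H 1 0; have H01 := H 0 1.
  rewrite !mulr0 !add0r in H00; rewrite !(mulr0, mulr1, add0r, addr0) H00 in H10 H01.
  by split=> //; [exact: addIr H10|exact: addIr H01].
have [e02 e12 e22] := lin _ _ _ _ _ _ zf.
have [e00 e10 e20] : [/\ A o0 o0 = B o0 o0, A o1 o0 = B o1 o0 & A o2 o0 = B o2 o0].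
  by apply: lin => x y; have := hx x y; rewrite /= !ev_proj_x zf => /addIr.
have [e01 e11 e21] : [/\ A o0 o1 = B o0 o1, A o1 o1 = B o1 o1 & A o2 o1 = B o2 o1].
  by apply: lin => x y; have := hy x y; rewrite /= !ev_proj_y zf => /addIr.
by apply/matrixP; apply: ord3_ind; apply: ord3_ind.
Qed.

Lemma ev_proj_derivatives A x y :
  let L j := A o0 j * x + A o1 j * y + A o2 j in
  [/\ ev (dX (proj_x A)) x y = A o0 o0 - (L o2 + x * A o0 o2),
      ev (proj_x A)^`() x y = A o1 o0 - x * A o1 o2,
      ev (dX (proj_y A)) x y = A o0 o1 - y * A o0 o2 &
      ev (proj_y A)^`() x y = A o1 o1 - (L o2 + y * A o1 o2)] /\
  [/\ ev (dX (proj_z A)) x y = - (l.-1%:R * A o0 o2) &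
      ev (proj_z A)^`() x y = - (l.-1%:R * A o1 o2)].
Proof.
move=> L.
have dXf j : dX (proj_form A j) = (A o0 j)%:P%:P.
  rewrite /proj_form !dXD !dXM !dXC dXX !derivC derivX !polyC0 polyC1.
  by rewrite !mul0r mulr0 mulr1 !add0r !addr0.
have dYf j : (proj_form A j)^`() = (A o1 j)%:P%:P.
  rewrite /proj_form !derivD !derivM !derivC derivX.
  by rewrite !mul0r mulr0 mulr1 !add0r !addr0.
have dXn n : dX (n%:R : {poly {poly R}}) = 0 by rewrite -!polyC_natr dXC derivC.
have dYn n : (n%:R : {poly {poly R}})^`() = 0 by rewrite -polyC_natr derivC.
rewrite /proj_x /proj_y /proj_z !dXB !derivB dXN derivN !dXM !derivM.
rewrite dXn dYn dXC dXX !derivX derivC !dXf !dYf polyC1 !mul0r !mul1r !add0r.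
by rewrite !evD !evN !evD !evM ev_natr !evC evX hornerX !hornerC.
Qed.

Lemma proj_bracket A B (f g : sym_space R 3 l.-1) :
  vf_bracket (prolong 2 l (proj_field A (deh_sym f)))
             (prolong 2 l (proj_field B (deh_sym g))) =
  prolong 2 l (proj_field (lie_bracket (A : gl R 3) B)
    (deh_sym (sym_pow R 3 l.-1 A g - sym_pow R 3 l.-1 B f))).
Proof.
have hw (h : sym_space R 3 l.-1) : weight_lt 1 l (deh_sym h).
  rewrite -[l in weight_lt 1 l](prednK (ltnW (ltnW hl))).
  exact: deh_sym_weight.
(* The commutator is replaced by a matrix known through its entries, which is all that the final
   [ring] calls use. *)
have [M MAB brE] : exists2 M : 'M[R]_3, M = lie_bracket (A : gl R 3) B &
    forall i j, M i j = A i o0 * B o0 j + A i o1 * B o1 j + A i o2 * B o2 j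
    - (B i o0 * A o0 j + B i o1 * A o1 j + B i o2 * A o2 j).
  exists (lie_bracket (A : gl R 3) B) => // i j.
  by rewrite /lie_bracket /= !mxE !big_ord_recl !big_ord0 /= !addr0 !addrA.
have deh_sub (u v : sym_space R 3 l.-1) : deh_sym (u - v) = deh_sym u - deh_sym v.
  by rewrite addrC -scaleN1r deh_sym_linear !polyCN !polyC1 mulN1r addrC.
have [cA cB] := (proj_curve A (hw f), proj_curve B (hw g)).
rewrite -MAB {MAB} deh_sub !deh_sym_act /proj_field in cA cB *.
have [EA EB] := (ev_proj_derivatives A, ev_proj_derivatives B).
have [[[EAx EAy] EAz] [[EBx EBy] EBz]] := ((ev_proj_x A, ev_proj_y A, ev_proj_z A),
  (ev_proj_x B, ev_proj_y B, ev_proj_z B)).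
have [[EMx EMy] EMz] := (ev_proj_x M, ev_proj_y M, ev_proj_z M).
move: (proj_x A) (proj_y A) (proj_z A) cA EA EAx EAy EAz => aA bA dA cA EA EAx EAy EAz.
move: (proj_x B) (proj_y B) (proj_z B) cB EB EBx EBy EBz => aB bB dB cB EB EBx EBy EBz.
move: (proj_x M) (proj_y M) (proj_z M) EMx EMy EMz => aM bM dM EMx EMy EMz.
apply: poly_field_bracket; [by []|by lia|exact: cA|exact: cB|..].
- move=> x y; have [[-> -> _ _] _] := EA x y; have [[-> -> _ _] _] := EB x y.
  by rewrite EMx EAx EAy EBx EBy !brE; ring.
- move=> x y; have [[_ _ -> ->] _] := EA x y; have [[_ _ -> ->] _] := EB x y.
  by rewrite EMy EAx EAy EBx EBy !brE; ring.
- move=> x y; have [_ [-> ->]] := EA x y; have [_ [-> ->]] := EB x y.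
  by rewrite EMz EAx EAy EBx EBy !brE; ring.
move=> x y; rewrite EAx EAy EAz EBx EBy EBz.
move: (deh_sym f) (deh_sym g) => P Q; rewrite !evD !evN.
move: (dX P) (dX Q) P^`() Q^`() => P1 Q1 P2 Q2.
by rewrite !evD !evM !evD !evM !evN !evM !evC !evX hornerX !hornerC ev_natr; ring.
Qed.

End ProjectiveCase.

Ltac coord_poly_fields :=
  split; rewrite /lift_fun /comp_x /comp_y /comp_z /= ?expr2;
  repeat first [exact: coord_poly_cst | exact: x_coord_poly | exact: y_coord_poly
    | exact: z_coord_poly | apply: coord_polyM | apply: coord_polyX].

Lemma matrix3_entries (R : nzRingType) (a00 a01 a02 a10 a11 a12 a20 a21 a22 : R) :
  exists A : 'M[R]_3,
  [/\ [/\ A o0 o0 = a00, A o0 o1 = a01 & A o0 o2 = a02],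
      [/\ A o1 o0 = a10, A o1 o1 = a11 & A o1 o2 = a12] &
      [/\ A o2 o0 = a20, A o2 o1 = a21 & A o2 o2 = a22]].
Proof.
exists (\matrix_(i, j) nth 0 (nth [::] [:: [:: a00; a01; a02];
  [:: a10; a11; a12]; [:: a20; a21; a22]] i) j).
by rewrite !mxE.
Qed.

Section ProjectiveAlgebra.
Variables (R : realType) (l : nat).
Hypothesis hl : (2 < l)%N.

Let l0 : (0 < l)%N. Proof. by lia. Qed.
Let N0 : l.-1%:R != 0 :> R. Proof. by rewrite pnatr_eq0; lia. Qed.

Lemma proj_gens_spanP S :
  prol_span 2 l (gens1_i ++ gens1_ii ++ gens1_iii l) S <->
  exists A : 'M[R]_3, S = prolong 2 l (proj_field l A 0).
Proof.
rewrite (prol_spanP (isT : 0 < 2)%N l0) => [|i]; last first.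
  by do 9?[case: i => [|i] //]; move=> _ /=; coord_poly_fields.
split=> [[c ->]|[A ->]].
  (* The z-coefficient fixes the third column, hence the division by l - 1; subtracting the same
     constant on the diagonal compensates for the terms - x L_2 and - y L_2 of the projective
     action. *)
  have [A [[A00 A01 A02] [A10 A11 A12] [A20 A21 A22]]] := matrix3_entries
    (c 2 - c 6 / l.-1%:R) (c 3) (- c 7) (c 4) (c 5 - c 6 / l.-1%:R) (- c 8)
    (c 0) (c 1) (- (c 6 / l.-1%:R)).
  exists A; congr (prolong _ _ _); apply: vfield3_ext => x y z.
  rewrite /comp_x /comp_y /comp_z /= ev_proj_x ev_proj_y ev_proj_z ev0 addr0.
  rewrite A00 A01 A02 A10 A11 A12 A20 A21 A22.
  rewrite !big_ord_recl !big_ord0 /= /bump !add1n /comp_x /comp_y /comp_z /=.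
  by split; have := N0; move: (l.-1%:R : R) => N hN; field.
exists (nth 0 [:: A o2 o0; A o2 o1; A o0 o0 - A o2 o2; A o0 o1; A o1 o0;
  A o1 o1 - A o2 o2; - (l.-1%:R * A o2 o2); - A o0 o2; - A o1 o2]).
congr (prolong _ _ _); apply: vfield3_ext => x y z.
rewrite /comp_x /comp_y /comp_z /= ev_proj_x ev_proj_y ev_proj_z ev0 addr0.
rewrite !big_ord_recl !big_ord0 /= /bump /comp_x /comp_y /comp_z /=.
by split; ring.
Qed.

Lemma gens1_iv_spanP S : prol_span 2 l (gens1_iv l) S <->
  exists f : sym_space R 3 l.-1, S = prolong 2 l (proj_field l 0 (deh_sym f)).
Proof.
have -> : gens1_iv l = gens2_iii 2 l :> seq (vfield3 R).
  rewrite /gens1_iv /gens2_iii; congr [seq _ | ij <- _].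
  by apply: eq_filter => ij; rewrite mul1n.
have proj0 Q : poly_field 0 0 0 Q = proj_field l (0 : 'M[R]_3) Q.
  apply: vfield3_ext => x y z; rewrite /comp_x /comp_y /comp_z /=.
  rewrite ev_proj_x ev_proj_y ev_proj_z !ev0 !mxE.
  by split; ring.
rewrite gens2_iii_spanP //; split=> [[Q wQ ->]|[f ->]].
  have [|f fQ] := @weight_deh_sym R l.-1 Q; first by rewrite prednK.
  by exists f; rewrite fQ proj0.
exists (deh_sym f); last by rewrite proj0.
by rewrite -[X in weight_lt _ X _](prednK l0); exact: deh_sym_weight.
Qed.

Lemma proj_symP S : sym_first_kind R 2 l S <->
  exists A (f : sym_space R 3 l.-1), S = prolong 2 l (proj_field l A (deh_sym f)).
Proof.
split=> [/(sym_prolong (isT : 0 < 2)%N l0)[V [-> cV hV]]|[A [f ->]]]; last first.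
  apply: prolong_sym => //; first exact: poly_field_coord_poly.
  apply: proj_curve => //; rewrite -[X in weight_lt _ X _](prednK l0).
  exact: deh_sym_weight.
have [p0 [p1 [p2 [q0 [q1 [q2 [u [v [r [d [hx hy hz wd]]]]]]]]]]] :=
  curve_cond_2 hl cV hV.
have [A [[A00 A01 A02] [A10 A11 A12] [A20 A21 A22]]] := matrix3_entries
  (p1 - r / l.-1%:R) q1 (- u) p2 (q2 - r / l.-1%:R) (- v) p0 q0 (- (r / l.-1%:R)).
have [|f fd] := @weight_deh_sym R l.-1 d; first by rewrite prednK.
exists A, f; congr (prolong _ _ _); apply: vfield3_ext => x y z.
rewrite hx hy hz /comp_x /comp_y /comp_z /= ev_proj_x ev_proj_y ev_proj_z fd.
rewrite A00 A01 A02 A10 A11 A12 A20 A21 A22.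
by split; have := N0; move: (l.-1%:R : R) => N hN; field.
Qed.

Lemma projective_case :
  sym_first_kind R 2 l
    = prol_span 2 l (gens1_i ++ gens1_ii ++ gens1_iii l ++ gens1_iv l) /\
  exists phi : semidirect (sym_pow R 3 l.-1) -> vfield R 2 l,
    [/\ is_lie_iso (@vf_bracket R 2 l) (sym_first_kind R 2 l) phi,
        [set phi (A, 0) | A in [set: gl R 3]]
          = prol_span 2 l (gens1_i ++ gens1_ii ++ gens1_iii l) &
        [set phi (0, f) | f in [set: sym_space R 3 l.-1]]
          = prol_span 2 l (gens1_iv l)].
Proof.
split.
  have split_phi A (f : sym_space R 3 l.-1) : prolong 2 l (proj_field l A (deh_sym f)) =
      prolong 2 l (proj_field l A 0) + prolong 2 l (proj_field l 0 (deh_sym f)).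
    rewrite -[X in X + _]scale1r -(@proj_linear _ _ hl _ _ _ _ _ (deh_sym f)).
      by rewrite scale1r addr0.
    by move=> x y; rewrite ev0 mulr0 add0r.
  rewrite !catA -[(_ ++ _) ++ gens1_iii l]catA.
  apply/seteqP; split=> S.
    move=> /proj_symP[A [f ->]]; apply/prol_span_cat.
    exists (prolong 2 l (proj_field l A 0)).
    exists (prolong 2 l (proj_field l 0 (deh_sym f))); split=> //.
      by apply/proj_gens_spanP; exists A.
    by apply/gens1_iv_spanP; exists f.
  move=> /prol_span_cat[S1 [S2 [/proj_gens_spanP[A ->] /gens1_iv_spanP[f ->] ->]]].
  by apply/proj_symP; exists A, f; exact/esym/split_phi.
exists (fun x => prolong 2 l (proj_field l x.1 (deh_sym x.2))); split.
- split.
  + move=> a x y; apply: proj_linear => // u v /=.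
    by rewrite deh_sym_linear evD evM !evC hornerC.
  + move=> [A f] [B g] /= /(proj_inj hl)[-> fg].
    by rewrite (deh_sym_inj fg).
  + by move=> [A f] [B g]; rewrite proj_bracket.
  + apply/seteqP; split=> [S [[A f] _ <-]|S /proj_symP[A [f ->]]].
      by apply/proj_symP; exists A, f.
    by exists (A, f).
- apply/seteqP; split=> [S [A _ <-]|S /proj_gens_spanP[A ->]].
    by apply/proj_gens_spanP; exists A; rewrite /= deh_sym0.
  by exists A => //=; rewrite deh_sym0.
- apply/seteqP; split=> [S [f _ <-]|S /gens1_iv_spanP[f ->]].
    by apply/gens1_iv_spanP; exists f.
  by exists f.
Qed.

End ProjectiveAlgebra.

(** * The case k > 2 *)

Section GL2Case.
Variables (R : realType) (k l : nat).
Hypotheses (hk : (2 < k)%N) (hkl : (k < l)%N).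

Let k1 : (1 < k)%N. Proof. by lia. Qed.
Let k0 : (0 < k)%N. Proof. by lia. Qed.
Let l0 : (0 < l)%N. Proof. by lia. Qed.
Let kl : (k <= l)%N. Proof. by lia. Qed.
Let K0 : k.-1%:R != 0 :> R. Proof. by rewrite pnatr_eq0; lia. Qed.

Local Notation L := (semidirect (center_rep R k)).
Local Notation W := 'cV[R]_(\sum_(i < (l %/ k.-1).+1) (l - k.-1 * i)).

Definition gl2_poly_field (x : L) (Q : {poly {poly R}}) :=
  poly_field (op_x x) (op_y x) (op_z l x) Q.

Lemma ev_op_x (x : L) u v : ev (op_x x) u v =
  x.1.2 i0 i0 * u + x.1.2 i1 i0 - u * (x.1.2 i0 i1 * u + x.1.2 i1 i1).
Proof.
rewrite /op_x evC /gl2_field /gl2_form hornerD hornerN !hornerM !hornerD.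
by rewrite !hornerM hornerX !hornerC.
Qed.

Lemma ev_op_y (x : L) u v : ev (op_y x) u v =
  - (k.-1%:R * (x.1.2 i0 i1 * u + x.1.2 i1 i1)) * v + (col_poly x.2).[u].
Proof.
rewrite /op_y evD evM evN evM ev_natr !evC evX /gl2_form hornerD hornerM.
by rewrite hornerX !hornerC.
Qed.

Lemma ev_op_z (x : L) u v : ev (op_z l x) u v =
  x.1.1 - l.-1%:R * (x.1.2 i0 i1 * u + x.1.2 i1 i1).
Proof.
rewrite /op_z evC /gl2_form hornerD hornerN hornerM hornerD hornerM.
by rewrite -polyC_natr hornerX !hornerC.
Qed.

Lemma gl2_poly_curve (x : L) Q : weight_lt k.-1 l Q ->
  field_curve_cond k l (gl2_poly_field x Q).
Proof.
move=> wQ; apply: poly_field_curve => // y sy.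
have sf A j := @size_gl2_form R A j.
have ey : (op_y x).[y] = col_poly x.2 - k.-1%:R * gl2_form x.1.2 i1 * y.
  rewrite /op_y hornerD hornerM hornerN hornerM -polyC_natr !hornerC hornerX.
  by ring.
rewrite ey /op_x /op_z !hornerC; split=> [|z sz].
  rewrite -addrA -opprD; apply: size_sub_le; first exact: size_col_poly.
  exact: size_projective.
rewrite mulrBl -addrA -opprD; apply: size_sub_le; last exact: size_projective.
by rewrite mul_polyC (leq_trans (size_scale_leq _ _)).
Qed.

Lemma gl2_poly_linear a (x y : L) P Q T :
  (forall u v, ev T u v = a * ev P u v + ev Q u v) ->
  prolong k l (gl2_poly_field (a *: x + y) T) =
    a *: prolong k l (gl2_poly_field x P) + prolong k l (gl2_poly_field y Q).
Proof.
move=> hT; apply: prolong_linear => //; try exact: poly_field_coord_poly.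
have evZ (c : R) S u v : ev (c%:P%:P * S) u v = c * ev S u v.
  by rewrite evM !evC hornerC.
move=> u v w; split; rewrite /comp_x /comp_y /comp_z /=.
- by rewrite op_xZ evD evZ.
- by rewrite op_yZ evD evZ.
- by rewrite op_zZ hT evD evZ; ring.
Qed.

(** At y = 0 the y component gives the V_k part; its coefficient of y gives the second column, as k
    - 1 is nonzero. The x component then yields the first column and the z-coefficient the central
    part. *)
Lemma gl2_poly_inj (x y : L) P Q :
  prolong k l (gl2_poly_field x P) = prolong k l (gl2_poly_field y Q) ->
  x = y /\ P = Q.
Proof.
move=> h; have {}h u v w := prolong_inj k0 l0 h u v w.
have hx u v := congr1 (fun v => v.1.1) (h u v 0).
have hy u v := congr1 (fun v => v.1.2) (h u v 0).
have hz u v w := congr1 snd (h u v w).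
have PQ : P = Q.
  by apply: ev_inj => u v; have := hz u v 0; rewrite /= !mulr0 !add0r.
have hc : x.2 = y.2.
  apply: (can_inj (@col_polyK R k)); apply: horner_eq => u.
  by have := hy u 0; rewrite /= !ev_op_y !mulr0 !add0r.
have hf u : x.1.2 i0 i1 * u + x.1.2 i1 i1 = y.1.2 i0 i1 * u + y.1.2 i1 i1.
  have := hy u 1; rewrite /= !ev_op_y hc !mulr1 => /addIr/oppr_inj.
  by move/(mulfI K0).
have lin (a b a' b' : R) : (forall u, a * u + b = a' * u + b') -> a = a' /\ b = b'.
  move=> e; have e0 := e 0; have e1 := e 1.
  by move: e1; rewrite !mulr0 !add0r in e0; rewrite e0 !mulr1 => /addIr.
have [h01 h11] := lin _ _ _ _ hf.
have [h00 h10] : x.1.2 i0 i0 = y.1.2 i0 i0 /\ x.1.2 i1 i0 = y.1.2 i1 i0.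
  by apply: lin => u; have := hx u 0; rewrite /= !ev_op_x hf => /addIr.
have hs : x.1.1 = y.1.1.
  by have := hz 0 0 1; rewrite /= !ev_op_z PQ hf !mulr1 => /addIr/addIr.
split=> //; move: x y hc h01 h11 h00 h10 hs {h hx hy hz hf}.
move=> [[s A] v] [[t B] u] /= -> h01 h11 h00 h10 ->.
congr (_, _, _); apply/matrixP; apply: ord2_ind; exact: ord2_ind.
Qed.

Lemma gl2_poly_bracket (x y : L) (f g : W) :
  vf_bracket (prolong k l (gl2_poly_field x (enc f)))
             (prolong k l (gl2_poly_field y (enc g))) =
  prolong k l (gl2_poly_field (lie_bracket x y)
    (enc (sigma R k1 kl x g - sigma R k1 kl y f))).
Proof.
apply: poly_field_bracket => //.
- by apply: gl2_poly_curve; exact: enc_weight.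
- by apply: gl2_poly_curve; exact: enc_weight.
- by apply: eq_bracket_poly; exact: op_x_bracket.
- by apply: eq_bracket_poly; exact: op_y_bracket.
- by apply: eq_bracket_poly; exact: op_z_bracket.
move=> u v; rewrite addrC -scaleN1r enc_linear /= !enc_sigma // /op /field_op.
rewrite !polyCN !polyC1 mulN1r; move: (enc f) (enc g) => P Q.
move: (op_x x) (op_x y) (op_y x) (op_y y) (op_z l x) (op_z l y).
move: (dX P) (dX Q) P^`() Q^`() => P1 Q1 P2 Q2 a b c d e h.
by rewrite !(evD, evN, evM); ring.
Qed.

Lemma gens2_i_spanP S : prol_span k l (gens2_i k l) S <->
  exists a : lie_prod (lie_abelian R^o) (gl R 2),
    S = prolong k l (gl2_poly_field (a, 0) 0).
Proof.
rewrite (prol_spanP k0 l0) => [|i]; last first.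
  by do 5?[case: i => [|i] //]; move=> _ /=; coord_poly_fields.
split=> [[c ->]|[[s A] ->]].
  (* The field y d/dy comes from a scalar matrix, which scales z as well; the central component
     chosen below removes that extra scaling. *)
  have [A [A00 A01 A10 A11]] := matrix2_entries (c 1 - c 3 / k.-1%:R) (- c 2)
    (c 0) (- (c 3 / k.-1%:R)).
  exists (c 4 - l.-1%:R * (c 3 / k.-1%:R), A); congr (prolong _ _ _).
  apply: vfield3_ext => x y z; rewrite /comp_x /comp_y /comp_z /=.
  rewrite ev_op_x ev_op_y ev_op_z ev0 /= col_poly0 horner0 A00 A01 A10 A11.
  rewrite !big_ord_recl !big_ord0 /= /bump !add1n /comp_x /comp_y /comp_z /=.
  by split; have := K0; move: (k.-1%:R : R) (l.-1%:R : R) => M N hM; field.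
exists (nth 0 [:: A i1 i0; A i0 i0 - A i1 i1; - A i0 i1; - (k.-1%:R * A i1 i1);
  s - l.-1%:R * A i1 i1]).
congr (prolong _ _ _); apply: vfield3_ext => x y z.
rewrite /comp_x /comp_y /comp_z /= ev_op_x ev_op_y ev_op_z ev0 /= col_poly0.
rewrite horner0 !big_ord_recl !big_ord0 /= /bump /comp_x /comp_y /comp_z /=.
by split; ring.
Qed.

Lemma gens2_ii_spanP S : prol_span k l (gens2_ii k) S <->
  exists v : 'cV[R]_k, S = prolong k l (gl2_poly_field ((0, 0), v) 0).
Proof.
have sz : size (gens2_ii k : seq (vfield3 R)) = k by rewrite size_map size_iota.
have gE i : (i < k)%N ->
    nth (@zero_field R) (gens2_ii k) i = fun x y z => (0, x ^+ i, 0).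
  by move=> ik; rewrite (nth_map 0%N) ?size_iota // nth_iota.
rewrite (prol_spanP k0 l0) => [|i]; last by rewrite sz => /gE ->; coord_poly_fields.
have fE (v : 'cV[R]_k) : prolong k l (gl2_poly_field ((0, 0), v) 0) =
    prolong k l (fun x y z => (0, (col_poly v).[x], 0)).
  congr (prolong _ _ _); apply: vfield3_ext => x y z.
  rewrite /comp_x /comp_y /comp_z /= ev_op_x ev_op_y ev_op_z ev0 /= !mxE.
  by split; ring.
have cE (c : nat -> R) : prolong k l (comb c (gens2_ii k) k) =
    prolong k l (fun x y z => (0, (\poly_(i < k) c i).[x], 0)).
  congr (prolong _ _ _); apply: vfield3_ext => x y z.
  rewrite /comp_x /comp_y /comp_z /=; split.
  - by rewrite big1 // => i _; rewrite gE //= mulr0.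
  - by rewrite horner_poly; apply: eq_bigr => i _; rewrite gE.
  - by rewrite big1 // => i _; rewrite gE //= mulr0.
rewrite sz; split=> [[c ->]|[v ->]].
  by exists (poly_col k (\poly_(i < k) c i)); rewrite cE fE poly_colK ?size_poly.
exists (fun i => (col_poly v)`_i); rewrite cE fE.
congr (prolong _ _ _); apply: vfield3_ext => x y z; split=> //.
rewrite /comp_y /= horner_poly (@horner_coef_wide _ k) ?size_col_poly //.
Qed.

Lemma gens2_iii_encP S : prol_span k l (gens2_iii k l) S <->
  exists w : W, S = prolong k l (gl2_poly_field ((0, 0), 0) (enc w)).
Proof.
have fE Q : poly_field 0 0 0 Q = gl2_poly_field ((0, 0), 0) Q.
  apply: vfield3_ext => x y z; rewrite /comp_x /comp_y /comp_z /=.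
  rewrite ev_op_x ev_op_y ev_op_z !ev0 /= !mxE col_poly0 horner0.
  by split; ring.
rewrite gens2_iii_spanP //; split=> [[Q wQ ->]|[w ->]].
  exists (dec k l Q); rewrite (decK k1 kl wQ).
  exact: (congr1 (prolong k l) (fE Q)).
exists (enc w); first exact: enc_weight.
exact/esym/(congr1 (prolong k l) (fE (enc w))).
Qed.

Lemma gl2_poly_symP S : sym_first_kind R k l S <->
  exists (x : L) (w : W), S = prolong k l (gl2_poly_field x (enc w)).
Proof.
split=> [/(sym_prolong k0 l0)[V [-> cV hV]]|[x [w ->]]]; last first.
  apply: prolong_sym => //; first exact: poly_field_coord_poly.
  by apply: gl2_poly_curve => //; exact: enc_weight.
have hkl' : (2 < k < l)%N by rewrite hk.
have [p0 [p1 [p2 [q [r [b [d [hx hy hz [sb wd]]]]]]]]] := curve_cond_gt2 hkl' cV hV.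
have [A [A00 A01 A10 A11]] := matrix2_entries (p1 - q / k.-1%:R) (- p2)
    p0 (- (q / k.-1%:R)).
exists ((r - l.-1%:R * (q / k.-1%:R), A), poly_col k b), (dec k l d).
congr (prolong _ _ _); apply: vfield3_ext => x y z.
rewrite hx hy hz /comp_x /comp_y /comp_z /= ev_op_x ev_op_y ev_op_z /=.
rewrite (decK k1 kl wd) poly_colK // A00 A01 A10 A11.
by split; have := K0; move: (k.-1%:R : R) (l.-1%:R : R) => M N hM; field.
Qed.

Lemma gl2_poly_split (x : L) (w : W) :
  prolong k l (gl2_poly_field x (enc w)) =
  prolong k l (gl2_poly_field (x.1, 0) 0)
  + (prolong k l (gl2_poly_field ((0, 0), x.2) 0)
     + prolong k l (gl2_poly_field ((0, 0), 0) (enc w))).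
Proof.
have add (y z : L) : prolong k l (gl2_poly_field (1 *: y + z) (enc w)) =
    prolong k l (gl2_poly_field y 0) + prolong k l (gl2_poly_field z (enc w)).
  rewrite (@gl2_poly_linear 1 y z 0 (enc w) (enc w)) ?scale1r // => u v.
  by rewrite ev0 mulr0 add0r.
have e : x = 1 *: ((x.1, 0) : L) + (1 *: (((0, 0), x.2) : L) + ((0, 0), 0)).
  rewrite !scale1r; case: x => [[s A] v].
  exact/esym/(f_equal2 pair (f_equal2 pair (etrans (congr1 _ (addr0 0)) (addr0 s))
    (etrans (congr1 _ (addr0 0)) (addr0 A))) (etrans (add0r _) (addr0 v))).
apply: etrans (congr1 (fun x => prolong k l (gl2_poly_field x (enc w))) e) _.
apply: etrans (add (x.1, 0) _) _.
exact: (congr1 (+%R _) (add ((0, 0), x.2) ((0, 0), 0))).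
Qed.

Lemma gl2_case :
  sym_first_kind R k l
    = prol_span k l (gens2_i k l ++ gens2_ii k ++ gens2_iii k l) /\
  exists phi : semidirect (sigma R k1 kl) -> vfield R k l,
    [/\ is_lie_iso (@vf_bracket R k l) (sym_first_kind R k l) phi,
        [set phi ((a, 0), 0)
           | a in [set: lie_prod (lie_abelian R^o) (gl R 2)]]
          = prol_span k l (gens2_i k l),
        [set phi ((0, v), 0) | v in [set: 'cV[R]_k]]
          = prol_span k l (gens2_ii k) &
        [set phi (0, w) | w in [set: W]] = prol_span k l (gens2_iii k l)].
Proof.
have enc0 : enc (0 : W) = 0.
  have := enc_linear (-1) (0 : W) 0; rewrite scaler0 addr0 !polyCN !polyC1.
  by rewrite mulN1r addNr.
split.
  apply/seteqP; split=> S.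
    move=> /gl2_poly_symP[x [w ->]]; rewrite gl2_poly_split.
    apply/prol_span_cat; eexists; eexists; split; last by [].
      by apply/gens2_i_spanP; exists x.1.
    apply/prol_span_cat; eexists; eexists; split; last by [].
      by apply/gens2_ii_spanP; exists x.2.
    by apply/gens2_iii_encP; exists w.
  move=> /prol_span_cat[S1 [S2 [/gens2_i_spanP[a ->] + ->]]].
  move=> /prol_span_cat[S3 [S4 [/gens2_ii_spanP[v ->] /gens2_iii_encP[w ->] ->]]].
  apply/gl2_poly_symP; exists (a, v), w; exact/esym/gl2_poly_split.
exists (fun x => prolong k l (gl2_poly_field x.1 (enc x.2))); split.
- split.
  + move=> a x y; apply: gl2_poly_linear => u v /=.
    by rewrite enc_linear evD evM !evC hornerC.
  + move=> [x f] [y g] /= /gl2_poly_inj[-> fg].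
    by rewrite (can_inj (@encK R k l) fg).
  + by move=> [x f] [y g]; rewrite gl2_poly_bracket.
  + apply/seteqP; split=> [S [[x f] _ <-]|S /gl2_poly_symP[x [f ->]]].
      by apply/gl2_poly_symP; exists x, f.
    by exists (x, f).
- apply/seteqP; split=> [S [a _ <-]|S /gens2_i_spanP[a ->]].
    by apply/gens2_i_spanP; exists a; rewrite /= enc0.
  by exists a => //=; rewrite enc0.
- apply/seteqP; split=> [S [v _ <-]|S /gens2_ii_spanP[v ->]].
    by apply/gens2_ii_spanP; exists v; rewrite /= enc0.
  by exists v => //=; rewrite enc0.
- apply/seteqP; split=> [S [w _ <-]|S /gens2_iii_encP[w ->]].
    by apply/gens2_iii_encP; exists w.
  by exists w.
Qed.

End GL2Case.

Theorem proposition1 (R : realType) (k l : nat) (hk : (2 <= k)%N)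
    (hkl : (k < l)%N) :
  (k = 2%N ->
     sym_first_kind R k l
       = prol_span k l (gens1_i ++ gens1_ii ++ gens1_iii l ++ gens1_iv l) /\
     exists phi : semidirect (sym_pow R 3 l.-1) -> vfield R k l,
       [/\ is_lie_iso (@vf_bracket R k l) (sym_first_kind R k l) phi,
           [set phi (A, 0) | A in [set: gl R 3]]
             = prol_span k l (gens1_i ++ gens1_ii ++ gens1_iii l) &
           [set phi (0, f) | f in [set: sym_space R 3 l.-1]]
             = prol_span k l (gens1_iv l)]) /\
  ((2 < k)%N ->
     sym_first_kind R k l
       = prol_span k l (gens2_i k l ++ gens2_ii k ++ gens2_iii k l) /\
     exists V : forall r : nat, lieRep (gl R 2) 'cV[R]_r,
       (forall r, (0 < r)%N -> irreducible_rep (V r)) /\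
     exists rho : lieRep (lie_prod (lie_abelian R^o) (gl R 2)) 'cV[R]_k,
       (forall A v, rho (0, A) v = V k A v) /\
     exists sigma : lieRep (semidirect rho)
         'cV[R]_(\sum_(i < (l %/ k.-1).+1) (l - k.-1 * i)),
       (forall A w, sigma ((0, A), 0) w
          = rep_sum (fun i : 'I_(l %/ k.-1).+1 => V (l - k.-1 * i)%N) A w) /\
     exists phi : semidirect sigma -> vfield R k l,
       [/\ is_lie_iso (@vf_bracket R k l) (sym_first_kind R k l) phi,
           [set phi ((a, 0), 0)
              | a in [set: lie_prod (lie_abelian R^o) (gl R 2)]]
             = prol_span k l (gens2_i k l),
           [set phi ((0, v), 0) | v in [set: 'cV[R]_k]]
             = prol_span k l (gens2_ii k) &
           [set phi (0, w)
              | w in [set: 'cV[R]_(\sum_(i < (l %/ k.-1).+1) (l - k.-1 * i))]]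
             = prol_span k l (gens2_iii k l)]).
Proof.
split=> [k2|k2]; first by subst k; exact: projective_case.
have [sym [phi hphi]] := gl2_case R k2 hkl.
split=> //; exists (gl2_rep R); split; first exact: gl2_rep_irreducible.
exists (center_rep R k); split=> //.
(* The type of [phi] determines the representation by unification. *)
eexists; split; last by exists phi.
by move=> A w; exact: sigma_rep_sum.
Qed.
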